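(* Let $\beta>1$ and $\mathbf{L}\in Q^2(\mathbb{D}^2)$. An analytic function $F\colon\mathbb{D}^2\to\mathbb{C}$ has bounded $\mathbf{L}$-index in joint variables if and only if there exists $p\in\mathbb{Z}_+$ such that for every $d\in(0,\beta]$ there exists $\eta(d)\in(0,d)$ such that for each $z^0\in\mathbb{D}^2$, for some $r=r(d,z^0)\in(\eta(d),d)$ and some $k^0=k^0(d,z^0)\le p$, the polynomial $p_{k^0}$ is a main polynomial in the diagonal power expansion of $F$ at $z^0$ on $\mathbb{T}^2\big(z^0,\frac{R}{\mathbf{L}(z^0)}\big)$ with $R=(r,r)$.
   Context: $\mathbb{D}^2=\{(z_1,z_2)\in\mathbb{C}^2:|z_1|<1,|z_2|<1\}$, $\mathbb{Z}_+=\{0,1,2,\dots\}$, $\mathbb{R}_+=[0,\infty)$. $\mathbf{L}(z)=(l_1(z),l_2(z))$, where each $l_j\colon\mathbb{D}^2\to\mathbb{R}_+$ is continuous and satisfies $l_j(z_1,z_2)>\beta/(1-|z_j|)$ for all $(z_1,z_2)\in\mathbb{D}^2$, $j=1,2$. For $z^0\in\mathbb{C}^2$ and $R=(r_1,r_2)\in\mathbb{R}_+^2$: $\mathbb{D}^2[z^0,R]=\{z:|z_j-z_j^0|\le r_j,\ j=1,2\}$, $\mathbb{T}^2(z^0,R)=\{z:|z_j-z_j^0|=r_j,\ j=1,2\}$, $\frac{R}{\mathbf{L}(z^0)}=\big(\frac{r_1}{l_1(z^0)},\frac{r_2}{l_2(z^0)}\big)$. $F^{(p,q)}=\frac{\partial^{p+q}F}{\partial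 z_1^p\partial z_2^q}$. An analytic $F\colon\mathbb{D}^2\to\mathbb{C}$ has bounded $\mathbf{L}$-index in joint variables if there is $n_0\in\mathbb{Z}_+$ such that for all $z\in\mathbb{D}^2$ and all $(p_1,p_2)\in\mathbb{Z}_+^2$: $\frac{|F^{(p_1,p_2)}(z)|}{p_1!p_2!\,l_1^{p_1}(z)l_2^{p_2}(z)}\le\max\{\frac{|F^{(k_1,k_2)}(z)|}{k_1!k_2!\,l_1^{k_1}(z)l_2^{k_2}(z)}:0\le k_1+k_2\le n_0\}$. $Q^2(\mathbb{D}^2)$ is the class of such $\mathbf{L}$ for which, for all $R=(r_1,r_2)\in[0,\beta]^2$ and $j=1,2$, $0<\lambda_{1,j}(R)\le\lambda_{2,j}(R)<\infty$, where $\lambda_{1,j}(R)=\inf_{z^0\in\mathbb{D}^2}\inf\{l_j(z)/l_j(z^0): z\in\mathbb{D}^2[z^0,R/\mathbf{L}(z^0)]\}$ and $\lambda_{2,j}(R)=\sup_{z^0\in\mathbb{D}^2}\sup\{l_j(z)/l_j(z^0): z\in\mathbb{D}^2[z^0,R/\mathbf{L}(z^0)]\}$. Diagonal power expansion: for $z^0\in\mathbb{D}^2$ write $F(z)=\sum_{k=0}^\infty p_k(z_1-z_1^0,z_2-z_2^0)$, where $p_k(w_1,w_2)=\sum_{j_1+j_2=k}b_{j_1,j_2}w_1^{j_1}w_2^{j_2}$ and $b_{j_1,j_2}=\frac{F^{(j_1,j_2)}(z^0)}{j_1!j_2!}$. For $R=(r_1,r_2)$, the polynomial $p_{k^0}$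 ($k^0\in\mathbb{Z}_+$) is a main polynomial of this expansion on $\mathbb{T}^2(z^0,R)$ if for every $z\in\mathbb{T}^2(z^0,R)$: $\big|\sum_{k\ne k^0}p_k(z_1-z_1^0,z_2-z_2^0)\big|\le\frac12\max\{|b_{j_1,j_2}|r_1^{j_1}r_2^{j_2}: j_1+j_2=k^0\}$. *)

(* Defs.v *)
From Stdlib Require Import Reals Lra Factorial.
From Coquelicot Require Import Coquelicot.
Open Scope R_scope.

Definition inD2 (z : C * C) : Prop := Cmod (fst z) < 1 /\ Cmod (snd z) < 1.

Definition D1 (F : C * C -> C) : C * C -> C :=
  fun z => C_derive (fun w => F (w, snd z)) (fst z).
Definition D2 (F : C * C -> C) : C * C -> C :=
  fun z => C_derive (fun w => F (fst z, w)) (snd z).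

Definition Dpq (F : C * C -> C) (p q : nat) : C * C -> C :=
  Nat.iter p D1 (Nat.iter q D2 F).

(* Analytic (holomorphic) on D^2: continuous and complex differentiable in each
   variable separately at every point of D^2 (Osgood's definition). *)
Definition analytic_D2 (F : C * C -> C) : Prop :=
  forall z, inD2 z ->
    continuous F z /\
    ex_derive (fun w => F (w, snd z)) (fst z) /\
    ex_derive (fun w => F (fst z, w)) (snd z).

Definition admissible_L (beta : R) (l1 l2 : C * C -> R) : Prop :=
  forall z, inD2 z ->
    continuous l1 z /\ continuous l2 z /\
    l1 z > beta / (1 - Cmod (fst z)) /\ l2 z > beta / (1 - Cmod (snd z)).

Definition in_polydisc (z0 : C * C) (s1 s2 : R) (z : C * C) : Prop :=
  Cmod (fst z - fst z0)%C <= s1 /\ Cmod (snd z - snd z0)%C <= s2.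

Definition in_torus (z0 : C * C) (s1 s2 : R) (z : C * C) : Prop :=
  Cmod (fst z - fst z0)%C = s1 /\ Cmod (snd z - snd z0)%C = s2.

(* Class Q^2(D^2): for all R=(r1,r2) in [0,beta]^2 and j=1,2,
   0 < lambda_{1,j}(R) <= lambda_{2,j}(R) < +oo, where lambda_{1,j}(R) (resp. lambda_{2,j}(R))
   is the infimum (resp. supremum) of l_j(z)/l_j(z0) over z0 in D^2 and
   z in D^2 /\ D^2[z0, R/L(z0)].  (Positivity of an infimum = existence of a positive
   lower bound; finiteness of a supremum = existence of an upper bound; the middle
   inequality is automatic as the sets are nonempty, but stated anyway via the bounds.) *)
Definition lambda_bounds (beta : R) (l1 l2 lj : C * C -> R) : Prop :=
  forall r1 r2, 0 <= r1 <= beta -> 0 <= r2 <= beta ->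
    (exists c, 0 < c /\
       forall z0 z, inD2 z0 -> inD2 z -> in_polydisc z0 (r1 / l1 z0) (r2 / l2 z0) z ->
         c <= lj z / lj z0) /\
    (exists C0,
       forall z0 z, inD2 z0 -> inD2 z -> in_polydisc z0 (r1 / l1 z0) (r2 / l2 z0) z ->
         lj z / lj z0 <= C0).

Definition Q2 (beta : R) (l1 l2 : C * C -> R) : Prop :=
  lambda_bounds beta l1 l2 l1 /\ lambda_bounds beta l1 l2 l2.

Definition Lterm (F : C * C -> C) (l1 l2 : C * C -> R) (z : C * C) (p1 p2 : nat) : R :=
  Cmod (Dpq F p1 p2 z) / (INR (fact p1) * INR (fact p2) * (l1 z ^ p1) * (l2 z ^ p2)).

(* Bounded L-index in joint variables; the max over the finite set
   {0 <= k1+k2 <= n0} is written out as "is bounded by one of its elements". *)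
Definition bounded_L_index (F : C * C -> C) (l1 l2 : C * C -> R) : Prop :=
  exists n0 : nat, forall z, inD2 z -> forall p1 p2 : nat,
    exists k1 k2 : nat, (k1 + k2 <= n0)%nat /\
      Lterm F l1 l2 z p1 p2 <= Lterm F l1 l2 z k1 k2.

Definition bcoef (F : C * C -> C) (z0 : C * C) (j1 j2 : nat) : C :=
  (Dpq F j1 j2 z0 / RtoC (INR (fact j1) * INR (fact j2)))%C.

Fixpoint pk_aux (F : C * C -> C) (z0 : C * C) (k : nat) (w : C * C) (j : nat) : C :=
  match j with
  | O => (bcoef F z0 0 k * Cpow (snd w) k)%C
  | S j' => (pk_aux F z0 k w j' +
             bcoef F z0 j (k - j) * Cpow (fst w) j * Cpow (snd w) (k - j))%C
  end.
Definition pk (F : C * C -> C) (z0 : C * C) (k : nat) (w : C * C) : C :=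
  pk_aux F z0 k w k.

Fixpoint maxupto (f : nat -> R) (n : nat) : R :=
  match n with
  | O => f O
  | S m => Rmax (maxupto f m) (f (S m))
  end.

Definition main_polynomial (F : C * C -> C) (z0 : C * C) (s1 s2 : R) (k0 : nat) : Prop :=
  forall z, in_torus z0 s1 s2 z ->
    exists S : C,
      is_series (fun k => if Nat.eqb k k0 then RtoC 0
                          else pk F z0 k ((fst z - fst z0)%C, (snd z - snd z0)%C)) S /\
      Cmod S <= / 2 * maxupto (fun j => Cmod (bcoef F z0 j (k0 - j)) * s1 ^ j * s2 ^ (k0 - j)) k0.

(* Main.v *)
(** If [F] has bounded index [N], then at each [z0] the maximal term of
    [A k * x ^ k], where [A k] is the largest normalised coefficient of degree
    [k], sits at an index at most [N] when [x <= 1].  This central index can only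
    decrease with [x], so along a geometric scale of ratio [rho] it is constant
    on two steps, and between them the central polynomial dominates all
    others, with geometric decay; [rho] depends on [N] only.

    Conversely, averaging over roots of unity on the torus extracts single
    coefficients from the sum of the non-main terms, so every term of degree
    [p + 1] is at most a constant times a term of degree at most [p]
    (Hayman's condition).  Along a segment from [z0] to a point of the polydisc
    of radius [beta / L z0], Hayman's condition closes the system of
    inequalities for the derivatives of order at most [p], and Gronwall's lemma
    bounds [F] on that polydisc by their size at [z0].  Cauchy's estimates then
    gain a factor [beta ^ k] in degree [k], and [beta > 1].

    Cauchy's theory is derived from complex differentiability alone: Goursat's
    lemma for [xi |-> f (c + exp xi) * exp (- xi)] on the rectangles
    [[ln t, ln s] x [0, 2 PI]] shows that the first Fourier coefficient of [f] on
    the circle of radius [s] is [2 PI s f'(c)].  This formula makes [f']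
    Lipschitz, hence differentiable, and integration by parts gives the
    formulas for higher derivatives. *)
Require Import Defs.
From Stdlib Require Import Reals Lra Lia Arith List ClassicalEpsilon FunctionalExtensionality.
From Coquelicot Require Import Coquelicot.
Open Scope R_scope.

(** * Complex differentiability *)

(** Every constant has to be uniform in the base point, and this shapes both halves. The same [r] in
    both coordinates, with radii [r / l1 z0] and [r / l2 z0], makes a monomial on the torus a
    normalised coefficient times the power of [r] given by its total degree, so each base point
    contributes a single sequence [A k]. A main polynomial is compared with its largest monomial and
    not with its values, which may vanish on the torus; hence upper bounds alone are needed. In the
    converse, [l1] and [l2] are merely continuous, so the normalised derivatives themselves cannot
    be differentiated along a segment: the weights are frozen at [z0], and the class Q^2 pays for
    each exchange of weights by a power of one constant. The modulus is not differentiable at zeros,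
    so Gronwall's lemma is applied to squared moduli. The resulting growth factor does not depend on
    [z0], hence the degree from which [beta ^ k] exceeds it is the same at all base points. *)

Definition cderiv (f : C -> C) (z l : C) : Prop :=
  forall eps, 0 < eps -> exists delta, 0 < delta /\
    forall w, Cmod (w - z)%C < delta ->
      Cmod (f w - f z - l * (w - z))%C <= eps * Cmod (w - z)%C.

Lemma is_derive_cderiv (f : C -> C) (z l : C) : is_derive f z l <-> cderiv f z l.
Proof.
split.
- intros [_ H] eps Heps.
  destruct (H z (fun P HP => HP) (mkposreal eps Heps)) as [d Hd].
  exists d; split; [apply cond_pos|].
  intros w Hw.
  specialize (Hd w Hw).
  change (Cmod (f w - f z - (w - z) * l)%C <= eps * Cmod (w - z)%C) in Hd.
  replace (l * (w - z))%C with ((w - z) * l)%C by ring. exact Hd.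
- intros H; split; [apply is_linear_scal_l|].
  intros x Hx. 
  apply (is_filter_lim_locally_unique (K := C_AbsRing) (V := AbsRing_NormedModule C_AbsRing)) in Hx. subst x.
  intros eps. destruct (H eps (cond_pos eps)) as [d [Hd1 Hd2]].
  exists (mkposreal d Hd1). intros w Hw. specialize (Hd2 w Hw).
  change (Cmod (f w - f z - (w - z) * l)%C <= eps * Cmod (w - z)%C).
  replace ((w - z) * l)%C with (l * (w - z))%C by ring. exact Hd2.
Qed.

(* Coquelicot's two normed modules on [C] (product balls, modulus balls) are not convertible. *)
Lemma is_derive_cderiv_abs (f : C -> C) (z l : C) : is_derive (K := C_AbsRing) (V := AbsRing_NormedModule C_AbsRing) f z l <-> cderiv f z l.
Proof.
split.
- intros [_ H] eps Heps.
  destruct (H z (fun P HP => HP) (mkposreal eps Heps)) as [d Hd].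
  exists d; split; [apply cond_pos|].
  intros w Hw.
  specialize (Hd w Hw).
  change (Cmod (f w - f z - (w - z) * l)%C <= eps * Cmod (w - z)%C) in Hd.
  replace (l * (w - z))%C with ((w - z) * l)%C by ring. exact Hd.
- intros H; split; [apply is_linear_scal_l|].
  intros x Hx. 
  apply (is_filter_lim_locally_unique (K := C_AbsRing) (V := AbsRing_NormedModule C_AbsRing)) in Hx. subst x.
  intros eps. destruct (H eps (cond_pos eps)) as [d [Hd1 Hd2]].
  exists (mkposreal d Hd1). intros w Hw. specialize (Hd2 w Hw).
  change (Cmod (f w - f z - (w - z) * l)%C <= eps * Cmod (w - z)%C).
  replace ((w - z) * l)%C with (l * (w - z))%C by ring. exact Hd2.
Qed.

Lemma ex_derive_cderiv (f : C -> C) (z : C) :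
  ex_derive f z <-> cderiv f z (C_derive f z).
Proof.
split.
- intros H. apply is_derive_cderiv. apply C_derive_correct; auto.
- intros H. exists (C_derive f z). now apply is_derive_cderiv.
Qed.

Lemma cderiv_unique (f : C -> C) (z l : C) : cderiv f z l -> C_derive f z = l.
Proof. intros H. apply is_C_derive_unique. now apply is_derive_cderiv. Qed.

Lemma Cmod_pair_le (x y : R) : Cmod (x, y) <= Rabs x + Rabs y.
Proof.
unfold Cmod; simpl.
apply Rsqr_incr_0_var; [|generalize (Rabs_pos x) (Rabs_pos y); lra].
rewrite Rsqr_sqrt by nra.
unfold Rsqr. generalize (Rabs_pos x) (Rabs_pos y); intros.
replace (x * (x * 1)) with (Rabs x * Rabs x) by (rewrite <- Rabs_mult, Rabs_pos_eq; nra).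
replace (y * (y * 1)) with (Rabs y * Rabs y) by (rewrite <- Rabs_mult, Rabs_pos_eq; nra).
nra.
Qed.

Lemma fst_le_Cmod (c : C) : Rabs (fst c) <= Cmod c.
Proof. apply re_le_Cmod. Qed.

Lemma snd_le_Cmod (c : C) : Rabs (snd c) <= Cmod c.
Proof.
generalize (re_le_Cmod (c * Ci)%C). rewrite re_mult_Ci, Cmod_mult, Rabs_Ropp.
replace (Cmod Ci) with 1. { rewrite Rmult_1_r; auto. }
unfold Cmod, Ci; simpl. replace (0 * (0 * 1) + 1 * (1 * 1)) with 1 by ring. now rewrite sqrt_1.
Qed.

Lemma ball_C_Cmod (z w : C) (d : R) :
  ball (M := C_UniformSpace) z d w -> Cmod (w - z)%C < 2 * d.
Proof.
intros [H1 H3].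
unfold ball in H1, H3; simpl in H1, H3. unfold AbsRing_ball, abs, minus, plus, opp in H1, H3; simpl in H1, H3.
eapply Rle_lt_trans; [apply (Cmod_pair_le (fst w - fst z) (snd w - snd z))|]. unfold Rminus. lra.
Qed.

Lemma continuous_C_eps {U : UniformSpace} (f : U -> C) (x : U) :
  continuous f x <->
  (forall eps, 0 < eps -> locally x (fun y => Cmod (f y - f x)%C < eps)).
Proof.
split.
- intros H eps Heps.
  assert (H2 : 0 < eps / 2) by lra.
  assert (Hl := proj1 (filterlim_locally f (f x)) H (mkposreal _ H2)).
  revert Hl; apply filter_imp. intros y Hy.
  apply ball_C_Cmod in Hy. simpl in Hy. lra.
- intros H. apply filterlim_locally. intros eps.
  specialize (H eps (cond_pos eps)). revert H; apply filter_imp.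
  intros y Hy. split; unfold ball; simpl; unfold AbsRing_ball, abs, minus, plus, opp; simpl.
  + eapply Rle_lt_trans; [|exact Hy]. apply (fst_le_Cmod (f y - f x)%C).
  + eapply Rle_lt_trans; [|exact Hy]. apply (snd_le_Cmod (f y - f x)%C).
Qed.

Lemma continuous_CC_eps (f : C -> C) (z : C) :
  continuous (T := C_UniformSpace) (U := C_UniformSpace) f z <->
  (forall eps, 0 < eps -> exists delta, 0 < delta /\
     forall w, Cmod (w - z)%C < delta -> Cmod (f w - f z)%C < eps).
Proof.
rewrite continuous_C_eps. split; intros H eps Heps; destruct (H eps Heps) as [d Hd].
- exists d; split; [apply cond_pos|]. intros w Hw; apply Hd. 
  now apply C_NormedModule_mixin_compat1.
- destruct Hd as [Hd1 Hd2]. assert (H2 : 0 < d / 2) by lra.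
  exists (mkposreal _ H2). intros w Hw; apply Hd2.
  apply ball_C_Cmod in Hw. simpl in Hw. lra.
Qed.

Lemma continuous_C2C_eps (F : C * C -> C) (z : C * C) :
  continuous F z <->
  (forall eps, 0 < eps -> exists delta, 0 < delta /\
     forall w, Cmod (fst w - fst z)%C < delta -> Cmod (snd w - snd z)%C < delta ->
       Cmod (F w - F z)%C < eps).
Proof.
rewrite continuous_C_eps. split; intros H eps Heps; destruct (H eps Heps) as [d Hd].
- exists d; split; [apply cond_pos|]. intros w Hw1 Hw2; apply Hd. 
  split; now apply C_NormedModule_mixin_compat1.
- destruct Hd as [Hd1 Hd2]. assert (H2 : 0 < d / 2) by lra.
  exists (mkposreal _ H2). intros w [H3 H4]; apply Hd2.
  + apply ball_C_Cmod in H3. simpl in H3. lra.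
  + apply ball_C_Cmod in H4. simpl in H4. lra.
Qed.

Lemma cderiv_continuous (f : C -> C) (z l : C) :
  cderiv f z l -> continuous (T := C_UniformSpace) (U := C_UniformSpace) f z.
Proof.
intros H. apply continuous_CC_eps. intros eps Heps.
destruct (H 1 Rlt_0_1) as [d [Hd1 Hd2]].
set (K := 1 + Cmod l). assert (HK : 0 < K) by (unfold K; generalize (Cmod_ge_0 l); lra).
exists (Rmin d (eps / K)); split.
{ apply Rmin_glb_lt; auto. apply Rdiv_lt_0_compat; auto. }
intros w Hw. 
assert (H1 : Cmod (w - z)%C < d) by (eapply Rlt_le_trans; [exact Hw|apply Rmin_l]).
assert (H2 : Cmod (w - z)%C < eps / K) by (eapply Rlt_le_trans; [exact Hw|apply Rmin_r]).
specialize (Hd2 w H1).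
replace (f w - f z)%C with ((f w - f z - l * (w - z)) + l * (w - z))%C by ring.
eapply Rle_lt_trans; [apply Cmod_triangle|]. rewrite Cmod_mult.
apply Rle_lt_trans with (K * Cmod (w - z)%C); [unfold K; lra|].
apply Rmult_lt_reg_r with (/ K); [now apply Rinv_0_lt_compat|].
replace (K * Cmod (w - z)%C * / K) with (Cmod (w - z)%C) by (field; lra). exact H2.
Qed.

(** * Goursat's lemma *)

Definition CInt (phi : R -> C) (a b : R) : C :=
  (RInt (fun t => fst (phi t)) a b, RInt (fun t => snd (phi t)) a b).

Definition ccont (phi : R -> C) (a b : R) : Prop :=
  forall t, a <= t <= b -> continuous (T := R_UniformSpace) (U := C_UniformSpace) phi t.

Lemma ccont_sub (phi : R -> C) (a b a' b' : R) :
  ccont phi a b -> a <= a' -> b' <= b -> ccont phi a' b'.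
Proof. intros H H1 H2 t Ht. apply H; lra. Qed.

Lemma ccont_fst (phi : R -> C) (a b : R) : a <= b -> ccont phi a b ->
  ex_RInt (fun t => fst (phi t)) a b.
Proof.
intros Hab H. apply (ex_RInt_continuous (V := R_CompleteNormedModule)).
rewrite Rmin_left, Rmax_right by auto. intros t Ht.
apply (continuous_comp (U := R_UniformSpace) (V := C_UniformSpace) (W := R_UniformSpace) phi fst).
- now apply H.
- apply continuous_fst.
Qed.

Lemma ccont_snd (phi : R -> C) (a b : R) : a <= b -> ccont phi a b ->
  ex_RInt (fun t => snd (phi t)) a b.
Proof.
intros Hab H. apply (ex_RInt_continuous (V := R_CompleteNormedModule)).
rewrite Rmin_left, Rmax_right by auto. intros t Ht.
apply (continuous_comp (U := R_UniformSpace) (V := C_UniformSpace) (W := R_UniformSpace) phi snd).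
- now apply H.
- apply continuous_snd.
Qed.

Lemma ccont_plus (phi psi : R -> C) (a b : R) :
  ccont phi a b -> ccont psi a b -> ccont (fun t => phi t + psi t)%C a b.
Proof.
intros H1 H2 t Ht.
apply (continuous_plus (U := R_UniformSpace) (V := C_R_NormedModule) phi psi); auto.
Qed.

Lemma ccont_mult (phi psi : R -> C) (a b : R) :
  ccont phi a b -> ccont psi a b -> ccont (fun t => phi t * psi t)%C a b.
Proof.
intros H1 H2 t Ht. apply continuous_C_eps. intros eps Heps.
assert (C1 := proj1 (continuous_C_eps _ _) (H1 t Ht)).
assert (C2 := proj1 (continuous_C_eps _ _) (H2 t Ht)).
set (K := Cmod (phi t) + Cmod (psi t) + 1).
assert (HK : 0 < K) by (unfold K; generalize (Cmod_ge_0 (phi t)) (Cmod_ge_0 (psi t)); lra).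
set (e := Rmin 1 (eps / K)).
assert (He : 0 < e) by (unfold e; apply Rmin_glb_lt; [lra|now apply Rdiv_lt_0_compat]).
assert (HeK : e * K <= eps).
{ apply Rle_trans with (eps / K * K). 
  - apply Rmult_le_compat_r; [lra|apply Rmin_r].
  - right; field; lra. }
assert (He1 : e <= 1) by apply Rmin_l.
generalize (filter_and _ _ (C1 e He) (C2 e He)). apply filter_imp. intros y [A B].
replace (phi y * psi y - phi t * psi t)%C with
  ((phi y - phi t) * (psi y - psi t) + (phi y - phi t) * psi t + phi t * (psi y - psi t))%C by ring.
eapply Rle_lt_trans; [apply Cmod_triangle|].
eapply Rle_lt_trans; [apply Rplus_le_compat_r, Cmod_triangle|].
rewrite !Cmod_mult.
generalize (Cmod_ge_0 (phi t)) (Cmod_ge_0 (psi t)) (Cmod_ge_0 (phi y - phi t)%C) (Cmod_ge_0 (psi y - psi t)%C).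
intros. unfold K in HeK.
nra.
Qed.

Lemma ccont_const (c : C) (a b : R) : ccont (fun _ => c) a b.
Proof. intros t _. apply continuous_const. Qed.

Lemma ccont_minus (phi psi : R -> C) (a b : R) :
  ccont phi a b -> ccont psi a b -> ccont (fun t => phi t - psi t)%C a b.
Proof.
intros H1 H2 t Ht.
apply (continuous_minus (U := R_UniformSpace) (V := C_R_NormedModule) phi psi); auto.
Qed.

Lemma CInt_ext (phi psi : R -> C) (a b : R) : a <= b ->
  (forall t, a <= t <= b -> phi t = psi t) -> CInt phi a b = CInt psi a b.
Proof.
intros Hab H. unfold CInt. f_equal; apply RInt_ext; rewrite Rmin_left, Rmax_right by auto;
intros; rewrite H; auto; lra.
Qed.

Lemma CInt_minus (phi psi : R -> C) (a b : R) : a <= b ->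
  ccont phi a b -> ccont psi a b ->
  CInt (fun t => phi t - psi t)%C a b = (CInt phi a b - CInt psi a b)%C.
Proof.
intros Hab H1 H2. unfold CInt, Cminus, Cplus, Copp; simpl. f_equal;
apply (RInt_minus (V := R_CompleteNormedModule)); auto using ccont_fst, ccont_snd.
Qed.

Lemma CInt_scal (c : C) (phi : R -> C) (a b : R) : a <= b ->
  ccont phi a b -> CInt (fun t => c * phi t)%C a b = (c * CInt phi a b)%C.
Proof.
intros Hab H. 
assert (E1 := ccont_fst _ _ _ Hab H). assert (E2 := ccont_snd _ _ _ Hab H).
unfold CInt, Cmult; simpl. f_equal.
- transitivity (minus (RInt (fun t => scal (fst c) (fst (phi t))) a b)
    (RInt (fun t => scal (snd c) (snd (phi t))) a b) : R).
  + symmetry. rewrite <- (RInt_minus (V := R_CompleteNormedModule)); [reflexivity| |];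
    now apply (ex_RInt_scal (V := R_CompleteNormedModule)).
  + rewrite !(RInt_scal (V := R_CompleteNormedModule)) by auto. reflexivity.
- transitivity (plus (RInt (fun t => scal (fst c) (snd (phi t))) a b)
    (RInt (fun t => scal (snd c) (fst (phi t))) a b) : R).
  + symmetry. rewrite <- (RInt_plus (V := R_CompleteNormedModule)); [reflexivity| |];
    now apply (ex_RInt_scal (V := R_CompleteNormedModule)).
  + rewrite !(RInt_scal (V := R_CompleteNormedModule)) by auto. reflexivity.
Qed.

Lemma CInt_Chasles (phi : R -> C) (a b c : R) : a <= b -> b <= c ->
  ccont phi a c -> (CInt phi a b + CInt phi b c)%C = CInt phi a c.
Proof.
intros Hab Hbc H. unfold CInt, Cplus; simpl.
assert (H1 : ccont phi a b) by (apply (ccont_sub phi a c); auto; lra).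
assert (H2 : ccont phi b c) by (apply (ccont_sub phi a c); auto; lra).
f_equal; apply (RInt_Chasles (V := R_CompleteNormedModule)); auto using ccont_fst, ccont_snd.
Qed.

(** The norm inequality is used for integrals with values in the product module, whose norm is
    [Cmod]; estimating the two components separately would lose the constant 1. *)
Lemma CInt_bound (phi : R -> C) (a b M : R) : a <= b -> ccont phi a b ->
  (forall t, a <= t <= b -> Cmod (phi t) <= M) -> Cmod (CInt phi a b) <= M * (b - a).
Proof.
intros Hab H HM. rewrite Cmod_norm.
apply (norm_RInt_le (V := prod_NormedModule R_AbsRing R_NormedModule R_NormedModule)
  phi (fun _ => M) a b _ (M * (b - a)) Hab).
- intros t Ht. rewrite <- Cmod_norm. now apply HM.
- apply (is_RInt_fct_extend_pair (U := R_NormedModule) (V := R_NormedModule) phi a b).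
  + apply (RInt_correct (V := R_CompleteNormedModule)). now apply ccont_fst.
  + apply (RInt_correct (V := R_CompleteNormedModule)). now apply ccont_snd.
- replace (M * (b - a)) with (scal (b - a) M) by (unfold scal; simpl; unfold mult; simpl; ring).
  apply (is_RInt_const (V := R_NormedModule)).
Qed.

Lemma RInt_affine (p q a b : R) :
  RInt (fun x => p + q * x) a b = p * (b - a) + q * (b * b - a * a) / 2.
Proof.
apply (is_RInt_unique (V := R_CompleteNormedModule)).
replace (p * (b - a) + q * (b * b - a * a) / 2)
  with (minus ((fun x => p * x + q * (x * x) / 2) b) ((fun x => p * x + q * (x * x) / 2) a))
  by (unfold minus, plus, opp; simpl; field).
apply (is_RInt_derive (V := R_CompleteNormedModule) (fun x => p * x + q * (x * x) / 2)).
- intros x _. auto_derive; auto. field.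
- intros x _. apply (continuous_plus (V := R_NormedModule)); [apply continuous_const|].
  apply (continuous_mult (K := R_AbsRing)); [apply continuous_const|apply continuous_id].
Qed.

Lemma continuous_pair_l (x y : R) :
  continuous (T := R_UniformSpace) (U := C_UniformSpace) (fun t => (t, y)) x.
Proof.
apply continuous_C_eps. intros eps Heps. exists (mkposreal eps Heps).
intros t Ht. unfold ball in Ht; simpl in Ht; unfold AbsRing_ball, abs, minus, plus, opp in Ht; simpl in Ht.
unfold Cminus, Cplus, Copp; simpl. eapply Rle_lt_trans; [apply Cmod_pair_le|].
rewrite Rplus_opp_r, Rabs_R0. lra.
Qed.

Lemma continuous_pair_r (x y : R) :
  continuous (T := R_UniformSpace) (U := C_UniformSpace) (fun t => (x, t)) y.
Proof.
apply continuous_C_eps. intros eps Heps. exists (mkposreal eps Heps).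
intros t Ht. unfold ball in Ht; simpl in Ht; unfold AbsRing_ball, abs, minus, plus, opp in Ht; simpl in Ht.
unfold Cminus, Cplus, Copp; simpl. eapply Rle_lt_trans; [apply Cmod_pair_le|].
rewrite Rplus_opp_r, Rabs_R0. lra.
Qed.

(** The contour integral of [h] along the boundary of the rectangle [[a, b] x [c, d]],
    counterclockwise, with opposite sides paired. *)
Definition circ (h : C -> C) (a b c d : R) : C :=
  (CInt (fun x => h (x, c)) a b - CInt (fun x => h (x, d)) a b
   + Ci * (CInt (fun y => h (b, y)) c d - CInt (fun y => h (a, y)) c d))%C.

Definition rcont (h : C -> C) (a b c d : R) : Prop :=
  forall x y, a <= x <= b -> c <= y <= d -> continuous (T := C_UniformSpace) (U := C_UniformSpace) h (x, y).

Lemma rcont_sub (h : C -> C) (a b c d a' b' c' d' : R) :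
  rcont h a b c d -> a <= a' -> b' <= b -> c <= c' -> d' <= d -> rcont h a' b' c' d'.
Proof. intros H H1 H2 H3 H4 x y Hx Hy. apply H; lra. Qed.

Lemma rcont_h (h : C -> C) (a b c d y : R) :
  rcont h a b c d -> c <= y <= d -> ccont (fun x => h (x, y)) a b.
Proof.
intros H Hy t Ht.
apply (continuous_comp (U := R_UniformSpace) (V := C_UniformSpace) (fun x => (x, y)) h).
- apply continuous_pair_l.
- now apply H.
Qed.

Lemma rcont_v (h : C -> C) (a b c d x : R) :
  rcont h a b c d -> a <= x <= b -> ccont (fun y => h (x, y)) c d.
Proof.
intros H Hy t Ht.
apply (continuous_comp (U := R_UniformSpace) (V := C_UniformSpace) (fun y => (x, y)) h).
- apply continuous_pair_r.
- now apply H.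
Qed.

Lemma circ_minus (h k : C -> C) (a b c d : R) : a <= b -> c <= d ->
  rcont h a b c d -> rcont k a b c d ->
  circ (fun z => h z - k z)%C a b c d = (circ h a b c d - circ k a b c d)%C.
Proof.
intros Hab Hcd Hh Hk. unfold circ.
rewrite !CInt_minus; try ring; auto;
try (eapply rcont_h; eauto; lra); eapply rcont_v; eauto; lra.
Qed.

Lemma circ_bound (h : C -> C) (a b c d M : R) : a <= b -> c <= d ->
  rcont h a b c d ->
  (forall x y, a <= x <= b -> c <= y <= d -> Cmod (h (x, y)) <= M) ->
  Cmod (circ h a b c d) <= 2 * M * ((b - a) + (d - c)).
Proof.
intros Hab Hcd Hh HM. unfold circ.
assert (B1 : Cmod (CInt (fun x => h (x, c)) a b) <= M * (b - a)).
{ apply CInt_bound; auto; [eapply rcont_h; eauto; lra|intros; apply HM; lra]. }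
assert (B2 : Cmod (CInt (fun x => h (x, d)) a b) <= M * (b - a)).
{ apply CInt_bound; auto; [eapply rcont_h; eauto; lra|intros; apply HM; lra]. }
assert (B3 : Cmod (CInt (fun y => h (b, y)) c d) <= M * (d - c)).
{ apply CInt_bound; auto; [eapply rcont_v; eauto; lra|intros; apply HM; lra]. }
assert (B4 : Cmod (CInt (fun y => h (a, y)) c d) <= M * (d - c)).
{ apply CInt_bound; auto; [eapply rcont_v; eauto; lra|intros; apply HM; lra]. }
assert (Cmod Ci = 1).
{ unfold Cmod, Ci; simpl. replace (0 * (0 * 1) + 1 * (1 * 1)) with 1 by ring. now rewrite sqrt_1. }
unfold Cminus.
eapply Rle_trans; [apply Cmod_triangle|]. rewrite Cmod_mult, H.
assert (T1 := Cmod_triangle (CInt (fun x => h (x, c)) a b) (- CInt (fun x => h (x, d)) a b)).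
assert (T2 := Cmod_triangle (CInt (fun y => h (b, y)) c d) (- CInt (fun y => h (a, y)) c d)).
rewrite Cmod_opp in T1, T2. lra.
Qed.

Lemma circ_split (h : C -> C) (a m b c n d : R) :
  a <= m -> m <= b -> c <= n -> n <= d -> rcont h a b c d ->
  circ h a b c d = (circ h a m c n + circ h m b c n + circ h a m n d + circ h m b n d)%C.
Proof.
intros H1 H2 H3 H4 Hh. unfold circ.
rewrite <- (CInt_Chasles (fun x => h (x, c)) a m b) by (auto; eapply rcont_h; eauto; lra).
rewrite <- (CInt_Chasles (fun x => h (x, d)) a m b) by (auto; eapply rcont_h; eauto; lra).
rewrite <- (CInt_Chasles (fun x => h (b, x)) c n d) by (auto; eapply rcont_v; eauto; lra).
rewrite <- (CInt_Chasles (fun x => h (a, x)) c n d) by (auto; eapply rcont_v; eauto; lra).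
ring.
Qed.

Lemma circ_affine (al l : C) (a b c d : R) : circ (fun z => al + l * z)%C a b c d = RtoC 0.
Proof.
destruct al as [p q]. destruct l as [u v].
unfold circ, CInt, Cmult, Cplus, Cminus, Copp, Ci; simpl.
rewrite (RInt_ext (fun t => p + (u * t - v * c)) (fun t => (p - v * c) + u * t)) by (intros; simpl; ring).
rewrite (RInt_ext (fun t => q + (u * c + v * t)) (fun t => (q + u * c) + v * t)) by (intros; simpl; ring).
rewrite (RInt_ext (fun t => p + (u * t - v * d)) (fun t => (p - v * d) + u * t)) by (intros; simpl; ring).
rewrite (RInt_ext (fun t => q + (u * d + v * t)) (fun t => (q + u * d) + v * t)) by (intros; simpl; ring).
rewrite (RInt_ext (fun t => p + (u * b - v * t)) (fun t => (p + u * b) + - v * t)) by (intros; simpl; ring).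
rewrite (RInt_ext (fun t => q + (u * t + v * b)) (fun t => (q + v * b) + u * t)) by (intros; simpl; ring).
rewrite (RInt_ext (fun t => p + (u * a - v * t)) (fun t => (p + u * a) + - v * t)) by (intros; simpl; ring).
rewrite (RInt_ext (fun t => q + (u * t + v * a)) (fun t => (q + v * a) + u * t)) by (intros; simpl; ring).
rewrite !RInt_affine. unfold RtoC. f_equal; field.
Qed.

Lemma cderiv_affine (al l z : C) : cderiv (fun w => al + l * w)%C z l.
Proof.
intros eps Heps; exists 1; split; [lra|]. intros w _.
replace (al + l * w - (al + l * z) - l * (w - z))%C with (RtoC 0) by ring.
rewrite Cmod_0. generalize (Cmod_ge_0 (w - z)%C). nra.
Qed.

Lemma nested_limit (x : nat -> R) (w : nat -> R) :
  (forall n, x n <= x (S n)) -> (forall n, x (S n) + w (S n) <= x n + w n) ->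
  (forall n, 0 <= w n) -> exists X, forall n, x n <= X <= x n + w n.
Proof.
intros H1 H2 H3.
assert (Hd : forall n m, x (n + m)%nat + w (n + m)%nat <= x n + w n).
{ intros n m; induction m; [rewrite Nat.add_0_r; lra|]. rewrite Nat.add_succ_r. 
  specialize (H2 (n + m)%nat). lra. }
assert (Hi : forall n m, x n <= x (n + m)%nat).
{ intros n m; induction m; [rewrite Nat.add_0_r; lra|]. rewrite Nat.add_succ_r. 
  specialize (H1 (n + m)%nat). lra. }
destruct (ex_finite_lim_seq_incr x (x 0%nat + w 0%nat)) as [X HX]; auto.
{ intros n. specialize (Hd 0%nat n). specialize (H3 n). simpl in Hd. lra. }
exists X. intros n; split.
- now apply is_lim_seq_incr_compare.
- assert (HX' := proj1 (is_lim_seq_incr_n x n X) HX).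
  assert (Rbar_le X (x n + w n)); [|assumption].
  apply (is_lim_seq_le (fun m => x (m + n)%nat) (fun _ => x n + w n)); auto.
  + intros m. rewrite Nat.add_comm. specialize (Hd n m). specialize (H3 (n + m)%nat). lra.
  + apply is_lim_seq_const.
Qed.

(** Picks a bad quarter at every stage of Goursat's argument. The invariant travels with the point
    in a subset type, so that the next choice can be made from it. *)
Lemma dependent_choice {A : Type} (P : nat -> A -> Prop) (Q : A -> A -> nat -> Prop) (x0 : A) :
  P O x0 -> (forall n x, P n x -> exists y, P (S n) y /\ Q x y n) ->
  exists f : nat -> A, f O = x0 /\ (forall n, P n (f n)) /\ (forall n, Q (f n) (f (S n)) n).
Proof.
intros H0 Hs.
set (step := fun n (x : {x : A | P n x}) =>
  let y := constructive_indefinite_description _ (Hs n (proj1_sig x) (proj2_sig x)) in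
  exist (P (S n)) (proj1_sig y) (proj1 (proj2_sig y))).
set (g := fix g n : {x : A | P n x} :=
  match n with O => exist (P O) x0 H0 | S n => step n (g n) end).
exists (fun n => proj1_sig (g n)). repeat split.
- intros n; apply proj2_sig.
- intros n. simpl. unfold step; simpl.
  exact (proj2 (proj2_sig (constructive_indefinite_description _ (Hs n (proj1_sig (g n)) (proj2_sig (g n)))))).
Qed.

Lemma rcont_minus (h k : C -> C) (a b c d : R) :
  rcont h a b c d -> rcont k a b c d -> rcont (fun z => h z - k z)%C a b c d.
Proof.
intros Hh Hk x y Hx Hy.
apply (continuous_minus (U := C_UniformSpace) (V := C_R_NormedModule) h k); auto.
Qed.

(* Quartering preserves the bound [e0 * (w + k) ^ 2] on the integral over a rectangle with sides [w] and [k];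
   comparison with the affine approximation at the common point of the nested rectangles contradicts it. *)
Lemma goursat (h : C -> C) (a b c d : R) : a <= b -> c <= d ->
  (forall x y, a <= x <= b -> c <= y <= d -> exists l, cderiv h (x, y) l) ->
  circ h a b c d = RtoC 0.
Proof.
intros Hab Hcd Hd. apply Cmod_eq_0.
assert (Hc : rcont h a b c d).
{ intros x y Hx Hy. destruct (Hd x y Hx Hy) as [l Hl]. eapply cderiv_continuous; eauto. }
set (w := b - a). set (k := d - c).
assert (Hw : 0 <= w) by (unfold w; lra). assert (Hk : 0 <= k) by (unfold k; lra).
(* A rectangle reduced to a point is set aside, since [e0] will have [s = w + k] in its
   denominator. *)
destruct (Rle_lt_dec (w + k) 0) as [Hs|Hs].
{ assert (H := circ_bound h a b c d (Cmod (h (a, c))) Hab Hcd Hc).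
  fold w k in H. replace (w + k) with 0 in H by lra. rewrite Rmult_0_r in H.
  apply Rle_antisym; [apply H|apply Cmod_ge_0].
  intros x y Hx Hy. replace x with a by (unfold w, k in *; lra). replace y with c by (unfold w, k in *; lra). lra. }
destruct (Rle_lt_dec (Cmod (circ h a b c d)) 0) as [Hm|Hm].
{ generalize (Cmod_ge_0 (circ h a b c d)); lra. }
(* The factor 2 in the denominator makes the starting inequality [m > e0 * (s * s)] strict. *)
exfalso. set (m := Cmod (circ h a b c d)) in *.
set (s := w + k) in *. set (e0 := m / (2 * s * s)).
assert (He0 : 0 < e0) by (unfold e0; apply Rdiv_lt_0_compat; nra).
assert (Hm0 : m > e0 * (s * s)) by (unfold e0; replace (m / (2 * s * s) * (s * s)) with (m / 2) by (field; lra); lra).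
set (e := fun n => (/ 2) ^ n).
assert (eS : forall n, e (S n) = / 2 * e n) by (intros; reflexivity).
assert (ep : forall n, 0 < e n) by (intros; apply pow_lt; lra).
(* Only the lower left corner is recorded: at stage [n] the sides are [w * e n] and [k * e n], with
   [e n] equal to [2 ^ (- n)]. *)
destruct (dependent_choice
  (fun n (q : R * R) => a <= fst q /\ fst q + w * e n <= b /\ c <= snd q /\ snd q + k * e n <= d /\
     Cmod (circ h (fst q) (fst q + w * e n) (snd q) (snd q + k * e n)) > e0 * ((s * e n) * (s * e n)))
  (fun q q' n => fst q <= fst q' /\ fst q' + w * e (S n) <= fst q + w * e n /\
     snd q <= snd q' /\ snd q' + k * e (S n) <= snd q + k * e n) (a, c)) as [f [Hf0 [Hf1 Hf2]]].
{ simpl. unfold e; simpl. rewrite !Rmult_1_r. unfold w, k. 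
  replace (a + (b - a)) with b by ring. replace (c + (d - c)) with d by ring.
  fold m. repeat split; lra. }
{ intros n [x y]; simpl fst; simpl snd. intros [H1 [H2 [H3 [H4 H5]]]].
  rewrite eS. 
  assert (Hwn : 0 <= w * e n) by (apply Rmult_le_pos; auto; left; auto).
  assert (Hkn : 0 <= k * e n) by (apply Rmult_le_pos; auto; left; auto).
  set (w' := w * (/ 2 * e n)). set (k' := k * (/ 2 * e n)).
  assert (Ew : w * e n = w' + w') by (unfold w'; field).
  assert (Ek : k * e n = k' + k') by (unfold k'; field).
  assert (Es : s * e n * (s * e n) = 4 * ((w' + k') * (w' + k'))) by (unfold w', k', s; field).
  rewrite Ew, Ek, Es in *. 
  assert (Es' : s * (/ 2 * e n) = w' + k') by (unfold w', k', s; ring). rewrite Es'.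
  rewrite (circ_split h x (x + w') (x + (w' + w')) y (y + k') (y + (k' + k'))) in H5; try lra.
  2: { apply (rcont_sub h a b c d); auto; lra. }
  set (c1 := circ h x (x + w') y (y + k')) in *.
  set (c2 := circ h (x + w') (x + (w' + w')) y (y + k')) in *.
  set (c3 := circ h x (x + w') (y + k') (y + (k' + k'))) in *.
  set (c4 := circ h (x + w') (x + (w' + w')) (y + k') (y + (k' + k'))) in *.
  set (B := e0 * ((w' + k') * (w' + k'))) in *.
  assert (T1 := Cmod_triangle (c1 + c2 + c3) c4).
  assert (T2 := Cmod_triangle (c1 + c2) c3).
  assert (T3 := Cmod_triangle c1 c2).
  assert (HB : e0 * (4 * ((w' + k') * (w' + k'))) = 4 * B) by (unfold B; ring). rewrite HB in H5.
  destruct (Rlt_le_dec B (Cmod c1)) as [D1|D1].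
  { exists (x, y); simpl. fold c1. repeat split; lra. }
  destruct (Rlt_le_dec B (Cmod c2)) as [D2|D2].
  { exists (x + w', y); simpl. replace (x + w' + w') with (x + (w' + w')) by ring. fold c2. repeat split; lra. }
  destruct (Rlt_le_dec B (Cmod c3)) as [D3|D3].
  { exists (x, y + k'); simpl. replace (y + k' + k') with (y + (k' + k')) by ring. fold c3. repeat split; lra. }
  destruct (Rlt_le_dec B (Cmod c4)) as [D4|D4].
  { exists (x + w', y + k'); simpl. replace (x + w' + w') with (x + (w' + w')) by ring.
    replace (y + k' + k') with (y + (k' + k')) by ring. fold c4. repeat split; lra. }
  lra. }
destruct (nested_limit (fun n => fst (f n)) (fun n => w * e n)) as [X HX].
{ intros n; apply Hf2. } { intros n; apply Hf2. } { intros n; apply Rmult_le_pos; auto; left; auto. }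
destruct (nested_limit (fun n => snd (f n)) (fun n => k * e n)) as [Y HY].
{ intros n; apply Hf2. } { intros n; apply Hf2. } { intros n; apply Rmult_le_pos; auto; left; auto. }
assert (HXa : a <= X <= b) by (specialize (HX O); destruct (Hf1 O) as [? [? _]]; lra).
assert (HYa : c <= Y <= d) by (specialize (HY O); destruct (Hf1 O) as [_ [_ [? [? _]]]]; lra).
destruct (Hd X Y HXa HYa) as [l Hl].
(* With precision [e0 / 4], [circ_bound] yields [2 * (e0 / 4 * p) * p], where [p = s * e n]. This is
   half of the lower bound [e0 * (p * p)] preserved by the quartering. *)
assert (He1 : 0 < e0 / 4) by lra.
destruct (Hl (e0 / 4) He1) as [del [Hdel1 Hdel2]].
destruct (pow_lt_1_zero (/ 2)) with (y := del / s) as [n Hn].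
{ rewrite Rabs_pos_eq; lra. } { now apply Rdiv_lt_0_compat. }
specialize (Hn n (Nat.le_refl n)). fold (e n) in Hn. rewrite Rabs_pos_eq in Hn by (left; auto).
specialize (HX n). specialize (HY n). destruct (Hf1 n) as [K1 [K2 [K3 [K4 K5]]]].
set (x := fst (f n)) in *. set (y := snd (f n)) in *.
assert (Hwn : 0 <= w * e n) by (apply Rmult_le_pos; auto; left; auto).
assert (Hkn : 0 <= k * e n) by (apply Rmult_le_pos; auto; left; auto).
assert (Hsn : s * e n < del).
{ apply Rmult_lt_compat_l with (r := s) in Hn; auto. replace (s * (del / s)) with del in Hn by (field; lra). exact Hn. }
assert (Esn : s * e n = w * e n + k * e n) by (unfold s; ring).
set (w' := w * e n) in *. set (k' := k * e n) in *.
assert (Hrc : rcont h x (x + w') y (y + k')) by (apply (rcont_sub h a b c d); auto).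
set (al := (h (X, Y) - l * (X, Y))%C).
assert (Haff : rcont (fun z => al + l * z)%C x (x + w') y (y + k')).
{ intros u v _ _. eapply cderiv_continuous. apply cderiv_affine. }
assert (Hb := circ_bound (fun z => h z - (al + l * z))%C x (x + w') y (y + k') (e0 / 4 * (s * e n))).
rewrite circ_minus, circ_affine in Hb; auto; try lra.
replace (circ h x (x + w') y (y + k') - RtoC 0)%C with (circ h x (x + w') y (y + k')) in Hb by ring.
assert (Hb' : Cmod (circ h x (x + w') y (y + k')) <= 2 * (e0 / 4 * (s * e n)) * (s * e n)).
{ rewrite Esn at 2. replace (w' + k') with (x + w' - x + (y + k' - y)) by ring. apply Hb; try lra.
  - now apply rcont_minus.
  - intros u v Hu Hv.
    assert (Hdist : Cmod ((u, v) - (X, Y))%C <= s * e n).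
    { rewrite Esn. eapply Rle_trans; [apply (Cmod_pair_le (u - X) (v - Y))|].
      apply Rplus_le_compat; apply Rabs_le; lra. }
    eapply Rle_trans; [|apply Rmult_le_compat_l; [lra|exact Hdist]].
    eapply Rle_trans; [|apply Hdel2; lra]. right. f_equal. unfold al. ring. }
assert (Hp : 0 < s * e n) by (apply Rmult_lt_0_compat; auto).
set (p := s * e n) in *.
assert (0 < e0 * (p * p)) by (apply Rmult_lt_0_compat; [auto|now apply Rmult_lt_0_compat]).
lra.
Qed.

(** * Curves and the complex exponential *)

Lemma is_derive_eps (f : R -> R) (x l : R) :
  is_derive f x l <->
  (forall eps, 0 < eps -> exists delta, 0 < delta /\
    forall y, Rabs (y - x) < delta -> Rabs (f y - f x - l * (y - x)) <= eps * Rabs (y - x)).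
Proof.
split.
- intros [_ H] eps Heps.
  destruct (H x (fun P HP => HP) (mkposreal eps Heps)) as [d Hd].
  exists d; split; [apply cond_pos|].
  intros w Hw. specialize (Hd w Hw).
  change (Rabs (f w - f x - (w - x) * l) <= eps * Rabs (w - x)) in Hd.
  now rewrite (Rmult_comm l).
- intros H; split; [apply is_linear_scal_l|].
  intros x' Hx.
  apply (is_filter_lim_locally_unique (K := R_AbsRing) (V := R_NormedModule)) in Hx. subst x'.
  intros eps. destruct (H eps (cond_pos eps)) as [d [Hd1 Hd2]].
  exists (mkposreal d Hd1). intros w Hw. specialize (Hd2 w Hw).
  change (Rabs (f w - f x - (w - x) * l) <= eps * Rabs (w - x)).
  now rewrite (Rmult_comm _ l).
Qed.

Definition rderiv (G : R -> C) (t : R) (l : C) : Prop :=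
  is_derive (fun u => fst (G u)) t (fst l) /\ is_derive (fun u => snd (G u)) t (snd l).

Lemma rderiv_eps (G : R -> C) (t : R) (l : C) :
  rderiv G t l <->
  (forall eps, 0 < eps -> exists delta, 0 < delta /\
    forall u, Rabs (u - t) < delta -> Cmod (G u - G t - l * RtoC (u - t))%C <= eps * Rabs (u - t)).
Proof.
unfold rderiv. rewrite !is_derive_eps. split.
- intros [H1 H2] eps Heps.
  destruct (H1 (eps / 2)) as [d1 [Hd1 K1]]; [lra|]. destruct (H2 (eps / 2)) as [d2 [Hd2 K2]]; [lra|].
  exists (Rmin d1 d2); split; [now apply Rmin_glb_lt|]. intros u Hu.
  assert (U1 : Rabs (u - t) < d1) by (eapply Rlt_le_trans; [exact Hu|apply Rmin_l]).
  assert (U2 : Rabs (u - t) < d2) by (eapply Rlt_le_trans; [exact Hu|apply Rmin_r]).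
  specialize (K1 u U1). specialize (K2 u U2).
  replace (G u - G t - l * RtoC (u - t))%C with
    ((fst (G u) - fst (G t) - fst l * (u - t), snd (G u) - snd (G t) - snd l * (u - t)) : C)
    by (unfold Cminus, Cplus, Copp, Cmult, RtoC; simpl; f_equal; ring).
  eapply Rle_trans; [apply Cmod_pair_le|]. lra.
- intros H. split; intros eps Heps; destruct (H eps Heps) as [d [Hd K]]; exists d; split; auto;
  intros u Hu; eapply Rle_trans; [|apply (K u Hu)| |apply (K u Hu)].
  + eapply Rle_trans; [|apply fst_le_Cmod]. right. f_equal. unfold Cminus, Cplus, Copp, Cmult, RtoC; simpl; ring.
  + eapply Rle_trans; [|apply snd_le_Cmod]. right. f_equal. unfold Cminus, Cplus, Copp, Cmult, RtoC; simpl; ring.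
Qed.

Lemma rderiv_continuous (G : R -> C) (t : R) (l : C) :
  rderiv G t l -> continuous (T := R_UniformSpace) (U := C_UniformSpace) G t.
Proof.
intros H. apply continuous_C_eps. intros eps Heps.
destruct (proj1 (rderiv_eps G t l) H 1 Rlt_0_1) as [d [Hd K]].
set (B := 1 + Cmod l). assert (HB : 0 < B) by (unfold B; generalize (Cmod_ge_0 l); lra).
assert (Hm : 0 < Rmin d (eps / B)) by (apply Rmin_glb_lt; auto; now apply Rdiv_lt_0_compat).
exists (mkposreal _ Hm). intros u Hu.
assert (Hu' : Rabs (u - t) < Rmin d (eps / B)) by exact Hu. clear Hu.
assert (U1 : Rabs (u - t) < d) by (eapply Rlt_le_trans; [exact Hu'|apply Rmin_l]).
assert (U2 : Rabs (u - t) < eps / B) by (eapply Rlt_le_trans; [exact Hu'|apply Rmin_r]).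
specialize (K u U1).
replace (G u - G t)%C with ((G u - G t - l * RtoC (u - t)) + l * RtoC (u - t))%C by ring.
eapply Rle_lt_trans; [apply Cmod_triangle|]. rewrite Cmod_mult, Cmod_R.
apply Rle_lt_trans with (B * Rabs (u - t)); [unfold B; lra|].
apply Rmult_lt_reg_r with (/ B); [now apply Rinv_0_lt_compat|].
replace (B * Rabs (u - t) * / B) with (Rabs (u - t)) by (field; lra). exact U2.
Qed.

Lemma rderiv_comp (f : C -> C) (G : R -> C) (t : R) (m l : C) :
  cderiv f (G t) m -> rderiv G t l -> rderiv (fun u => f (G u)) t (m * l)%C.
Proof.
intros Hf HG. apply rderiv_eps. intros eps Heps.
set (B := 1 + Cmod l + Cmod m).
assert (HB : 1 <= B) by (unfold B; generalize (Cmod_ge_0 l) (Cmod_ge_0 m); lra).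
set (e := eps / (2 * B)). assert (He : 0 < e) by (unfold e; apply Rdiv_lt_0_compat; lra).
assert (HeB : e * B = eps / 2) by (unfold e; field; lra).
destruct (Hf e He) as [d1 [Hd1 K1]].
destruct (proj1 (continuous_C_eps G t) (rderiv_continuous _ _ _ HG) d1 Hd1) as [d2 K2].
assert (Hmin : 0 < Rmin e 1) by (apply Rmin_glb_lt; lra).
destruct (proj1 (rderiv_eps _ _ _) HG _ Hmin) as [d3 [Hd3 K3]].
exists (Rmin d2 d3). split; [apply Rmin_glb_lt; auto; apply cond_pos|].
intros u Hu.
assert (U2 : Rabs (u - t) < d2) by (eapply Rlt_le_trans; [exact Hu|apply Rmin_l]).
assert (U3 : Rabs (u - t) < d3) by (eapply Rlt_le_trans; [exact Hu|apply Rmin_r]).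
specialize (K2 u U2). specialize (K1 _ K2). specialize (K3 u U3).
set (q := Rabs (u - t)) in *. assert (Hq : 0 <= q) by apply Rabs_pos.
assert (K3a : Cmod (G u - G t - l * RtoC (u - t))%C <= e * q).
{ eapply Rle_trans; [exact K3|]. apply Rmult_le_compat_r; auto. apply Rmin_l. }
assert (K3b : Cmod (G u - G t)%C <= B * q).
{ replace (G u - G t)%C with ((G u - G t - l * RtoC (u - t)) + l * RtoC (u - t))%C by ring.
  eapply Rle_trans; [apply Cmod_triangle|]. rewrite Cmod_mult, Cmod_R. fold q.
  assert (Rmin e 1 * q <= 1 * q) by (apply Rmult_le_compat_r; auto; apply Rmin_r).
  assert (0 <= Cmod m * q) by (apply Rmult_le_pos; auto; apply Cmod_ge_0).
  unfold B. lra. }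
replace (f (G u) - f (G t) - m * l * RtoC (u - t))%C with
  ((f (G u) - f (G t) - m * (G u - G t)) + m * (G u - G t - l * RtoC (u - t)))%C by ring.
eapply Rle_trans; [apply Cmod_triangle|]. rewrite Cmod_mult.
assert (e * Cmod (G u - G t)%C <= e * (B * q)) by (apply Rmult_le_compat_l; lra).
assert (Cmod m * Cmod (G u - G t - l * RtoC (u - t))%C <= B * (e * q)).
{ apply Rmult_le_compat; auto; try apply Cmod_ge_0. unfold B; generalize (Cmod_ge_0 l); lra. }
replace (eps * q) with (2 * (e * B) * q) by (rewrite HeB; field). lra.
Qed.

Lemma rderiv_mult (F G : R -> C) (t : R) (a b : C) :
  rderiv F t a -> rderiv G t b -> rderiv (fun u => F u * G u)%C t (a * G t + F t * b)%C.
Proof.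
intros [F1 F2] [G1 G2]. split; simpl.
- evar (l : R). replace (fst a * fst (G t) - snd a * snd (G t) + (fst (F t) * fst b - snd (F t) * snd b)) with l.
  + apply (is_derive_minus (K := R_AbsRing) (V := R_NormedModule)); apply (is_derive_mult (K := R_AbsRing)); eauto; intros; apply Rmult_comm.
  + unfold l, minus, plus, opp, mult; simpl; ring.
- evar (l : R). replace (fst a * snd (G t) + snd a * fst (G t) + (fst (F t) * snd b + snd (F t) * fst b)) with l.
  + apply (is_derive_plus (K := R_AbsRing) (V := R_NormedModule)); apply (is_derive_mult (K := R_AbsRing)); eauto; intros; apply Rmult_comm.
  + unfold l, minus, plus, opp, mult; simpl; ring.
Qed.

Lemma rderiv_const (c : C) (t : R) : rderiv (fun _ => c) t (RtoC 0).
Proof. split; simpl; apply (is_derive_const (K := R_AbsRing) (V := R_NormedModule)). Qed.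

Lemma rderiv_val (G : R -> C) (t : R) (l l' : C) : rderiv G t l -> l = l' -> rderiv G t l'.
Proof. now intros H <-. Qed.

Lemma CInt_derive (G dG : R -> C) (a b : R) : a <= b ->
  (forall t, a <= t <= b -> rderiv G t (dG t)) -> ccont dG a b ->
  CInt dG a b = (G b - G a)%C.
Proof.
intros Hab HG Hc. unfold CInt, Cminus, Cplus, Copp; simpl. f_equal.
- apply (is_RInt_unique (V := R_CompleteNormedModule)).
  apply (is_RInt_derive (V := R_CompleteNormedModule) (fun u => fst (G u)));
  rewrite Rmin_left, Rmax_right by auto; intros x Hx.
  + now apply HG.
  + apply (continuous_comp (U := R_UniformSpace) (V := C_UniformSpace) (W := R_UniformSpace) dG fst).
    * now apply Hc.
    * apply continuous_fst.
- apply (is_RInt_unique (V := R_CompleteNormedModule)).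
  apply (is_RInt_derive (V := R_CompleteNormedModule) (fun u => snd (G u)));
  rewrite Rmin_left, Rmax_right by auto; intros x Hx.
  + now apply HG.
  + apply (continuous_comp (U := R_UniformSpace) (V := C_UniformSpace) (W := R_UniformSpace) dG snd).
    * now apply Hc.
    * apply continuous_snd.
Qed.

Definition eit (t : R) : C := (cos t, sin t).

Lemma eit_add (s t : R) : eit (s + t) = (eit s * eit t)%C.
Proof. unfold eit, Cmult; simpl. rewrite cos_plus, sin_plus. f_equal; ring. Qed.

Lemma eit_0 : eit 0 = RtoC 1.
Proof. unfold eit. now rewrite cos_0, sin_0. Qed.

Lemma Cmod_eit (t : R) : Cmod (eit t) = 1.
Proof.
unfold Cmod, eit; simpl. generalize (sin2_cos2 t); unfold Rsqr; intros.
replace (cos t * (cos t * 1) + sin t * (sin t * 1)) with 1 by lra. apply sqrt_1.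
Qed.

Lemma eit_2npi (n : nat) : eit (INR n * (2 * PI)) = RtoC 1.
Proof.
unfold eit. replace (INR n * (2 * PI)) with (0 + 2 * INR n * PI) by ring.
now rewrite cos_period, sin_period, cos_0, sin_0.
Qed.

Lemma eit_opp_inv (t : R) : (eit t * eit (- t))%C = RtoC 1.
Proof. rewrite <- eit_add. replace (t + - t) with 0 by ring. apply eit_0. Qed.

Lemma rderiv_eit (k t : R) : rderiv (fun u => eit (k * u)) t (RtoC k * Ci * eit (k * t))%C.
Proof. split; simpl; auto_derive; auto; ring. Qed.

Definition cexp (z : C) : C := (RtoC (exp (fst z)) * eit (snd z))%C.

Lemma cexp_add (z w : C) : cexp (z + w)%C = (cexp z * cexp w)%C.
Proof. unfold cexp. simpl. rewrite exp_plus, eit_add, RtoC_mult. ring. Qed.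

Lemma cexp_0 : cexp (RtoC 0) = RtoC 1.
Proof. unfold cexp. simpl. rewrite exp_0, eit_0. ring. Qed.

(** The functional equation carries the derivative from 0 to every other point, so only the origin
    needs a computation. There the remainder splits into the first order remainders of [exp], [cos]
    and [sin], times bounded factors, and the product [x * y]. *)
Lemma cderiv_cexp_0 : cderiv cexp (RtoC 0) (RtoC 1).
Proof.
intros eps Heps.
(* The estimates [E1] and [P1] to [P4] add up to nine times [e * q], which [eps / 16] covers;
   [e <= 1] keeps [exp x] below 3. *)
set (e := Rmin (eps / 16) 1).
assert (He : 0 < e) by (apply Rmin_glb_lt; lra).
assert (He1 : e <= eps / 16) by apply Rmin_l.
assert (He2 : e <= 1) by apply Rmin_r.
assert (D1 : is_derive exp 0 1) by (auto_derive; auto; rewrite exp_0; ring).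
assert (D2 : is_derive cos 0 0) by (auto_derive; auto; rewrite sin_0; ring).
assert (D3 : is_derive sin 0 1) by (auto_derive; auto; rewrite cos_0; ring).
destruct (proj1 (is_derive_eps _ _ _) D1 e He) as [d1 [Hd1 K1]].
destruct (proj1 (is_derive_eps _ _ _) D2 e He) as [d2 [Hd2 K2]].
destruct (proj1 (is_derive_eps _ _ _) D3 e He) as [d3 [Hd3 K3]].
exists (Rmin (Rmin d1 (Rmin d2 d3)) e). split; [apply Rmin_glb_lt; [apply Rmin_glb_lt; [|apply Rmin_glb_lt]|]; assumption|].
intros [x y] Hw. replace ((x, y) - RtoC 0)%C with ((x, y) : C) in * by (unfold Cminus, Cplus, Copp, RtoC; simpl; f_equal; ring).
set (q := Cmod (x, y)) in *.
assert (Hx : Rabs x <= q) by apply (fst_le_Cmod (x, y)).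
assert (Hy : Rabs y <= q) by apply (snd_le_Cmod (x, y)).
assert (Q1 : q < d1) by (eapply Rlt_le_trans; [exact Hw|]; eapply Rle_trans; [apply Rmin_l|apply Rmin_l]).
assert (Q2 : q < d2) by (eapply Rlt_le_trans; [exact Hw|]; eapply Rle_trans; [apply Rmin_l|]; eapply Rle_trans; [apply Rmin_r|apply Rmin_l]).
assert (Q3 : q < d3) by (eapply Rlt_le_trans; [exact Hw|]; eapply Rle_trans; [apply Rmin_l|]; eapply Rle_trans; [apply Rmin_r|apply Rmin_r]).
assert (Q4 : q < e) by (eapply Rlt_le_trans; [exact Hw|apply Rmin_r]).
specialize (K1 x). specialize (K2 y). specialize (K3 y).
rewrite exp_0, Rminus_0_r in K1. rewrite cos_0, Rminus_0_r in K2. rewrite sin_0, !Rminus_0_r in K3.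
specialize (K1 ltac:(lra)). specialize (K2 ltac:(lra)). specialize (K3 ltac:(lra)).
rewrite cexp_0. unfold cexp, eit, Cminus, Cplus, Copp, Cmult, RtoC; simpl.
eapply Rle_trans; [apply Cmod_pair_le|].
replace (exp x * cos y - 0 * sin y + - (1) + - (1 * x - 0 * y)) with ((exp x - 1 - 1 * x) + exp x * (cos y - 1 - 0 * y)) by ring.
replace (exp x * sin y + 0 * cos y + - 0 + - (1 * y + 0 * x)) with (exp x * (sin y - 1 * y) + (exp x - 1 - 1 * x) * y + x * y) by ring.
assert (Hq : 0 <= q) by apply Cmod_ge_0.
assert (E1 : Rabs (exp x - 1 - 1 * x) <= e * q) by (eapply Rle_trans; [exact K1|apply Rmult_le_compat_l; lra]).
assert (E2 : Rabs (cos y - 1 - 0 * y) <= e * q) by (eapply Rle_trans; [exact K2|apply Rmult_le_compat_l; lra]).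
assert (E3 : Rabs (sin y - 1 * y) <= e * q) by (eapply Rle_trans; [exact K3|apply Rmult_le_compat_l; lra]).
assert (Eq : e * q <= 1) by nra.
assert (E4 : Rabs (exp x) <= 3).
{ replace (exp x) with ((exp x - 1 - 1 * x) + (1 + x)) by ring.
  eapply Rle_trans; [apply Rabs_triang|]. assert (Rabs (1 + x) <= 2); [|lra].
  eapply Rle_trans; [apply Rabs_triang|]. rewrite Rabs_R1. lra. }
assert (P1 : Rabs (exp x * (cos y - 1 - 0 * y)) <= 3 * (e * q)).
{ rewrite Rabs_mult. apply Rmult_le_compat; auto; apply Rabs_pos. }
assert (P2 : Rabs (exp x * (sin y - 1 * y)) <= 3 * (e * q)).
{ rewrite Rabs_mult. apply Rmult_le_compat; auto; apply Rabs_pos. }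
assert (P3 : Rabs ((exp x - 1 - 1 * x) * y) <= 1 * (e * q)).
{ rewrite Rabs_mult. rewrite Rmult_comm. apply Rmult_le_compat; auto; try apply Rabs_pos; lra. }
assert (P4 : Rabs (x * y) <= e * q).
{ rewrite Rabs_mult. apply Rmult_le_compat; auto; try apply Rabs_pos; lra. }
assert (T1 := Rabs_triang (exp x - 1 - 1 * x) (exp x * (cos y - 1 - 0 * y))).
assert (T2 := Rabs_triang (exp x * (sin y - 1 * y) + (exp x - 1 - 1 * x) * y) (x * y)).
assert (T3 := Rabs_triang (exp x * (sin y - 1 * y)) ((exp x - 1 - 1 * x) * y)).
nra.
Qed.

Lemma cderiv_cexp (z : C) : cderiv cexp z (cexp z).
Proof.
intros eps Heps. set (K := 1 + Cmod (cexp z)).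
assert (HK : 0 < K) by (unfold K; generalize (Cmod_ge_0 (cexp z)); lra).
destruct (cderiv_cexp_0 (eps / K)) as [d [Hd H]]; [now apply Rdiv_lt_0_compat|].
exists d; split; auto. intros w Hw.
specialize (H (w - z)%C). rewrite cexp_0 in H.
replace (w - z - RtoC 0)%C with (w - z)%C in H by ring.
specialize (H Hw).
replace (cexp w) with (cexp z * cexp (w - z))%C by (rewrite <- cexp_add; f_equal; ring).
replace (cexp z * cexp (w - z) - cexp z - cexp z * (w - z))%C
  with (cexp z * (cexp (w - z) - RtoC 1 - RtoC 1 * (w - z)))%C by ring.
rewrite Cmod_mult.
apply Rle_trans with (K * (eps / K * Cmod (w - z)%C)).
- apply Rmult_le_compat; auto; try apply Cmod_ge_0. unfold K; lra.
- right; field; lra.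
Qed.

(** * Cauchy's formula for the derivative *)

Lemma cderiv_comp (f g : C -> C) (z m l : C) :
  cderiv f (g z) m -> cderiv g z l -> cderiv (fun w => f (g w)) z (l * m)%C.
Proof.
rewrite <- !is_derive_cderiv_abs. intros H1 H2.
apply (is_derive_comp (K := C_AbsRing) (V := AbsRing_NormedModule C_AbsRing) f g z m l); [exact H1|exact H2].
Qed.

Lemma cderiv_mult (f g : C -> C) (z a b : C) :
  cderiv f z a -> cderiv g z b -> cderiv (fun w => f w * g w)%C z (a * g z + f z * b)%C.
Proof.
rewrite <- !is_derive_cderiv_abs. intros H1 H2.
apply (is_derive_mult (K := C_AbsRing) f g z a b); auto. intros; apply Cmult_comm.
Qed.

Definition hol_on (f : C -> C) (c : C) (s : R) : Prop :=
  forall w, Cmod (w - c)%C <= s -> exists l, cderiv f w l.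

Lemma hol_on_sub (f : C -> C) (c c' : C) (s s' : R) :
  hol_on f c s -> Cmod (c' - c)%C + s' <= s -> hol_on f c' s'.
Proof.
intros H Hs w Hw. apply H. replace (w - c)%C with ((w - c') + (c' - c))%C by ring.
eapply Rle_trans; [apply Cmod_triangle|]. lra.
Qed.

Lemma hol_on_C_derive (f : C -> C) (c : C) (s : R) (w : C) :
  hol_on f c s -> Cmod (w - c)%C <= s -> cderiv f w (C_derive f w).
Proof.
intros H Hw. destruct (H w Hw) as [l Hl]. rewrite (cderiv_unique f w l); auto.
Qed.

Definition circle (c : C) (s t : R) : C := (c + RtoC s * eit t)%C.

Lemma Cmod_circle (c : C) (s t : R) : 0 <= s -> Cmod (circle c s t - c)%C = s.
Proof.
intros Hs. unfold circle. replace (c + RtoC s * eit t - c)%C with (RtoC s * eit t)%C by ring.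
rewrite Cmod_mult, Cmod_eit, Cmod_R, Rabs_pos_eq; auto; ring.
Qed.

Lemma circle_period (c : C) (s : R) : circle c s (2 * PI) = circle c s 0.
Proof.
unfold circle. f_equal. f_equal. rewrite eit_0. replace (2 * PI) with (INR 1 * (2 * PI)) by (simpl; ring).
apply eit_2npi.
Qed.

Lemma rderiv_circle (c : C) (s t : R) : rderiv (circle c s) t (RtoC s * Ci * eit t)%C.
Proof. split; simpl; auto_derive; auto; ring. Qed.

Lemma ccont_eit (k a b : R) : ccont (fun t => eit (k * t)) a b.
Proof. intros t _. eapply rderiv_continuous, rderiv_eit. Qed.

Lemma ccont_circle_cont (f : C -> C) (c : C) (s a b : R) :
  (forall t, continuous (T := C_UniformSpace) (U := C_UniformSpace) f (circle c s t)) ->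
  ccont (fun t => f (circle c s t)) a b.
Proof.
intros H t _.
apply (continuous_comp (U := R_UniformSpace) (V := C_UniformSpace) (W := C_UniformSpace) (circle c s) f); auto.
eapply rderiv_continuous, rderiv_circle.
Qed.

Lemma ccont_circle (f : C -> C) (c : C) (s a b : R) : 0 <= s ->
  hol_on f c s -> ccont (fun t => f (circle c s t)) a b.
Proof.
intros Hs H. apply ccont_circle_cont. intros t. destruct (H (circle c s t)) as [l Hl].
- rewrite Cmod_circle; lra.
- eapply cderiv_continuous; eauto.
Qed.

Definition fourier (phi : R -> C) (n : nat) : C :=
  CInt (fun t => phi t * eit (- INR n * t))%C 0 (2 * PI).

Lemma pi2_pos : 0 <= 2 * PI.
Proof. generalize PI_RGT_0; lra. Qed.

Lemma fourier_bound (phi : R -> C) (n : nat) (M : R) : ccont phi 0 (2 * PI) ->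
  (forall t, Cmod (phi t) <= M) -> Cmod (fourier phi n) <= M * (2 * PI).
Proof.
intros Hc HM. unfold fourier. replace (M * (2 * PI)) with (M * (2 * PI - 0)) by ring.
apply CInt_bound.
- apply pi2_pos.
- apply ccont_mult; auto. apply ccont_eit.
- intros t _. rewrite Cmod_mult, Cmod_eit, Rmult_1_r. auto.
Qed.

Lemma fourier_minus (phi psi : R -> C) (n : nat) : ccont phi 0 (2 * PI) -> ccont psi 0 (2 * PI) ->
  fourier (fun t => phi t - psi t)%C n = (fourier phi n - fourier psi n)%C.
Proof.
intros H1 H2. unfold fourier. rewrite <- CInt_minus; auto using pi2_pos, ccont_mult, ccont_eit.
apply CInt_ext; [apply pi2_pos|]. intros; ring.
Qed.

Lemma fourier_scal (c : C) (phi : R -> C) (n : nat) : ccont phi 0 (2 * PI) ->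
  fourier (fun t => c * phi t)%C n = (c * fourier phi n)%C.
Proof.
intros H1. unfold fourier. rewrite <- CInt_scal; auto using pi2_pos, ccont_mult, ccont_eit.
apply CInt_ext; [apply pi2_pos|]. intros; ring.
Qed.

Lemma fourier_ext (phi psi : R -> C) (n : nat) : (forall t, phi t = psi t) ->
  fourier phi n = fourier psi n.
Proof. intros H. apply CInt_ext; [apply pi2_pos|]. intros; now rewrite H. Qed.

Lemma fourier_const_1 (c : C) : fourier (fun _ => c) 1 = RtoC 0.
Proof.
unfold fourier. rewrite CInt_scal; auto using pi2_pos, ccont_eit.
replace (CInt (fun t => eit (- INR 1 * t)) 0 (2 * PI)) with (RtoC 0); [ring|].
rewrite (CInt_ext _ (fun t => Ci * ((RtoC (- INR 1) * Ci) * eit (- INR 1 * t)))%C).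
- rewrite CInt_scal; [|apply pi2_pos|].
  + rewrite (CInt_derive (fun t => eit (- INR 1 * t))); [|apply pi2_pos| |].
    * replace (- INR 1 * (2 * PI)) with (- (INR 1 * (2 * PI))) by ring.
      replace (eit (- (INR 1 * (2 * PI)))) with (RtoC 1).
      -- rewrite Rmult_0_r, eit_0. ring.
      -- rewrite <- (eit_opp_inv (INR 1 * (2 * PI))). rewrite eit_2npi. ring.
    * intros; apply rderiv_eit.
    * apply ccont_mult; [apply ccont_const|apply ccont_eit].
  + apply ccont_mult; [apply ccont_const|apply ccont_eit].
- apply pi2_pos.
- intros t _. simpl INR. replace (Ci * (RtoC (- (1)) * Ci * eit (- (1) * t)))%C with 
   ((Ci * Ci) * RtoC (- (1)) * eit (- (1) * t))%C by ring.
  replace (Ci * Ci * RtoC (- (1)))%C with (RtoC 1); [ring|].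
  unfold Ci, Cmult, RtoC; simpl; f_equal; ring.
Qed.

Lemma fourier_eit_1 (c : C) : fourier (fun t => c * eit t)%C 1 = (RtoC (2 * PI) * c)%C.
Proof.
unfold fourier. rewrite (CInt_ext _ (fun t => c)).
- unfold CInt. rewrite !RInt_const. unfold scal, Cmult, RtoC; simpl; unfold mult; simpl. f_equal; ring.
- apply pi2_pos.
- intros t _. simpl INR. rewrite <- Cmult_assoc. 
  replace (- (1) * t) with (- t) by ring. rewrite eit_opp_inv. ring.
Qed.

Definition Phi (f : C -> C) (c : C) (s : R) (n : nat) : C := fourier (fun t => f (circle c s t)) n.

(** In logarithmic coordinates an annulus is a rectangle: the two circles are its vertical sides,
    and the integrals over the horizontal sides cancel because [cexp] has period [2 * PI] in the
    imaginary direction. *)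
Lemma Phi_1_radius (f : C -> C) (c : C) (s t : R) : 0 < t -> t <= s -> hol_on f c s ->
  (RtoC (/ t) * Phi f c t 1)%C = (RtoC (/ s) * Phi f c s 1)%C.
Proof.
intros Ht Hts H.
set (h := fun z => (f (c + cexp z) * cexp (- z))%C).
assert (Hln : ln t <= ln s) by (destruct Hts as [Hts| ->]; [left; apply ln_increasing; auto|right; auto]).
assert (G : circ h (ln t) (ln s) 0 (2 * PI) = RtoC 0).
{ apply goursat; auto using pi2_pos. intros x y Hx Hy.
  destruct (H (c + cexp (x, y))%C) as [l Hl].
  - replace (c + cexp (x, y) - c)%C with (cexp (x, y)) by ring. unfold cexp; simpl.
    rewrite Cmod_mult, Cmod_eit, Cmod_R, Rabs_pos_eq by (left; apply exp_pos). rewrite Rmult_1_r.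
    rewrite <- (exp_ln s) by lra. destruct (proj2 Hx) as [Hx'| ->]; [left; now apply exp_increasing|right; auto].
  - eexists. unfold h. apply cderiv_mult.
    + apply (cderiv_comp f (fun z => (c + cexp z)%C)); [exact Hl|].
      apply is_derive_cderiv. apply (is_derive_plus (K := C_AbsRing) (V := C_NormedModule)).
      * apply (is_derive_const (K := C_AbsRing) (V := C_NormedModule)).
      * apply is_derive_cderiv. apply cderiv_cexp.
    + apply (cderiv_comp cexp (fun z => (- z)%C)); [apply cderiv_cexp|].
      apply is_derive_cderiv_abs. apply (is_derive_opp (K := C_AbsRing) (V := AbsRing_NormedModule C_AbsRing)).
      apply (is_derive_id (K := C_AbsRing)). }
assert (V : forall r, 0 < r -> r <= s -> CInt (fun y => h (ln r, y)) 0 (2 * PI) = (RtoC (/ r) * Phi f c r 1)%C).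
{ intros r Hr Hrs. unfold Phi, fourier. rewrite <- CInt_scal; auto using pi2_pos.
  - apply CInt_ext; [apply pi2_pos|]. intros y _. unfold h, cexp, circle. simpl fst; simpl snd. simpl INR.
    rewrite exp_Ropp, exp_ln by auto. replace (- (1) * y) with (- y) by ring. ring.
  - apply ccont_mult; [|apply ccont_eit]. apply ccont_circle; [lra|].
    apply (hol_on_sub f c c s r H). replace (c - c)%C with (RtoC 0) by ring. rewrite Cmod_0. lra. }
unfold circ in G. rewrite !V in G by lra.
rewrite (CInt_ext (fun x => h (x, 0)) (fun x => h (x, 2 * PI))) in G; auto.
- replace (RtoC (/ t) * Phi f c t 1)%C with 
   (RtoC (/ s) * Phi f c s 1 + Ci * (Ci * (RtoC (/ s) * Phi f c s 1 - RtoC (/ t) * Phi f c t 1)))%C.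
  + replace (Ci * (RtoC (/ s) * Phi f c s 1 - RtoC (/ t) * Phi f c t 1))%C with (RtoC 0); [ring|].
    rewrite <- G. ring.
  + rewrite Cmult_assoc. replace (Ci * Ci)%C with (- RtoC 1)%C; [ring|].
    unfold Ci, Cmult, Copp, RtoC; simpl; f_equal; ring.
- intros x _. unfold h. assert (E : eit (2 * PI) = RtoC 1).
  { replace (2 * PI) with (INR 1 * (2 * PI)) by (simpl; ring). apply eit_2npi. }
  f_equal.
  + f_equal. f_equal. unfold cexp; simpl. rewrite eit_0, E. reflexivity.
  + unfold cexp; simpl. f_equal. rewrite Ropp_0, eit_0.
    rewrite <- (eit_opp_inv (2 * PI)). rewrite E. ring.
Qed.

Lemma Cmod_le_eps_eq (a b : C) (K : R) : 
  (forall eps, 0 < eps -> Cmod (a - b)%C <= K * eps) -> a = b.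
Proof.
intros H. apply Ceq_minus, Cmod_eq_0. apply Rle_antisym; [|apply Cmod_ge_0].
apply le_epsilon. intros eps Heps. rewrite Rplus_0_l.
assert (HK : 0 < Rabs K + 1) by (generalize (Rabs_pos K); lra).
eapply Rle_trans; [apply (H (eps / (Rabs K + 1))); now apply Rdiv_lt_0_compat|].
apply Rle_trans with ((Rabs K + 1) * (eps / (Rabs K + 1))).
- apply Rmult_le_compat_r; [left; now apply Rdiv_lt_0_compat|]. generalize (Rle_abs K); lra.
- right; field; lra.
Qed.

(** The normalised coefficient is the same on all smaller circles, so the radius may tend to 0.
    There [f] is [f c], which has no first coefficient, plus [l * t * eit u], plus an error of size
    [eps * t]. *)
Lemma cauchy_derivative (f : C -> C) (c : C) (s : R) (l : C) : 0 < s -> hol_on f c s ->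
  cderiv f c l -> Phi f c s 1 = (RtoC (2 * PI * s) * l)%C.
Proof.
intros Hs H Hl.
assert (Hs' : RtoC s <> RtoC 0) by (intros E; apply RtoC_inj in E; lra).
assert (E : (RtoC (/ s) * Phi f c s 1)%C = (RtoC (2 * PI) * l)%C).
{ apply (Cmod_le_eps_eq _ _ (2 * PI)). intros eps Heps.
  destruct (Hl eps Heps) as [d [Hd K]].
  set (t := Rmin s (d / 2)). assert (Ht : 0 < t) by (apply Rmin_glb_lt; lra).
  assert (Hts : t <= s) by apply Rmin_l. assert (Htd : t < d) by (eapply Rle_lt_trans; [apply Rmin_r|lra]).
  rewrite <- (Phi_1_radius f c s t); auto.
  assert (Ht' : RtoC t <> RtoC 0) by (intros E; apply RtoC_inj in E; lra).
  assert (Cf : ccont (fun u => f (circle c t u)) 0 (2 * PI)).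
  { apply ccont_circle; [lra|]. apply (hol_on_sub f c c s t H). 
    replace (c - c)%C with (RtoC 0) by ring. rewrite Cmod_0. lra. }
  assert (Ce : forall k, ccont (fun u => k * eit u)%C 0 (2 * PI)).
  { intros k. apply ccont_mult; [apply ccont_const|].
    intros u Hu. generalize (ccont_eit 1 0 (2 * PI) u Hu). apply continuous_ext. intros; f_equal; ring. }
  replace (RtoC (/ t) * Phi f c t 1 - RtoC (2 * PI) * l)%C with
    (RtoC (/ t) * fourier (fun u => (f (circle c t u) - f c) - (RtoC t * l) * eit u)%C 1)%C.
  - rewrite Cmod_mult, Cmod_R, Rabs_pos_eq by (left; now apply Rinv_0_lt_compat).
    apply Rmult_le_reg_l with t; auto. rewrite <- Rmult_assoc, Rinv_r, Rmult_1_l by lra.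
    replace (t * (2 * PI * eps)) with (eps * t * (2 * PI)) by ring.
    apply fourier_bound.
    + apply ccont_minus; auto. apply ccont_minus; auto. apply ccont_const.
    + intros u. assert (Hcc := Cmod_circle c t u ltac:(lra)). specialize (K (circle c t u)).
      rewrite Hcc in K.
      replace (f (circle c t u) - f c - RtoC t * l * eit u)%C with
        (f (circle c t u) - f c - l * (circle c t u - c))%C by (unfold circle; ring).
      now apply K.
  - rewrite fourier_minus, fourier_minus, fourier_const_1, fourier_eit_1; auto.
    + unfold Phi. rewrite RtoC_inv by lra. field; auto.
    + apply ccont_const.
    + apply ccont_minus; auto. apply ccont_const. }
replace (RtoC (2 * PI * s) * l)%C with (RtoC s * (RtoC (2 * PI) * l))%C by (rewrite (RtoC_mult (2 * PI) s); ring).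
rewrite <- E. rewrite RtoC_inv by lra. field; auto.
Qed.

Lemma cauchy_C_derive (f : C -> C) (c : C) (s : R) : 0 < s -> hol_on f c s ->
  C_derive f c = (RtoC (/ (2 * PI * s)) * Phi f c s 1)%C.
Proof.
intros Hs H. assert (HP := PI_RGT_0).
assert (Hn : 2 * PI * s <> 0) by (apply Rgt_not_eq, Rmult_lt_0_compat; lra).
rewrite (cauchy_derivative f c s (C_derive f c)); auto.
- rewrite Cmult_assoc, <- RtoC_mult, Rinv_l by auto. ring.
- apply (hol_on_C_derive f c s); auto. replace (c - c)%C with (RtoC 0) by ring. rewrite Cmod_0; lra.
Qed.

Lemma cauchy_fourier_bound (phi : R -> C) (s M : R) (n : nat) : 0 < s ->
  ccont phi 0 (2 * PI) -> (forall t, Cmod (phi t) <= M) ->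
  Cmod (RtoC (/ (2 * PI * s)) * fourier phi n)%C <= M / s.
Proof.
intros Hs Hc HM. assert (HP := PI_RGT_0).
assert (Hn : 0 < 2 * PI * s) by (apply Rmult_lt_0_compat; lra).
rewrite Cmod_mult, Cmod_R, Rabs_pos_eq by (left; now apply Rinv_0_lt_compat).
replace (M / s) with (/ (2 * PI * s) * (M * (2 * PI))) by (field; lra).
apply Rmult_le_compat_l; [left; now apply Rinv_0_lt_compat|]. now apply fourier_bound.
Qed.

Lemma C_derive_bound (f : C -> C) (c : C) (s M : R) : 0 < s -> hol_on f c s ->
  (forall w, Cmod (w - c)%C <= s -> Cmod (f w) <= M) -> Cmod (C_derive f c) <= M / s.
Proof.
intros Hs H HM. rewrite (cauchy_C_derive f c s) by auto.
apply cauchy_fourier_bound; auto.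
- apply ccont_circle; auto; lra.
- intros t; apply HM. rewrite Cmod_circle; lra.
Qed.

(** * Holomorphic functions of one variable *)

(** The mean value theorem fails for complex values. It is applied to the real part of
    [Cconj u * G t] with [u = G 1 - G 0], whose total increment is the square of [Cmod u]. *)
Lemma rderiv_mean_value (G dG : R -> C) (K : R) :
  (forall t, 0 <= t <= 1 -> rderiv G t (dG t)) ->
  (forall t, 0 <= t <= 1 -> Cmod (dG t) <= K) -> Cmod (G 1 - G 0)%C <= K.
Proof.
intros HG HK.
set (u := (G 1 - G 0)%C).
destruct (Req_dec (Cmod u) 0) as [Hu|Hu].
{ rewrite Hu. apply Rle_trans with (Cmod (dG 0)); [apply Cmod_ge_0|apply HK; lra]. }
assert (Hu' : 0 < Cmod u) by (generalize (Cmod_ge_0 u); lra).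
assert (D : forall t, 0 <= t <= 1 -> is_derive (fun t => fst (Cconj u * G t)%C) t (fst (Cconj u * dG t)%C)).
{ intros t Ht. assert (R1 := rderiv_mult _ _ t _ _ (rderiv_const (Cconj u) t) (HG t Ht)).
  destruct R1 as [R1 _]. revert R1. 
  replace (RtoC 0 * G t + Cconj u * dG t)%C with (Cconj u * dG t)%C by ring. auto. }
destruct (MVT_gen (fun t => fst (Cconj u * G t)%C) 0 1 (fun t => fst (Cconj u * dG t)%C)) as [x [Hx E]].
- rewrite Rmin_left, Rmax_right by lra. intros; apply D; lra.
- rewrite Rmin_left, Rmax_right by lra. intros y Hy.
  apply continuity_pt_filterlim. apply (ex_derive_continuous (K := R_AbsRing) (V := R_NormedModule)).
  eexists. apply D; auto.
- rewrite Rmin_left, Rmax_right in Hx by lra.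
  assert (E2 : fst (Cconj u * G 1)%C - fst (Cconj u * G 0)%C = Cmod u * Cmod u).
  { replace (Cmod u * Cmod u) with (Cmod u ^ 2) by ring. rewrite Cmod2_alt.
    unfold u, Re, Im, Cconj, Cminus, Cplus, Copp, Cmult; simpl. ring. }
  rewrite E2 in E.
  assert (B := fst_le_Cmod (Cconj u * dG x)%C). rewrite Cmod_mult, Cmod_conj in B.
  assert (B2 := Rle_abs (fst (Cconj u * dG x)%C)).
  specialize (HK x Hx). apply Rmult_le_reg_l with (Cmod u); auto.
  apply Rle_trans with (Cmod u * Cmod (dG x)); [lra|]. apply Rmult_le_compat_l; lra.
Qed.

Definition seg (a b : C) (t : R) : C := (a + RtoC t * (b - a))%C.

Lemma rderiv_seg (a b : C) (t : R) : rderiv (seg a b) t (b - a)%C.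
Proof. split; simpl; auto_derive; auto; ring. Qed.

Lemma seg_dist (a b : C) (t : R) : 0 <= t <= 1 -> Cmod (seg a b t - a)%C <= Cmod (b - a)%C.
Proof.
intros Ht. unfold seg. replace (a + RtoC t * (b - a) - a)%C with (RtoC t * (b - a))%C by ring.
rewrite Cmod_mult, Cmod_R, Rabs_pos_eq by lra. generalize (Cmod_ge_0 (b - a)%C). nra.
Qed.

Lemma seg_0 (a b : C) : seg a b 0 = a.
Proof. unfold seg. ring. Qed.

Lemma seg_1 (a b : C) : seg a b 1 = b.
Proof. unfold seg. ring. Qed.

Lemma mean_value (f f' : C -> C) (a b : C) (K : R) :
  (forall w, Cmod (w - a)%C <= Cmod (b - a)%C -> cderiv f w (f' w) /\ Cmod (f' w) <= K) ->
  Cmod (f b - f a)%C <= K * Cmod (b - a)%C.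
Proof.
intros H. rewrite <- (seg_1 a b) at 1. rewrite <- (seg_0 a b) at 2.
apply (rderiv_mean_value (fun t => f (seg a b t)) (fun t => f' (seg a b t) * (b - a))%C).
- intros t Ht. apply rderiv_comp; [|apply rderiv_seg]. apply H, seg_dist; auto.
- intros t Ht. rewrite Cmod_mult. apply Rmult_le_compat_r; [apply Cmod_ge_0|]. apply H, seg_dist; auto.
Qed.

Lemma Cminus_diag (c : C) : (c - c)%C = RtoC 0.
Proof. ring. Qed.

Lemma Cmod_minus_triangle (a b c : C) : Cmod (a - c)%C <= Cmod (a - b)%C + Cmod (b - c)%C.
Proof. replace (a - c)%C with ((a - b) + (b - c))%C by ring. apply Cmod_triangle. Qed.

(** The last hypothesis keeps the disc about [v] through [w] in the half disc about [c], where
    Cauchy's estimate has the radius [s / 2] available and bounds the derivative by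
    [M / (s / 2)]. *)
Lemma hol_lipschitz (f : C -> C) (c : C) (s M : R) (v w : C) : 0 < s -> hol_on f c s ->
  (forall w, Cmod (w - c)%C <= s -> Cmod (f w) <= M) ->
  Cmod (v - c)%C + Cmod (w - v)%C <= s / 2 -> Cmod (f w - f v)%C <= 2 * M / s * Cmod (w - v)%C.
Proof.
intros Hs H HM Hvw. apply (mean_value f (C_derive f)). intros u Hu.
assert (Huc : Cmod (u - c)%C <= s / 2).
{ eapply Rle_trans; [apply (Cmod_minus_triangle u v c)|]. lra. }
split.
- apply (hol_on_C_derive f c s); auto. lra.
- replace (2 * M / s) with (M / (s / 2)) by (field; lra).
  apply C_derive_bound; [lra| |].
  + apply (hol_on_sub f c u s (s / 2)); auto. lra.
  + intros z Hz. apply HM. eapply Rle_trans; [apply (Cmod_minus_triangle z u c)|]. lra.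
Qed.

(** Both derivatives are integrals over circles of radius [s / 4] that differ by the translation
    [h], so the integrands differ by at most [2 * M / s * Cmod h]. Division by [s / 4] produces the
    constant 8. *)
Lemma C_derive_lipschitz (f : C -> C) (c h : C) (s M : R) : 0 < s -> hol_on f c s ->
  (forall w, Cmod (w - c)%C <= s -> Cmod (f w) <= M) -> Cmod h <= s / 4 ->
  Cmod (C_derive f (c + h) - C_derive f c)%C <= 8 * M / (s * s) * Cmod h.
Proof.
intros Hs H HM Hh.
assert (Hh' : Cmod (c + h - c)%C = Cmod h) by (f_equal; ring).
assert (H1 : hol_on f (c + h)%C (s / 4)) by (apply (hol_on_sub f c _ s); auto; rewrite Hh'; lra).
assert (H0 : hol_on f c (s / 4)) by (apply (hol_on_sub f c _ s); auto; rewrite Cminus_diag, Cmod_0; lra).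
rewrite (cauchy_C_derive f (c + h)%C (s / 4)), (cauchy_C_derive f c (s / 4)) by (auto; lra).
unfold Phi.
assert (C1 := ccont_circle f (c + h)%C (s / 4) 0 (2 * PI) ltac:(lra) H1).
assert (C0 := ccont_circle f c (s / 4) 0 (2 * PI) ltac:(lra) H0).
replace (RtoC (/ (2 * PI * (s / 4))) * fourier (fun t => f (circle (c + h) (s / 4) t)) 1 - 
  RtoC (/ (2 * PI * (s / 4))) * fourier (fun t => f (circle c (s / 4) t)) 1)%C with
  (RtoC (/ (2 * PI * (s / 4))) * fourier (fun t => f (circle (c + h) (s / 4) t) - f (circle c (s / 4) t))%C 1)%C
  by (rewrite fourier_minus by auto; ring).
replace (8 * M / (s * s) * Cmod h) with ((2 * M / s * Cmod h) / (s / 4)) by (field; lra).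
apply cauchy_fourier_bound; [lra|now apply ccont_minus|].
intros t. replace (Cmod h) with (Cmod (circle (c + h) (s / 4) t - circle c (s / 4) t)%C)
  by (f_equal; unfold circle; ring).
apply (hol_lipschitz f c s); auto.
rewrite Cmod_circle by lra. replace (circle (c + h) (s / 4) t - circle c (s / 4) t)%C with h by (unfold circle; ring).
lra.
Qed.

(** Mean value inequality for [f] minus its linear part at [c]; the derivative of this difference is
    small by [C_derive_lipschitz]. *)
Lemma quadratic_remainder (f : C -> C) (c h : C) (s M : R) : 0 < s -> hol_on f c s ->
  (forall w, Cmod (w - c)%C <= s -> Cmod (f w) <= M) -> Cmod h <= s / 4 ->
  Cmod (f (c + h) - f c - C_derive f c * h)%C <= 8 * M / (s * s) * (Cmod h * Cmod h).
Proof.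
intros Hs H HM Hh.
assert (Hh' : Cmod (c + h - c)%C = Cmod h) by (f_equal; ring).
assert (HM0 : 0 <= M).
{ eapply Rle_trans; [apply (Cmod_ge_0 (f c))|]. apply HM. rewrite Cminus_diag, Cmod_0; lra. }
assert (HK : 0 <= 8 * M / (s * s)) by (apply Rmult_le_pos; [lra|left; apply Rinv_0_lt_compat; nra]).
replace (f (c + h) - f c - C_derive f c * h)%C with
  ((fun w => f w + (- C_derive f c) * w) (c + h) - (fun w => f w + (- C_derive f c) * w) c)%C by (cbv beta; ring).
rewrite <- Rmult_assoc. rewrite <- Hh' at 2.
apply (mean_value (fun w => f w + (- C_derive f c) * w)%C (fun w => C_derive f w - C_derive f c)%C).
intros w Hw. rewrite Hh' in Hw. split.
- apply is_derive_cderiv. 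
  apply (is_derive_plus (K := C_AbsRing) (V := C_NormedModule) f (fun w => - C_derive f c * w)%C w (C_derive f w) (- C_derive f c)%C).
  + apply is_derive_cderiv, (hol_on_C_derive f c s); auto; lra.
  + apply is_derive_cderiv. intros eps Heps; exists 1; split; [lra|]. intros v _.
    replace (- C_derive f c * v - - C_derive f c * w - - C_derive f c * (v - w))%C with (RtoC 0) by ring.
    rewrite Cmod_0. generalize (Cmod_ge_0 (v - w)%C). nra.
- replace w with (c + (w - c))%C at 1 by ring.
  eapply Rle_trans; [apply (C_derive_lipschitz f c (w - c)%C s M); auto; lra|].
  apply Rmult_le_compat_l; auto.
Qed.

Lemma quadratic_cderiv (f : C -> C) (c l : C) (K r : R) : 0 < r ->
  (forall h, Cmod h < r -> Cmod (f (c + h) - f c - l * h)%C <= K * (Cmod h * Cmod h)) ->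
  cderiv f c l.
Proof.
intros Hr H eps Heps.
set (B := Rabs K + 1). assert (HB : 0 < B) by (unfold B; generalize (Rabs_pos K); lra).
exists (Rmin r (eps / B)). split; [apply Rmin_glb_lt; auto; now apply Rdiv_lt_0_compat|].
intros w Hw. assert (H1 : Cmod (w - c)%C < r) by (eapply Rlt_le_trans; [exact Hw|apply Rmin_l]).
assert (H2 : Cmod (w - c)%C < eps / B) by (eapply Rlt_le_trans; [exact Hw|apply Rmin_r]).
specialize (H (w - c)%C H1). replace (c + (w - c))%C with w in H by ring.
eapply Rle_trans; [exact H|]. set (q := Cmod (w - c)%C) in *.
assert (Hq : 0 <= q) by apply Cmod_ge_0.
assert (B * q <= eps).
{ apply Rle_trans with (B * (eps / B)); [apply Rmult_le_compat_l; lra|right; field; lra]. }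
assert (K <= B) by (unfold B; generalize (Rle_abs K); lra).
rewrite <- Rmult_assoc. apply Rmult_le_compat_r; auto. nra.
Qed.

(** Differentiation under the integral sign with respect to the parameter [k]. A remainder quadratic
    in [k], uniformly on the circle, passes through the integral directly. The parameter will be
    first the centre of the circle, later the second variable. *)
Lemma fourier_quadratic (G : C -> R -> C) (g : R -> C) (k : C) (s K : R) : 0 < s ->
  ccont (G k) 0 (2 * PI) -> ccont (G (RtoC 0)) 0 (2 * PI) -> ccont g 0 (2 * PI) ->
  (forall t, Cmod (G k t - G (RtoC 0) t - g t * k)%C <= K * (Cmod k * Cmod k)) ->
  Cmod (RtoC (/ (2 * PI * s)) * fourier (G k) 1 - RtoC (/ (2 * PI * s)) * fourier (G (RtoC 0)) 1
    - RtoC (/ (2 * PI * s)) * fourier g 1 * k)%C <= K / s * (Cmod k * Cmod k).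
Proof.
intros Hs H1 H0 Hg HK.
replace (RtoC (/ (2 * PI * s)) * fourier (G k) 1 - RtoC (/ (2 * PI * s)) * fourier (G (RtoC 0)) 1
    - RtoC (/ (2 * PI * s)) * fourier g 1 * k)%C with
  (RtoC (/ (2 * PI * s)) * fourier (fun t => G k t - G (RtoC 0) t - k * g t)%C 1)%C.
- replace (K / s * (Cmod k * Cmod k)) with ((K * (Cmod k * Cmod k)) / s) by (field; lra).
  apply cauchy_fourier_bound; auto.
  + apply ccont_minus; [now apply ccont_minus|]. apply ccont_mult; auto. apply ccont_const.
  + intros t. rewrite (Cmult_comm k). auto.
- rewrite fourier_minus, fourier_minus, fourier_scal; auto; [ring| |].
  + now apply ccont_minus.
  + apply ccont_mult; auto. apply ccont_const.
Qed.

(** Continuity at the centre is enough once the radius may shrink; compactness of the disc is not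
    called upon. *)
Lemma hol_bounded (f : C -> C) (c : C) (s : R) : 0 < s -> hol_on f c s ->
  exists M r, 0 < r <= s /\ forall w, Cmod (w - c)%C <= r -> Cmod (f w) <= M.
Proof.
intros Hs H. destruct (H c) as [l Hl]; [rewrite Cminus_diag, Cmod_0; lra|].
apply cderiv_continuous in Hl. 
destruct (proj1 (continuous_CC_eps f c) Hl 1 Rlt_0_1) as [d [Hd K]].
exists (1 + Cmod (f c)), (Rmin s (d / 2)). split; [split; [apply Rmin_glb_lt; lra|apply Rmin_l]|].
intros w Hw. assert (Hwd : Cmod (w - c)%C < d) by (eapply Rle_lt_trans; [exact Hw|]; eapply Rle_lt_trans; [apply Rmin_r|lra]).
specialize (K w Hwd). replace (f w) with ((f w - f c) + f c)%C by ring.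
eapply Rle_trans; [apply Cmod_triangle|]. lra.
Qed.

(** Moving [c] translates the circle in Cauchy's formula, so [C_derive f (c + h)] is an integral
    over one fixed circle with [h] as a parameter in the integrand. The derivative is therefore the
    same integral with [C_derive f] in place of [f]. *)
Lemma C_derive_hol (f : C -> C) (c : C) (s : R) : 0 < s -> hol_on f c s ->
  exists l, cderiv (C_derive f) c l.
Proof.
intros Hs0 H0. destruct (hol_bounded f c s Hs0 H0) as [M [r [Hr HM]]].
assert (H : hol_on f c r) by (apply (hol_on_sub f c c s r); auto; rewrite Cminus_diag, Cmod_0; lra).
destruct Hr as [Hr _]. clear s Hs0 H0.
(* Discs of radius [r / 2] about the points of this circle stay in the disc of radius [r], and
   increments below [r / 8] are a quarter of [r / 2], as [quadratic_remainder] requires. *)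
set (q := r / 4). assert (Hq : 0 < q) by (unfold q; lra).
set (K := 8 * M / (r / 2 * (r / 2))).
assert (Hv : forall t, hol_on f (circle c q t) (r / 2)).
{ intros t. apply (hol_on_sub f c _ r); auto. rewrite Cmod_circle by lra. unfold q; lra. }
assert (HMv : forall t w, Cmod (w - circle c q t)%C <= r / 2 -> Cmod (f w) <= M).
{ intros t w Hw. apply HM. eapply Rle_trans; [apply (Cmod_minus_triangle w (circle c q t) c)|].
  rewrite (Cmod_circle c q t) by lra. unfold q in *; lra. }
exists (RtoC (/ (2 * PI * q)) * fourier (fun t => C_derive f (circle c q t)) 1)%C.
apply (quadratic_cderiv _ _ _ (K / q) (r / 8)); [lra|].
intros h Hh.
assert (Hh' : Cmod (c + h - c)%C = Cmod h) by (f_equal; ring).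
assert (H1 : forall h, Cmod h < r / 8 -> hol_on f (c + h)%C q).
{ intros k Hk. apply (hol_on_sub f c _ r); auto. replace (c + k - c)%C with k by ring. unfold q; lra. }
rewrite (cauchy_C_derive f (c + h)%C q), (cauchy_C_derive f c q) by (auto; try lra; replace c with (c + RtoC 0)%C by ring; apply H1; rewrite Cmod_0; lra).
assert (E0 : Phi f c q 1 = fourier ((fun h t => f (circle c q t + h)%C) (RtoC 0)) 1).
{ apply fourier_ext. intros t. f_equal. ring. }
assert (E1 : Phi f (c + h) q 1 = fourier ((fun h t => f (circle c q t + h)%C) h) 1).
{ apply fourier_ext. intros t. f_equal. unfold circle. ring. }
assert (Cc : forall k, Cmod k < r / 8 -> ccont (fun t => f (circle c q t + k)%C) 0 (2 * PI)).
{ intros k Hk. generalize (ccont_circle f (c + k)%C q 0 (2 * PI) ltac:(lra) (H1 k Hk)).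
  intros G t Ht. generalize (G t Ht). apply continuous_ext. intros u; f_equal. unfold circle; ring. }
rewrite E0, E1.
apply (fourier_quadratic (fun h t => f (circle c q t + h)%C) (fun t => C_derive f (circle c q t)) h q K); auto.
- apply Cc; rewrite Cmod_0; lra.
- apply ccont_circle_cont. intros t. apply continuous_CC_eps. intros eps Heps.
  assert (HK : 0 <= K).
  { unfold K. apply Rmult_le_pos; [|left; apply Rinv_0_lt_compat; nra].
    assert (0 <= M) by (eapply Rle_trans; [apply (Cmod_ge_0 (f c))|]; apply HM; rewrite Cminus_diag, Cmod_0; lra). lra. }
  exists (Rmin (r / 8) (eps / (K + 1))). split.
  { apply Rmin_glb_lt; [lra|apply Rdiv_lt_0_compat; lra]. }
  intros w Hw.
  assert (W1 : Cmod (w - circle c q t)%C < r / 8) by (eapply Rlt_le_trans; [exact Hw|apply Rmin_l]).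
  assert (W2 : Cmod (w - circle c q t)%C < eps / (K + 1)) by (eapply Rlt_le_trans; [exact Hw|apply Rmin_r]).
  replace w with (circle c q t + (w - circle c q t))%C at 1 by ring.
  eapply Rle_lt_trans; [apply (C_derive_lipschitz f (circle c q t) (w - circle c q t)%C (r / 2) M); auto; try lra; apply HMv|].
  fold K. apply Rle_lt_trans with ((K + 1) * Cmod (w - circle c q t)%C).
  { apply Rmult_le_compat_r; [apply Cmod_ge_0|lra]. }
  apply Rmult_lt_compat_l with (r := K + 1) in W2; [|lra].
  replace ((K + 1) * (eps / (K + 1))) with eps in W2 by (field; lra). exact W2.
- intros t. replace (circle c q t + RtoC 0)%C with (circle c q t) by ring.
  apply (quadratic_remainder f (circle c q t) h (r / 2) M); auto; try lra. apply HMv.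
Qed.

(** * Derivatives of all orders and Cauchy's estimate *)

Definition hol_disc (f : C -> C) : Prop := forall w, Cmod w < 1 -> exists l, cderiv f w l.

Lemma hol_disc_on (f : C -> C) (c : C) (s : R) : hol_disc f -> Cmod c + s < 1 -> hol_on f c s.
Proof.
intros H Hs w Hw. apply H. replace w with ((w - c) + c)%C by ring.
eapply Rle_lt_trans; [apply Cmod_triangle|]. lra.
Qed.

Lemma hol_disc_C_derive (f : C -> C) : hol_disc f -> hol_disc (C_derive f).
Proof.
intros H w Hw. apply (C_derive_hol f w ((1 - Cmod w) / 2)); [lra|].
apply hol_disc_on; auto; lra.
Qed.

Lemma hol_disc_iter (f : C -> C) (n : nat) : hol_disc f -> hol_disc (Nat.iter n C_derive f).
Proof. intros H; induction n; simpl; auto. now apply hol_disc_C_derive. Qed.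

(** Integration by parts over a full period: the derivative of
    [f (circle c s t) * eit (- INR (S n) * t)] integrates to 0. The factor [eit t] in the velocity
    of the circle shifts the frequency from [S n] to [n]. *)
Lemma Phi_C_derive (f : C -> C) (c : C) (s : R) (n : nat) : 0 < s ->
  hol_on f c s -> hol_on (C_derive f) c s ->
  (RtoC s * Phi (C_derive f) c s n)%C = (RtoC (INR (S n)) * Phi f c s (S n))%C.
Proof.
intros Hs H H'. unfold Phi, fourier.
assert (C1 := ccont_circle f c s 0 (2 * PI) ltac:(lra) H).
assert (C2 := ccont_circle (C_derive f) c s 0 (2 * PI) ltac:(lra) H').
assert (Ce : forall k, ccont (fun u => k * eit u)%C 0 (2 * PI)).
{ intros k. apply ccont_mult; [apply ccont_const|].
  intros u Hu. generalize (ccont_eit 1 0 (2 * PI) u Hu). apply continuous_ext. intros; f_equal; ring. }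
assert (E := CInt_derive (fun t => f (circle c s t) * eit (- INR (S n) * t))%C
  (fun t => (C_derive f (circle c s t) * (RtoC s * Ci * eit t)) * eit (- INR (S n) * t)
    + f (circle c s t) * (RtoC (- INR (S n)) * Ci * eit (- INR (S n) * t)))%C 0 (2 * PI) pi2_pos).
cbv beta in E. rewrite circle_period in E.
replace (eit (- INR (S n) * (2 * PI))) with (eit (- INR (S n) * 0)) in E.
2: { rewrite Rmult_0_r, eit_0. replace (- INR (S n) * (2 * PI)) with (- (INR (S n) * (2 * PI))) by ring.
  rewrite <- (eit_opp_inv (INR (S n) * (2 * PI))). rewrite eit_2npi. ring. }
rewrite Cminus_diag in E.
rewrite (CInt_ext _ (fun t => Ci * (RtoC s * (C_derive f (circle c s t) * eit (- INR n * t))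
   - RtoC (INR (S n)) * (f (circle c s t) * eit (- INR (S n) * t))))%C) in E.
- rewrite CInt_scal, CInt_minus, !CInt_scal in E; auto using pi2_pos, ccont_mult, ccont_eit, ccont_const, ccont_minus.
  set (A := CInt (fun t : R => (C_derive f (circle c s t) * eit (- INR n * t))%C) 0 (2 * PI)) in *.
  set (B := CInt (fun t : R => (f (circle c s t) * eit (- INR (S n) * t))%C) 0 (2 * PI)) in *.
  apply Ceq_minus. replace (RtoC s * A - RtoC (INR (S n)) * B)%C with 
   (- Ci * (Ci * (RtoC s * A - RtoC (INR (S n)) * B)))%C.
  + rewrite E; auto.
    * ring.
    * intros t Ht. apply (rderiv_mult (fun t => f (circle c s t)) (fun t => eit (- INR (S n) * t))); [|apply rderiv_eit].
      apply rderiv_comp; [|apply rderiv_circle]. apply (hol_on_C_derive f c s); auto.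
      rewrite Cmod_circle; lra.
    * apply ccont_plus.
      -- apply ccont_mult; [|apply ccont_eit]. apply ccont_mult; auto.
      -- apply ccont_mult; auto. apply ccont_mult; [apply ccont_const|apply ccont_eit].
  + rewrite Cmult_assoc. replace (- Ci * Ci)%C with (RtoC 1); [ring|].
    unfold Ci, Cmult, Copp, RtoC; simpl; f_equal; ring.
- apply pi2_pos.
- intros t _. replace (- INR n * t) with (t + - INR (S n) * t) by (rewrite S_INR; ring).
  rewrite eit_add. rewrite RtoC_opp. ring.
Qed.

Lemma Phi_iter (f : C -> C) (c : C) (s : R) (m n : nat) : 0 < s -> hol_disc f -> Cmod c + s < 1 ->
  (RtoC (INR (fact n)) * RtoC s ^ m * Phi (Nat.iter m C_derive f) c s n)%C
  = (RtoC (INR (fact (m + n))) * Phi f c s (m + n))%C.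
Proof.
intros Hs Hf Hcs. revert n. induction m; intros n.
- simpl. ring.
- specialize (IHm (S n)). replace (m + S n)%nat with (S m + n)%nat in IHm by lia.
  rewrite <- IHm. simpl Nat.iter. 
  replace (RtoC (INR (fact n)) * RtoC s ^ S m * Phi (C_derive (Nat.iter m C_derive f)) c s n)%C with
   (RtoC (INR (fact n)) * RtoC s ^ m * (RtoC s * Phi (C_derive (Nat.iter m C_derive f)) c s n))%C
   by (simpl Cpow; ring).
  rewrite Phi_C_derive; auto.
  + rewrite fact_simpl, mult_INR, RtoC_mult. ring.
  + apply hol_disc_on; auto. now apply hol_disc_iter.
  + apply hol_disc_on; auto. apply (hol_disc_iter f (S m)); auto.
Qed.

Theorem cauchy_estimate (f : C -> C) (c : C) (s M : R) (n : nat) : 0 < s -> hol_disc f ->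
  Cmod c + s < 1 -> (forall w, Cmod (w - c)%C <= s -> Cmod (f w) <= M) ->
  Cmod (Nat.iter n C_derive f c) <= INR (fact n) * M / s ^ n.
Proof.
intros Hs Hf Hcs HM. destruct n as [|m].
{ simpl. replace (1 * M / 1) with M by field. apply HM. rewrite Cminus_diag, Cmod_0; lra. }
simpl Nat.iter.
assert (HP := PI_RGT_0).
rewrite (cauchy_C_derive _ c s); auto.
2: { apply hol_disc_on; auto. now apply hol_disc_iter. }
(* Index 1 turns the first coefficient of the derivative of order [m] into the coefficient of order
   [S m] of [f] on the same circle, so no radius is lost by iterating. *)
assert (E := Phi_iter f c s m 1 Hs Hf Hcs). replace (m + 1)%nat with (S m) in E by lia.
assert (Hsm : 0 < s ^ m) by now apply pow_lt.
assert (EM : Cmod (RtoC (INR (fact 1)) * RtoC s ^ m * Phi (Nat.iter m C_derive f) c s 1)%C =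
  s ^ m * Cmod (Phi (Nat.iter m C_derive f) c s 1)).
{ rewrite !Cmod_mult, Cmod_pow, !Cmod_R. simpl. rewrite Rabs_R1, (Rabs_pos_eq s) by lra. ring. }
rewrite E, Cmod_mult, Cmod_R, Rabs_pos_eq in EM by apply pos_INR.
assert (HB : Cmod (Phi f c s (S m)) <= M * (2 * PI)).
{ apply fourier_bound.
  - apply ccont_circle; [lra|]. now apply hol_disc_on.
  - intros t; apply HM. rewrite Cmod_circle; lra. }
rewrite Cmod_mult, Cmod_R, Rabs_pos_eq by (left; apply Rinv_0_lt_compat, Rmult_lt_0_compat; lra).
replace (Cmod (Phi (Nat.iter m C_derive f) c s 1)) with (INR (fact (S m)) * Cmod (Phi f c s (S m)) / s ^ m).
2: { rewrite EM. field; lra. }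
replace (INR (fact (S m)) * M / s ^ S m) with (/ (2 * PI * s) * (INR (fact (S m)) * (M * (2 * PI)) / s ^ m)).
2: { simpl pow. field. repeat split; lra. }
apply Rmult_le_compat_l; [left; apply Rinv_0_lt_compat, Rmult_lt_0_compat; lra|].
apply Rmult_le_compat_r; [left; now apply Rinv_0_lt_compat|].
apply Rmult_le_compat_l; [apply pos_INR|exact HB].
Qed.

(** * Holomorphic functions on the bidisc *)

Lemma inD2_pair (a b : C) : inD2 (a, b) <-> Cmod a < 1 /\ Cmod b < 1.
Proof. unfold inD2; simpl; tauto. Qed.

Lemma analytic_slice1 (F : C * C -> C) (b : C) : analytic_D2 F -> Cmod b < 1 ->
  hol_disc (fun w => F (w, b)).
Proof.
intros H Hb w Hw. destruct (H (w, b)) as [_ [H1 _]]; [now apply (proj2 (inD2_pair _ _))|].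
simpl in H1. exists (C_derive (fun w => F (w, b)) w). now apply ex_derive_cderiv.
Qed.

Lemma analytic_slice2 (F : C * C -> C) (a : C) : analytic_D2 F -> Cmod a < 1 ->
  hol_disc (fun w => F (a, w)).
Proof.
intros H Hb w Hw. destruct (H (a, w)) as [_ [_ H1]]; [now apply (proj2 (inD2_pair _ _))|].
simpl in H1. exists (C_derive (fun w => F (a, w)) w). now apply ex_derive_cderiv.
Qed.

Lemma analytic_intro (F : C * C -> C) :
  (forall z, inD2 z -> continuous F z) ->
  (forall b, Cmod b < 1 -> hol_disc (fun w => F (w, b))) ->
  (forall a, Cmod a < 1 -> hol_disc (fun w => F (a, w))) -> analytic_D2 F.
Proof.
intros Hc H1 H2 [a b] Hz. split; [auto|]. apply (proj1 (inD2_pair _ _)) in Hz. simpl. split.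
- destruct (H1 b (proj2 Hz) a (proj1 Hz)) as [l Hl]. exists l. now apply is_derive_cderiv.
- destruct (H2 a (proj1 Hz) b (proj2 Hz)) as [l Hl]. exists l. now apply is_derive_cderiv.
Qed.

Definition swap (F : C * C -> C) : C * C -> C := fun z => F (snd z, fst z).

Lemma analytic_swap (F : C * C -> C) : analytic_D2 F -> analytic_D2 (swap F).
Proof.
intros H. apply analytic_intro.
- intros [a b] Hz. apply (proj1 (inD2_pair _ _)) in Hz.
  destruct (H (b, a)) as [Hc _]; [apply (proj2 (inD2_pair _ _)); tauto|].
  apply continuous_C2C_eps. intros eps Heps.
  destruct (proj1 (continuous_C2C_eps F (b, a)) Hc eps Heps) as [d [Hd K]].
  exists d; split; auto. intros [x y] Hx Hy. apply (K (y, x)); auto.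
- intros b Hb. now apply (analytic_slice2 F b).
- intros a Ha. now apply (analytic_slice1 F a).
Qed.

Lemma analytic_locally_bounded (F : C * C -> C) (a b : C) : analytic_D2 F -> inD2 (a, b) ->
  exists s M, 0 < s /\ Cmod a + s < 1 /\ Cmod b + s < 1 /\
    forall u v, Cmod (u - a)%C <= s -> Cmod (v - b)%C <= s -> Cmod (F (u, v)) <= M.
Proof.
intros H Hz. assert (Hz' := proj1 (inD2_pair a b) Hz). destruct (H _ Hz) as [Hc _].
destruct (proj1 (continuous_C2C_eps F (a, b)) Hc 1 Rlt_0_1) as [d [Hd K]].
set (s := Rmin (d / 2) (Rmin ((1 - Cmod a) / 2) ((1 - Cmod b) / 2))).
assert (S1 : s <= d / 2) by apply Rmin_l.
assert (S2 : s <= (1 - Cmod a) / 2) by (eapply Rle_trans; [apply Rmin_r|apply Rmin_l]).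
assert (S3 : s <= (1 - Cmod b) / 2) by (eapply Rle_trans; [apply Rmin_r|apply Rmin_r]).
assert (S0 : 0 < s) by (unfold s; apply Rmin_glb_lt; [lra|apply Rmin_glb_lt; lra]).
exists s, (1 + Cmod (F (a, b))). repeat split; try lra.
intros u v Hu Hv. specialize (K (u, v)). simpl in K.
specialize (K ltac:(lra) ltac:(lra)).
replace (F (u, v)) with ((F (u, v) - F (a, b)) + F (a, b))%C by ring.
eapply Rle_trans; [apply Cmod_triangle|]. lra.
Qed.

(** Both values are Cauchy integrals over circles of one radius [q], about [u] and about [a]. The
    integrands are compared pointwise, one variable being changed at a time. *)
Lemma D1_locally_lipschitz (F : C * C -> C) (a b : C) : analytic_D2 F -> inD2 (a, b) ->
  exists s K, 0 < s /\ forall u v, Cmod (u - a)%C <= s -> Cmod (v - b)%C <= s ->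
    Cmod (D1 F (u, v) - D1 F (a, b))%C <= K * (Cmod (u - a)%C + Cmod (v - b)%C).
Proof.
intros H Hz. destruct (analytic_locally_bounded F a b H Hz) as [r [M [Hr [Ha [Hb HM]]]]].
set (q := r / 4). assert (Hq : 0 < q) by (unfold q; lra).
exists (r / 8), (2 * M / r / q). split; [lra|]. intros u v Hu Hv.
assert (Hb0 : Cmod b < 1) by lra.
assert (Hv0 : Cmod v < 1).
{ replace v with ((v - b) + b)%C by ring. eapply Rle_lt_trans; [apply Cmod_triangle|]. lra. }
assert (Hu0 : Cmod u + q < 1).
{ replace u with ((u - a) + a)%C by ring. unfold q.
  generalize (Cmod_triangle (u - a) a). lra. }
assert (B1 := analytic_slice1 F b H Hb0). assert (B2 := analytic_slice1 F v H Hv0).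
assert (E1 : D1 F (u, v) = C_derive (fun w => F (w, v)) u) by reflexivity.
assert (E2 : D1 F (a, b) = C_derive (fun w => F (w, b)) a) by reflexivity.
rewrite E1, E2.
assert (G1 : hol_on (fun w => F (w, v)) u q) by (apply hol_disc_on; auto).
assert (G2 : hol_on (fun w => F (w, b)) a q) by (apply hol_disc_on; auto; unfold q; lra).
rewrite (cauchy_C_derive _ u q), (cauchy_C_derive _ a q) by auto.
assert (C1 := ccont_circle (fun w => F (w, v)) u q 0 (2 * PI) ltac:(lra) G1).
assert (C2 := ccont_circle (fun w => F (w, b)) a q 0 (2 * PI) ltac:(lra) G2).
replace (RtoC (/ (2 * PI * q)) * Phi (fun w => F (w, v)) u q 1 - RtoC (/ (2 * PI * q)) * Phi (fun w => F (w, b)) a q 1)%C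
 with (RtoC (/ (2 * PI * q)) * fourier (fun t => F (circle u q t, v) - F (circle a q t, b))%C 1)%C.
2: { rewrite fourier_minus; auto. unfold Phi. ring. }
replace (2 * M / r / q * (Cmod (u - a)%C + Cmod (v - b)%C)) with ((2 * M / r * (Cmod (u - a)%C + Cmod (v - b)%C)) / q) by (field; lra).
apply cauchy_fourier_bound; auto; [now apply ccont_minus|].
intros t.
eapply Rle_trans; [apply (Cmod_minus_triangle _ (F (circle a q t, v)))|].
rewrite Rmult_plus_distr_l. apply Rplus_le_compat.
- replace (u - a)%C with (circle u q t - circle a q t)%C by (unfold circle; ring).
  apply (hol_lipschitz (fun w => F (w, v)) a r M); auto.
  + apply hol_disc_on; auto.
  + intros w Hw. apply HM; lra.
  + rewrite Cmod_circle by lra. replace (circle u q t - circle a q t)%C with (u - a)%C by (unfold circle; ring).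
    unfold q; lra.
- apply (hol_lipschitz (fun w => F (circle a q t, w)) b r M); auto.
  + apply hol_disc_on; auto. apply analytic_slice2; auto.
    replace (circle a q t) with ((circle a q t - a) + a)%C by ring.
    eapply Rle_lt_trans; [apply Cmod_triangle|]. rewrite Cmod_circle by lra. unfold q; lra.
  + intros w Hw. apply HM; auto. rewrite Cmod_circle by lra. unfold q; lra.
  + rewrite Cminus_diag, Cmod_0. lra.
Qed.

Lemma D1_continuous (F : C * C -> C) (z : C * C) : analytic_D2 F -> inD2 z -> continuous (D1 F) z.
Proof.
intros H Hz. destruct z as [a b]. destruct (D1_locally_lipschitz F a b H Hz) as [s [K [Hs HK]]].
apply continuous_C2C_eps. intros eps Heps.
set (B := Rabs K + 1). assert (HB : 0 < B) by (unfold B; generalize (Rabs_pos K); lra).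
set (e := eps / (2 * B)). assert (He : 0 < e) by (unfold e; apply Rdiv_lt_0_compat; lra).
exists (Rmin s e). split; [now apply Rmin_glb_lt|].
intros [u v]; simpl; intros Hu Hv.
assert (M1 := Rmin_l s e). assert (M2 := Rmin_r s e).
eapply Rle_lt_trans; [apply HK; lra|].
set (x := Cmod (u - a)%C + Cmod (v - b)%C). 
assert (Hx0 : 0 <= x) by (unfold x; generalize (Cmod_ge_0 (u - a)%C) (Cmod_ge_0 (v - b)%C); lra).
assert (Hx : x < 2 * e) by (unfold x; lra).
apply Rle_lt_trans with (B * x).
- apply Rmult_le_compat_r; auto. unfold B; generalize (Rle_abs K); lra.
- apply Rlt_le_trans with (B * (2 * e)); [now apply Rmult_lt_compat_l|].
  right. unfold e; field; lra.
Qed.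

Lemma D2_swap (F : C * C -> C) : D2 F = swap (D1 (swap F)).
Proof. reflexivity. Qed.

Lemma D2_continuous (F : C * C -> C) (z : C * C) : analytic_D2 F -> inD2 z -> continuous (D2 F) z.
Proof.
intros H Hz. rewrite D2_swap. destruct z as [a b].
assert (Hc := D1_continuous (swap F) (b, a) (analytic_swap F H)).
apply (proj1 (inD2_pair _ _)) in Hz. specialize (Hc ltac:(apply (proj2 (inD2_pair _ _)); tauto)).
apply continuous_C2C_eps. intros eps Heps.
destruct (proj1 (continuous_C2C_eps _ (b, a)) Hc eps Heps) as [d [Hd K]].
exists d; split; auto. intros [x y] Hx Hy. apply (K (y, x)); auto.
Qed.

Lemma continuous_slice1 (G : C * C -> C) (a b : C) : continuous G (a, b) ->
  continuous (T := C_UniformSpace) (U := C_UniformSpace) (fun w => G (w, b)) a.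
Proof.
intros Hc. apply continuous_CC_eps. intros eps Heps.
destruct (proj1 (continuous_C2C_eps _ _) Hc eps Heps) as [d [Hd K]].
exists d; split; auto. intros w Hw. apply (K (w, b)); auto. simpl. now rewrite Cminus_diag, Cmod_0.
Qed.

(* The integral in the derivative is Cauchy's formula for [D1 (D2 F)], whence the symmetry of mixed partials. *)
Lemma D1_cderiv_snd (F : C * C -> C) (a b : C) : analytic_D2 F -> inD2 (a, b) ->
  exists q, 0 < q /\ Cmod a + q < 1 /\ cderiv (fun w => D1 F (a, w)) b
    (RtoC (/ (2 * PI * q)) * fourier (fun t => D2 F (circle a q t, b)) 1)%C.
Proof.
intros H Hz. destruct (analytic_locally_bounded F a b H Hz) as [r [M [Hr [Ha [Hb HM]]]]].
set (q := r / 4). assert (Hq : 0 < q) by (unfold q; lra).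
assert (Hca : forall t, Cmod (circle a q t) < 1).
{ intros t. replace (circle a q t) with ((circle a q t - a) + a)%C by ring.
  eapply Rle_lt_trans; [apply Cmod_triangle|]. rewrite Cmod_circle by lra. unfold q; lra. }
exists q. split; [auto|split; [unfold q; lra|]].
apply (quadratic_cderiv _ _ _ (8 * M / (r * r) / q) (r / 4)); [lra|].
intros k Hk.
assert (Hbk : forall k, Cmod k < r / 4 -> Cmod (b + k)%C < 1).
{ intros j Hj. eapply Rle_lt_trans; [apply Cmod_triangle|]. lra. }
assert (Hh : forall k, Cmod k < r / 4 -> hol_on (fun w => F (w, (b + k)%C)) a q).
{ intros j Hj. apply hol_disc_on; [|unfold q; lra]. apply analytic_slice1; auto. }
assert (Hk0 : Cmod (RtoC 0) < r / 4) by (rewrite Cmod_0; lra).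
assert (E : forall j, Cmod j < r / 4 -> D1 F (a, (b + j)%C) = (RtoC (/ (2 * PI * q)) * fourier (fun t => F (circle a q t, (b + j)%C)) 1)%C).
{ intros j Hj. apply (cauchy_C_derive (fun w => F (w, (b + j)%C)) a q); auto. }
assert (E0 := E (RtoC 0) Hk0). replace (D1 F (a, (b + RtoC 0)%C)) with (D1 F (a, b)) in E0 by (do 2 f_equal; ring).
rewrite E by auto. rewrite E0.
apply (fourier_quadratic (fun j t => F (circle a q t, (b + j)%C)) (fun t => D2 F (circle a q t, b)) k q); auto.
- apply (ccont_circle (fun w => F (w, (b + k)%C)) a q); auto; lra.
- apply (ccont_circle (fun w => F (w, (b + RtoC 0)%C)) a q); auto; lra.
- apply (ccont_circle_cont (fun w => D2 F (w, b))). intros t. apply continuous_slice1.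
  apply D2_continuous; auto. apply (proj2 (inD2_pair _ _)); split; auto; lra.
- intros t. replace (b + RtoC 0)%C with b by ring.
  apply (quadratic_remainder (fun w => F (circle a q t, w)) b k r M); auto; try lra.
  + apply hol_disc_on; auto. apply analytic_slice2; auto.
  + intros w Hw. apply HM; auto. rewrite Cmod_circle by lra. unfold q; lra.
Qed.

Lemma analytic_D2_partial1 (F : C * C -> C) : analytic_D2 F -> analytic_D2 (D1 F).
Proof.
intros H. apply analytic_intro.
- intros z Hz. now apply D1_continuous.
- intros b Hb. apply (hol_disc_C_derive (fun w => F (w, b))). now apply analytic_slice1.
- intros a Ha b Hb. destruct (D1_cderiv_snd F a b H) as [q [_ [_ Hl]]]; [now apply (proj2 (inD2_pair _ _))|].
  eexists; exact Hl.
Qed.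

Lemma analytic_D2_partial2 (F : C * C -> C) : analytic_D2 F -> analytic_D2 (D2 F).
Proof. intros H. rewrite D2_swap. apply analytic_swap, analytic_D2_partial1, analytic_swap, H. Qed.

Lemma D1_D2_comm (F : C * C -> C) (z : C * C) : analytic_D2 F -> inD2 z ->
  D2 (D1 F) z = D1 (D2 F) z.
Proof.
intros H Hz. destruct z as [a b]. destruct (D1_cderiv_snd F a b H Hz) as [q [Hq [Haq Hl]]].
change (C_derive (fun w => D1 F (a, w)) b = C_derive (fun w => D2 F (w, b)) a).
rewrite (cderiv_unique _ _ _ Hl). symmetry.
apply (cauchy_C_derive (fun w => D2 F (w, b)) a q); auto.
apply hol_disc_on; auto. apply analytic_slice1; [now apply analytic_D2_partial2|]. apply (proj1 (inD2_pair _ _)) in Hz; tauto.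
Qed.

Lemma analytic_iter_D1 (F : C * C -> C) (p : nat) : analytic_D2 F -> analytic_D2 (Nat.iter p D1 F).
Proof. intros H; induction p; simpl; auto using analytic_D2_partial1. Qed.

Lemma analytic_iter_D2 (F : C * C -> C) (p : nat) : analytic_D2 F -> analytic_D2 (Nat.iter p D2 F).
Proof. intros H; induction p; simpl; auto using analytic_D2_partial2. Qed.

Lemma analytic_Dpq (F : C * C -> C) (p q : nat) : analytic_D2 F -> analytic_D2 (Dpq F p q).
Proof. intros H. apply analytic_iter_D1, analytic_iter_D2, H. Qed.

(** The partial derivatives commute only on the bidisc, so passing an equality under [D1] needs this
    local congruence in place of extensionality. *)
Lemma D1_congr (G H : C * C -> C) (z : C * C) : analytic_D2 G ->
  (forall w, inD2 w -> G w = H w) -> inD2 z -> D1 G z = D1 H z.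
Proof.
intros HG E Hz. destruct z as [a b]. apply (proj1 (inD2_pair _ _)) in Hz. destruct Hz as [Ha Hb].
destruct (analytic_slice1 G b HG Hb a Ha) as [l Hl].
change (C_derive (fun w => G (w, b)) a = C_derive (fun w => H (w, b)) a).
rewrite (cderiv_unique _ _ _ Hl). symmetry. apply cderiv_unique.
intros eps Heps. destruct (Hl eps Heps) as [d [Hd K]].
exists (Rmin d (1 - Cmod a)). split; [apply Rmin_glb_lt; lra|]. intros w Hw.
assert (M1 := Rmin_l d (1 - Cmod a)). assert (M2 := Rmin_r d (1 - Cmod a)).
rewrite <- !E.
- apply K; lra.
- now apply (proj2 (inD2_pair _ _)).
- apply (proj2 (inD2_pair _ _)); split; auto. replace w with ((w - a) + a)%C by ring.
  eapply Rle_lt_trans; [apply Cmod_triangle|]. lra.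
Qed.

(** [Dpq] applies [D2] innermost, so a further [D2] has to travel through [p] copies of [D1]. *)
Lemma D2_Dpq (F : C * C -> C) (p q : nat) (z : C * C) : analytic_D2 F -> inD2 z ->
  D2 (Dpq F p q) z = Dpq F p (S q) z.
Proof.
intros H. assert (HG := analytic_iter_D2 F q H). unfold Dpq. simpl Nat.iter at 3.
set (G := Nat.iter q D2 F) in *. revert z. induction p; intros z Hz; [reflexivity|].
simpl. rewrite D1_D2_comm; auto using analytic_iter_D1.
apply D1_congr; auto using analytic_D2_partial2, analytic_iter_D1.
Qed.

Lemma iter_D1_slice (G : C * C -> C) (p : nat) (a b : C) :
  Nat.iter p D1 G (a, b) = Nat.iter p C_derive (fun w => G (w, b)) a.
Proof.
revert a. induction p; intros a; [reflexivity|]. simpl.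
change (C_derive (fun w => Nat.iter p D1 G (w, b)) a = C_derive (Nat.iter p C_derive (fun w => G (w, b))) a).
f_equal. apply functional_extensionality. intros w. apply IHp.
Qed.

Lemma iter_D2_slice (G : C * C -> C) (p : nat) (a b : C) :
  Nat.iter p D2 G (a, b) = Nat.iter p C_derive (fun w => G (a, w)) b.
Proof.
revert b. induction p; intros b; [reflexivity|]. simpl.
change (C_derive (fun w => Nat.iter p D2 G (a, w)) b = C_derive (Nat.iter p C_derive (fun w => G (a, w))) b).
f_equal. apply functional_extensionality. intros w. apply IHp.
Qed.

Theorem cauchy_estimate_2 (F : C * C -> C) (a b : C) (s1 s2 M : R) (p q : nat) :
  analytic_D2 F -> 0 < s1 -> 0 < s2 -> Cmod a + s1 < 1 -> Cmod b + s2 < 1 ->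
  (forall u v, Cmod (u - a)%C <= s1 -> Cmod (v - b)%C <= s2 -> Cmod (F (u, v)) <= M) ->
  Cmod (Dpq F p q (a, b)) <= INR (fact p) * INR (fact q) * M / (s1 ^ p * s2 ^ q).
Proof.
intros H Hs1 Hs2 Ha Hb HM. unfold Dpq. rewrite iter_D1_slice.
replace (INR (fact p) * INR (fact q) * M / (s1 ^ p * s2 ^ q)) with
  (INR (fact p) * (INR (fact q) * M / s2 ^ q) / s1 ^ p).
2: { field. split; apply pow_nonzero; lra. }
assert (Hb0 : Cmod b < 1) by lra.
apply cauchy_estimate; auto.
- apply analytic_slice1; auto. now apply analytic_iter_D2.
- intros u Hu. rewrite iter_D2_slice. apply cauchy_estimate; auto.
  apply analytic_slice2; auto. replace u with ((u - a) + a)%C by ring.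
  eapply Rle_lt_trans; [apply Cmod_triangle|]. lra.
Qed.

(** The increment is split into a step in the second variable at [a] and a step in the first at
    height [v]. The remainder of the latter has a constant independent of [v], and continuity of
    [D1 G] replaces [D1 G (a, v)] by [D1 G (a, b)]. *)
Lemma frechet (G : C * C -> C) (a b : C) : analytic_D2 G -> inD2 (a, b) ->
  forall eps, 0 < eps -> exists d, 0 < d /\ forall u v, Cmod (u - a)%C < d -> Cmod (v - b)%C < d ->
    Cmod (G (u, v) - G (a, b) - D1 G (a, b) * (u - a) - D2 G (a, b) * (v - b))%C
      <= eps * (Cmod (u - a)%C + Cmod (v - b)%C).
Proof.
intros H Hz eps Heps.
assert (Hz' := proj1 (inD2_pair a b) Hz). destruct Hz' as [Ha1 Hb1].
destruct (analytic_locally_bounded G a b H Hz) as [r [M [Hr [Ha [Hb HM]]]]].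
set (K := 8 * M / (r * r)). set (B := Rabs K + 1).
assert (HB : 0 < B) by (unfold B; generalize (Rabs_pos K); lra).
assert (He2 : 0 < eps / 2) by lra.
destruct (proj1 (continuous_C2C_eps _ _) (D1_continuous G (a, b) H Hz) (eps / 2) He2) as [d1 [Hd1 K1]].
assert (HD2 : cderiv (fun w => G (a, w)) b (D2 G (a, b))).
{ apply (hol_on_C_derive (fun w => G (a, w)) b r).
  - apply hol_disc_on; auto. now apply analytic_slice2.
  - rewrite Cminus_diag, Cmod_0; lra. }
destruct (HD2 eps Heps) as [d2 [Hd2 K2]].
assert (Hx : 0 < eps / 2 / B) by (now apply Rdiv_lt_0_compat).
set (d := Rmin (Rmin d1 d2) (Rmin (r / 4) (eps / 2 / B))).
assert (D1' : d <= d1) by (eapply Rle_trans; [apply Rmin_l|apply Rmin_l]).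
assert (D2' : d <= d2) by (eapply Rle_trans; [apply Rmin_l|apply Rmin_r]).
assert (D3' : d <= r / 4) by (eapply Rle_trans; [apply Rmin_r|apply Rmin_l]).
assert (D4' : d <= eps / 2 / B) by (eapply Rle_trans; [apply Rmin_r|apply Rmin_r]).
exists d. split. { unfold d. apply Rmin_glb_lt; apply Rmin_glb_lt; auto; lra. }
intros u v Hu Hv.
replace (G (u, v) - G (a, b) - D1 G (a, b) * (u - a) - D2 G (a, b) * (v - b))%C with
  ((G (u, v) - G (a, v) - D1 G (a, v) * (u - a)) + (D1 G (a, v) - D1 G (a, b)) * (u - a)
   + (G (a, v) - G (a, b) - D2 G (a, b) * (v - b)))%C by ring.
assert (Hv1 : Cmod v < 1).
{ replace v with ((v - b) + b)%C by ring. eapply Rle_lt_trans; [apply Cmod_triangle|]. lra. }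
assert (P1 : Cmod (G (u, v) - G (a, v) - D1 G (a, v) * (u - a))%C <= eps / 2 * Cmod (u - a)%C).
{ replace u with (a + (u - a))%C at 1 by ring.
  eapply Rle_trans.
  - apply (quadratic_remainder (fun w => G (w, v)) a (u - a)%C r M); auto; try lra.
    + apply hol_disc_on; auto. now apply analytic_slice1.
    + intros w Hw. apply HM; lra.
  - fold K. rewrite <- Rmult_assoc. apply Rmult_le_compat_r; [apply Cmod_ge_0|].
    apply Rle_trans with (B * (eps / 2 / B)); [|right; field; lra].
    apply Rle_trans with (B * Cmod (u - a)%C).
    + apply Rmult_le_compat_r; [apply Cmod_ge_0|]. unfold B. generalize (Rle_abs K); lra.
    + apply Rmult_le_compat_l; lra. }
assert (P2 : Cmod ((D1 G (a, v) - D1 G (a, b)) * (u - a))%C <= eps / 2 * Cmod (u - a)%C).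
{ rewrite Cmod_mult. apply Rmult_le_compat_r; [apply Cmod_ge_0|]. left. apply (K1 (a, v)); simpl.
  - now rewrite Cminus_diag, Cmod_0.
  - lra. }
assert (P3 := K2 v ltac:(lra)).
eapply Rle_trans; [apply Cmod_triangle|].
eapply Rle_trans; [apply Rplus_le_compat_r, Cmod_triangle|]. lra.
Qed.

Lemma rderiv_segment (G : C * C -> C) (a b a' b' : C) (t : R) : analytic_D2 G ->
  inD2 (seg a a' t, seg b b' t) ->
  rderiv (fun u => G (seg a a' u, seg b b' u)) t
    (D1 G (seg a a' t, seg b b' t) * (a' - a) + D2 G (seg a a' t, seg b b' t) * (b' - b))%C.
Proof.
intros H Hz. apply rderiv_eps. intros eps Heps.
set (B := Cmod (a' - a)%C + Cmod (b' - b)%C + 1).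
assert (HB : 0 < B) by (unfold B; generalize (Cmod_ge_0 (a' - a)%C) (Cmod_ge_0 (b' - b)%C); lra).
destruct (frechet G _ _ H Hz (eps / B)) as [d [Hd K]]; [now apply Rdiv_lt_0_compat|].
exists (d / B). split; [now apply Rdiv_lt_0_compat|]. intros u Hu.
assert (E1 : (seg a a' u - seg a a' t)%C = (RtoC (u - t) * (a' - a))%C) by (unfold seg; rewrite RtoC_minus; ring).
assert (E2 : (seg b b' u - seg b b' t)%C = (RtoC (u - t) * (b' - b))%C) by (unfold seg; rewrite RtoC_minus; ring).
specialize (K (seg a a' u) (seg b b' u)). rewrite E1, E2 in K. rewrite !Cmod_mult, !Cmod_R in K.
assert (Hut : Rabs (u - t) * B < d).
{ apply Rmult_lt_compat_r with (r := B) in Hu; auto. replace (d / B * B) with d in Hu by (field; lra). exact Hu. }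
assert (Q := Rabs_pos (u - t)).
assert (Q1 := Cmod_ge_0 (a' - a)%C). assert (Q2 := Cmod_ge_0 (b' - b)%C).
assert (R1 : Rabs (u - t) * Cmod (a' - a)%C <= Rabs (u - t) * B) by (apply Rmult_le_compat_l; auto; unfold B; lra).
assert (R2 : Rabs (u - t) * Cmod (b' - b)%C <= Rabs (u - t) * B) by (apply Rmult_le_compat_l; auto; unfold B; lra).
specialize (K ltac:(lra) ltac:(lra)).
match type of K with Cmod ?X <= _ => replace (G (seg a a' u, seg b b' u) - G (seg a a' t, seg b b' t) -
  (D1 G (seg a a' t, seg b b' t) * (a' - a) + D2 G (seg a a' t, seg b b' t) * (b' - b)) * RtoC (u - t))%C with X by ring end.
eapply Rle_trans; [exact K|].
apply Rle_trans with (eps / B * (Rabs (u - t) * B)); [|right; field; lra].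
apply Rmult_le_compat_l; [left; now apply Rdiv_lt_0_compat|].
unfold B. nra.
Qed.

(** * Bounded index implies main polynomials *)

Lemma maxupto_ge (f : nat -> R) (n j : nat) : (j <= n)%nat -> f j <= maxupto f n.
Proof.
induction n; intros Hj; simpl.
- replace j with 0%nat by lia. lra.
- destruct (Nat.eq_dec j (S n)) as [->|Hn]; [apply Rmax_r|].
  eapply Rle_trans; [apply IHn; lia|apply Rmax_l].
Qed.

Lemma maxupto_attained (f : nat -> R) (n : nat) : exists j, (j <= n)%nat /\ maxupto f n = f j.
Proof.
induction n; simpl; [exists 0%nat; auto|].
destruct IHn as [j [Hj E]]. unfold Rmax. destruct (Rle_dec (maxupto f n) (f (S n))).
- exists (S n); auto.
- exists j; auto.
Qed.

Lemma maxupto_scal (f g : nat -> R) (c : R) (n : nat) : 0 <= c ->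
  (forall j, (j <= n)%nat -> g j = c * f j) -> maxupto g n = c * maxupto f n.
Proof.
intros Hc. induction n; intros H; simpl; [apply H; auto|].
rewrite IHn by (intros; apply H; lia). rewrite (H (S n)) by lia. now rewrite RmaxRmult.
Qed.

Lemma argmax (f : nat -> R) (n : nat) : exists j, (j <= n)%nat /\ forall k, (k <= n)%nat -> f k <= f j.
Proof.
destruct (maxupto_attained f n) as [j [Hj E]]. exists j; split; auto.
intros k Hk. rewrite <- E. now apply maxupto_ge.
Qed.

(* The central index (position of the maximal term of [A k * x ^ k]) can only drop when [x] shrinks, hence it is unchanged at some step. *)
Lemma stable_central_index (A : nat -> R) (rho : R) : (forall k, 0 <= A k) -> 0 < rho < 1 ->
  forall n x nu, 0 < x -> (nu <= n)%nat -> (forall k, A k * x ^ k <= A nu * x ^ nu) ->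
  exists m k0, (m <= n)%nat /\ (k0 <= n)%nat /\ forall k,
    A k * (x * rho ^ (2 * m)) ^ k <= A k0 * (x * rho ^ (2 * m)) ^ k0 /\
    A k * (x * rho ^ (2 * m + 2)) ^ k <= A k0 * (x * rho ^ (2 * m + 2)) ^ k0.
Proof.
intros HA Hrho n. induction n as [n IH] using (well_founded_induction lt_wf).
intros x nu Hx Hnu Hmax.
(* One round covers two steps of the scale, which leaves a middle radius between [x] and [x * t]. If
   the index is the same at both ends the search stops; otherwise it has dropped, which happens at
   most [n] times. *)
set (t := rho ^ 2). assert (Ht : 0 < t < 1) by (unfold t; simpl; nra).
destruct (argmax (fun k => A k * (x * t) ^ k) nu) as [nu' [Hnu' Hmax']].
assert (HG : forall k, A k * (x * t) ^ k <= A nu' * (x * t) ^ nu').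
{ intros k. destruct (le_lt_dec k nu) as [Hk|Hk]; [now apply Hmax'|].
  eapply Rle_trans; [|apply (Hmax' nu); lia].
  rewrite !Rpow_mult_distr. rewrite <- !Rmult_assoc.
  apply Rmult_le_compat; auto.
  - apply Rmult_le_pos; auto. left; now apply pow_lt.
  - left; now apply pow_lt.
  - replace k with (nu + (k - nu))%nat by lia. rewrite pow_add.
    assert (0 < t ^ nu) by now apply pow_lt.
    assert (t ^ (k - nu) <= 1 ^ (k - nu)) by (apply pow_incr; lra). rewrite pow1 in H0. nra. }
destruct (Nat.eq_dec nu' nu) as [->|Hne].
- exists 0%nat, nu. split; [lia|split; [auto|]]. intros k. simpl (2 * 0)%nat. simpl (0 + 2)%nat.
  simpl (rho ^ 0). rewrite Rmult_1_r. fold t. auto.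
- destruct (IH nu') with (x := x * t) (nu := nu') as [m [k0 [Hm [Hk0 H]]]]; auto; [lia|apply Rmult_lt_0_compat; lra|].
  exists (S m), k0. split; [lia|split; [lia|]]. intros k. specialize (H k).
  replace (x * rho ^ (2 * S m)) with (x * t * rho ^ (2 * m)).
  + replace (x * rho ^ (2 * S m + 2)) with (x * t * rho ^ (2 * m + 2)); auto.
    unfold t. rewrite Rmult_assoc, <- pow_add. do 2 f_equal. lia.
  + unfold t. rewrite Rmult_assoc, <- pow_add. do 2 f_equal. lia.
Qed.

Lemma succ_le_pow2 (k : nat) : INR (S k) * (/ 2) ^ k <= 1.
Proof.
induction k; [simpl; lra|]. rewrite S_INR. simpl pow.
assert (0 < (/ 2) ^ k) by (apply pow_lt; lra).
rewrite S_INR in *. generalize (pos_INR k). intros. nra.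
Qed.

(** Comparison at [r * rho] for [k < k0] and at [r / rho] for [k > k0] gains [rho] to the power of
    the distance between [k] and [k0]. The exponent [N + 2] makes [N + 2] times this distance at
    least [k + 1]. The gain is thus [(/ 4) ^ (k + 1)], in which one factor [(/ 2) ^ k] absorbs
    [INR (S k)], the number of monomials of degree [k]. *)
Lemma dominant_term (A : nat -> R) (r : R) (N k0 : nat) : (forall k, 0 <= A k) -> 0 < r -> (k0 <= N)%nat ->
  let rho := (/ 4) ^ (N + 2) in
  (forall k, A k * (r / rho) ^ k <= A k0 * (r / rho) ^ k0) ->
  (forall k, A k * (r * rho) ^ k <= A k0 * (r * rho) ^ k0) ->
  forall k, k <> k0 -> INR (S k) * (A k * r ^ k) <= A k0 * r ^ k0 * (/ 4 * (/ 2) ^ k).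
Proof.
intros HA Hr HN rho H1 H2 k Hk.
assert (Hrho : 0 < rho) by (apply pow_lt; lra).
assert (D : exists e, (k + 1 <= (N + 2) * e)%nat /\ A k * r ^ k <= A k0 * r ^ k0 * rho ^ e).
{ destruct (le_lt_dec k k0) as [Hkk|Hkk].
  - exists (k0 - k)%nat. split; [nia|]. specialize (H2 k).
    rewrite !Rpow_mult_distr in H2. replace k0 with (k + (k0 - k))%nat in H2 at 3 by lia.
    rewrite (pow_add rho) in H2.
    apply Rmult_le_reg_r with (rho ^ k); [now apply pow_lt|]. lra.
  - exists (k - k0)%nat. split; [nia|]. specialize (H1 k). unfold Rdiv in H1.
    rewrite !Rpow_mult_distr in H1. replace k with (k0 + (k - k0))%nat in H1 at 3 by lia.
    rewrite (pow_add (/ rho)) in H1.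
    assert (P0 : 0 < (/ rho) ^ k0) by (apply pow_lt; now apply Rinv_0_lt_compat).
    assert (E : (/ rho) ^ (k - k0) * rho ^ (k - k0) = 1).
    { rewrite <- Rpow_mult_distr, Rinv_l by lra. apply pow1. }
    assert (P1 : 0 < rho ^ (k - k0)) by (now apply pow_lt).
    apply Rmult_le_reg_r with ((/ rho) ^ k0); auto.
    apply Rle_trans with (A k * (r ^ k * ((/ rho) ^ k0 * (/ rho) ^ (k - k0))) * rho ^ (k - k0)).
    + right. transitivity (A k * r ^ k * (/ rho) ^ k0 * ((/ rho) ^ (k - k0) * rho ^ (k - k0))); [rewrite E; ring|ring].
    + apply Rle_trans with (A k0 * (r ^ k0 * (/ rho) ^ k0) * rho ^ (k - k0)); [apply Rmult_le_compat_r; lra|right; ring]. }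
destruct D as [e [He HD]].
assert (R1 : rho ^ e <= (/ 4) ^ (k + 1)).
{ unfold rho. rewrite <- pow_mult. replace ((N + 2) * e)%nat with ((k + 1) + ((N + 2) * e - (k + 1)))%nat by lia.
  rewrite pow_add. assert (0 < (/ 4) ^ (k + 1)) by (apply pow_lt; lra).
  assert ((/ 4) ^ ((N + 2) * e - (k + 1)) <= 1 ^ ((N + 2) * e - (k + 1))) by (apply pow_incr; lra).
  rewrite pow1 in H0. nra. }
assert (P : 0 <= A k0 * r ^ k0) by (apply Rmult_le_pos; auto; left; now apply pow_lt).
apply Rle_trans with (INR (S k) * (A k0 * r ^ k0 * (/ 4) ^ (k + 1))).
- apply Rmult_le_compat_l; [apply pos_INR|]. eapply Rle_trans; [exact HD|]. now apply Rmult_le_compat_l.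
- rewrite pow_add, pow_1. replace (/ 4) with (/ 2 * / 2) at 1 by field. rewrite Rpow_mult_distr.
  replace (INR (S k) * (A k0 * r ^ k0 * ((/ 2) ^ k * (/ 2) ^ k * / 4))) with
   (A k0 * r ^ k0 * (/ 4 * (/ 2) ^ k) * (INR (S k) * (/ 2) ^ k)) by ring.
  rewrite <- (Rmult_1_r (A k0 * r ^ k0 * (/ 4 * (/ 2) ^ k))) at 2.
  apply Rmult_le_compat_l; [|apply succ_le_pow2].
  apply Rmult_le_pos; auto. assert (0 < (/ 2) ^ k) by (apply pow_lt; lra). lra.
Qed.

(** * Complex series with a geometric majorant *)

Lemma is_series_C_eps (a : nat -> C) (l : C) :
  is_series (K := C_AbsRing) (V := C_NormedModule) a l <->
  (forall eps, 0 < eps -> exists N, forall n, (N <= n)%nat ->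
     Cmod (sum_n (G := C_AbelianMonoid) a n - l)%C < eps).
Proof.
split.
- intros H eps Heps.
  destruct (proj1 (filterlim_locally (F := eventually) (U := C_UniformSpace) _ l) H (mkposreal (eps / 2) ltac:(lra))) as [N HN].
  exists N. intros n Hn. specialize (HN n Hn). apply ball_C_Cmod in HN. simpl in HN. 
  eapply Rlt_le_trans; [exact HN|lra].
- intros H. apply (proj2 (filterlim_locally (F := eventually) (U := C_UniformSpace) _ l)). intros eps.
  destruct (H eps (cond_pos eps)) as [N HN]. exists N. intros n Hn.
  apply C_NormedModule_mixin_compat1. now apply HN.
Qed.

Lemma C_sum_Sn (a : nat -> C) (n : nat) :
  sum_n (G := C_AbelianMonoid) a (S n) = (sum_n (G := C_AbelianMonoid) a n + a (S n))%C.
Proof. apply (sum_Sn (G := C_AbelianMonoid)). Qed.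

(** The term [q ^ S m] is kept in the bound because the induction on [m] closes only with the exact
    geometric sum. *)
Lemma geometric_tail (a : nat -> C) (K q : R) (n m : nat) : 0 <= K -> 0 <= q < 1 ->
  (forall k, Cmod (a k) <= K * q ^ k) -> (n <= m)%nat ->
  Cmod (sum_n (G := C_AbelianMonoid) a m - sum_n (G := C_AbelianMonoid) a n)%C <= K * (q ^ S n - q ^ S m) / (1 - q).
Proof.
intros HK Hq Ha Hnm. induction Hnm as [|m Hnm IH].
- rewrite Cminus_diag, Cmod_0. right. field. lra.
- rewrite C_sum_Sn.
  replace (sum_n (G := C_AbelianMonoid) a m + a (S m) - sum_n (G := C_AbelianMonoid) a n)%C
    with ((sum_n (G := C_AbelianMonoid) a m - sum_n (G := C_AbelianMonoid) a n) + a (S m))%C by ring.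
  eapply Rle_trans; [apply Cmod_triangle|].
  eapply Rle_trans; [apply Rplus_le_compat; [apply IH|apply Ha]|]. right. simpl. field. lra.
Qed.

Lemma geometric_series_bound (a : nat -> C) (l : C) (K q : R) (n : nat) : 0 <= K -> 0 <= q < 1 ->
  (forall k, Cmod (a k) <= K * q ^ k) -> is_series (K := C_AbsRing) (V := C_NormedModule) a l ->
  Cmod (l - sum_n (G := C_AbelianMonoid) a n)%C <= K * q ^ S n / (1 - q).
Proof.
intros HK Hq Ha Hl. apply le_epsilon. intros eps Heps.
destruct (proj1 (is_series_C_eps a l) Hl eps Heps) as [N HN].
set (m := Nat.max n N). specialize (HN m (Nat.le_max_r _ _)).
assert (T := geometric_tail a K q n m HK Hq Ha (Nat.le_max_l _ _)).
set (Sm := sum_n (G := C_AbelianMonoid) a m) in *. set (Sn := sum_n (G := C_AbelianMonoid) a n) in *.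
replace (l - Sn)%C with ((Sm - Sn) + - (Sm - l))%C by ring.
eapply Rle_trans; [apply Cmod_triangle|]. rewrite Cmod_opp.
assert (K * (q ^ S n - q ^ S m) / (1 - q) <= K * q ^ S n / (1 - q)).
{ unfold Rdiv. apply Rmult_le_compat_r; [left; apply Rinv_0_lt_compat; lra|].
  apply Rmult_le_compat_l; auto. assert (0 <= q ^ S m) by (apply pow_le; lra). lra. }
lra.
Qed.

Lemma geometric_ex_series (a : nat -> C) (K q : R) : 0 <= K -> 0 <= q < 1 ->
  (forall k, Cmod (a k) <= K * q ^ k) -> exists l, is_series (K := C_AbsRing) (V := C_NormedModule) a l.
Proof.
intros HK Hq Ha. 
apply (ex_series_le (K := C_AbsRing) (V := C_CompleteNormedModule) a (fun k => K * q ^ k)).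
- exact Ha.
- apply (ex_series_scal (K := R_AbsRing) (V := R_NormedModule) K). apply ex_series_geom.
  rewrite Rabs_pos_eq; lra.
Qed.

(** * Largest normalised coefficients by degree *)

Lemma Lterm_pos (F : C * C -> C) (l1 l2 : C * C -> R) (z : C * C) (i j : nat) :
  0 < l1 z -> 0 < l2 z -> 0 <= Lterm F l1 l2 z i j.
Proof.
intros H1 H2. unfold Lterm. apply Rmult_le_pos; [apply Cmod_ge_0|].
left. apply Rinv_0_lt_compat. repeat apply Rmult_lt_0_compat; try apply INR_fact_lt_0; now apply pow_lt.
Qed.

Lemma Cmod_bcoef (F : C * C -> C) (z : C * C) (i j : nat) :
  Cmod (bcoef F z i j) = Cmod (Dpq F i j z) / (INR (fact i) * INR (fact j)).
Proof.
unfold bcoef. assert (0 < INR (fact i) * INR (fact j)) by (apply Rmult_lt_0_compat; apply INR_fact_lt_0).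
rewrite Cmod_div, Cmod_R, Rabs_pos_eq; auto; try lra.
intros E. apply RtoC_inj in E. lra.
Qed.

(** The radii absorb the weights of [Lterm], and only the total degree of the monomial remains
    visible. *)
Lemma bcoef_Lterm (F : C * C -> C) (l1 l2 : C * C -> R) (z : C * C) (r : R) (i j : nat) :
  0 < l1 z -> 0 < l2 z ->
  Cmod (bcoef F z i j) * (r / l1 z) ^ i * (r / l2 z) ^ j = Lterm F l1 l2 z i j * r ^ (i + j).
Proof.
intros H1 H2. rewrite Cmod_bcoef. unfold Lterm, Rdiv. rewrite !Rpow_mult_distr, pow_add.
rewrite !pow_inv. field. repeat split; try apply pow_nonzero; try lra; apply INR_fact_neq_0.
Qed.

Lemma pk_aux_bound (F : C * C -> C) (z0 w : C * C) (k : nat) (B : R) (j : nat) : (j <= k)%nat ->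
  (forall i, (i <= k)%nat -> Cmod (bcoef F z0 i (k - i)) * Cmod (fst w) ^ i * Cmod (snd w) ^ (k - i) <= B) ->
  Cmod (pk_aux F z0 k w j) <= INR (S j) * B.
Proof.
intros Hj HB. induction j.
- simpl pk_aux. rewrite Cmod_mult, Cmod_pow. specialize (HB 0%nat ltac:(lia)).
  rewrite Nat.sub_0_r in HB. simpl in *. lra.
- simpl pk_aux. eapply Rle_trans; [apply Cmod_triangle|]. rewrite S_INR.
  rewrite Rmult_plus_distr_r, Rmult_1_l. apply Rplus_le_compat; [apply IHj; lia|].
  rewrite !Cmod_mult, !Cmod_pow. apply HB; lia.
Qed.

Definition level_max (F : C * C -> C) (l1 l2 : C * C -> R) (z : C * C) (k : nat) : R :=
  maxupto (fun j => Lterm F l1 l2 z j (k - j)) k.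

Lemma level_max_scaled (F : C * C -> C) (l1 l2 : C * C -> R) (z : C * C) (r : R) (k : nat) :
  0 < l1 z -> 0 < l2 z -> 0 <= r ->
  maxupto (fun j => Cmod (bcoef F z j (k - j)) * (r / l1 z) ^ j * (r / l2 z) ^ (k - j)) k
  = level_max F l1 l2 z k * r ^ k.
Proof.
intros H1 H2 Hr. unfold level_max. rewrite Rmult_comm. apply maxupto_scal.
- now apply pow_le.
- intros j Hj. rewrite bcoef_Lterm by auto. replace (j + (k - j))%nat with k by lia. ring.
Qed.

Lemma level_max_pos (F : C * C -> C) (l1 l2 : C * C -> R) (z : C * C) (k : nat) :
  0 < l1 z -> 0 < l2 z -> 0 <= level_max F l1 l2 z k.
Proof.
intros H1 H2. eapply Rle_trans; [|apply (maxupto_ge _ k 0); lia]. now apply Lterm_pos.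
Qed.

Lemma pk_bound (F : C * C -> C) (l1 l2 : C * C -> R) (z0 z : C * C) (r : R) (k : nat) :
  0 < l1 z0 -> 0 < l2 z0 -> 0 <= r -> in_torus z0 (r / l1 z0) (r / l2 z0) z ->
  Cmod (pk F z0 k ((fst z - fst z0)%C, (snd z - snd z0)%C)) <= INR (S k) * (level_max F l1 l2 z0 k * r ^ k).
Proof.
intros H1 H2 Hr [T1 T2]. apply pk_aux_bound; auto. intros i Hi. simpl. rewrite T1, T2.
rewrite <- level_max_scaled by auto.
apply (maxupto_ge (fun j => Cmod (bcoef F z0 j (k - j)) * (r / l1 z0) ^ j * (r / l2 z0) ^ (k - j))); auto.
Qed.

Lemma bounded_index_main_polynomial (F : C * C -> C) (l1 l2 : C * C -> R) :
  (forall z, inD2 z -> 0 < l1 z /\ 0 < l2 z) -> bounded_L_index F l1 l2 ->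
  exists p : nat, forall d : R, 0 < d ->
     exists eta : R, 0 < eta < d /\
       forall z0 : C * C, inD2 z0 ->
         exists r : R, eta < r < d /\
           exists k0 : nat, (k0 <= p)%nat /\
             main_polynomial F z0 (r / l1 z0) (r / l2 z0) k0.
Proof.
intros Hl [N HN]. exists N. intros d Hd.
set (rho := (/ 4) ^ (N + 2)). assert (Hrho : 0 < rho < 1).
{ split; [apply pow_lt; lra|]. unfold rho. apply pow_lt_1_compat; [lra|lia]. }
set (x := Rmin d 1). assert (Hx : 0 < x) by (apply Rmin_glb_lt; lra).
assert (Hx1 : x <= 1) by apply Rmin_r. assert (Hxd : x <= d) by apply Rmin_l.
assert (Hle1 : forall n, rho ^ n <= 1).
{ intros n. rewrite <- (pow1 n). apply pow_incr; lra. }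
assert (Hpos : forall n, 0 < rho ^ n) by (intros n; apply pow_lt; lra).
(* The step [m] found below is at most [N] at every base point, so the radius
   [x * rho ^ (2 * m + 1)] always stays above this value. *)
exists (x * rho ^ (2 * N + 2)). split.
{ split; [apply Rmult_lt_0_compat; auto|]. replace (2 * N + 2)%nat with (S (2 * N + 1)) by lia. rewrite <- tech_pow_Rmult.
  generalize (Hle1 (2 * N + 1)%nat) (Hpos (2 * N + 1)%nat). intros.
  set (u := rho ^ (2 * N + 1)) in *. assert (rho * u < 1) by nra.
  assert (x * (rho * u) < x * 1) by (apply Rmult_lt_compat_l; auto). lra. }
intros z0 Hz0. destruct (Hl z0 Hz0) as [L1 L2].
set (A := level_max F l1 l2 z0).
assert (HA : forall k, 0 <= A k) by (intros; now apply level_max_pos).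
assert (HAN : forall k, exists m, (m <= N)%nat /\ A k <= A m).
{ intros k. destruct (maxupto_attained (fun j => Lterm F l1 l2 z0 j (k - j)) k) as [j [Hj E]].
  destruct (HN z0 Hz0 j (k - j)%nat) as [k1 [k2 [Hk Hle]]]. exists (k1 + k2)%nat. split; auto.
  unfold A at 1, level_max. rewrite E. eapply Rle_trans; [exact Hle|].
  replace k2 with (k1 + k2 - k1)%nat at 1 by lia.
  apply (maxupto_ge (fun j => Lterm F l1 l2 z0 j (k1 + k2 - j))). lia. }
destruct (argmax (fun k => A k * x ^ k) N) as [nu [Hnu Hmax]].
destruct (argmax A N) as [mu [Hmu Hmaxmu]].
destruct (stable_central_index A rho HA Hrho N x nu Hx Hnu) as [m [k0 [Hm [Hk0 Hst]]]].
(* Beyond [N], bounded index gives [A k <= A mu], and [x <= 1] gives [x ^ k <= x ^ mu]; hence the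
   maximum over degrees up to [N] is global. *)
{ intros k. destruct (le_lt_dec k N) as [Hk|Hk]; [now apply Hmax|].
  eapply Rle_trans; [|apply (Hmax mu Hmu)].
  destruct (HAN k) as [m [Hm Hle]].
  apply Rmult_le_compat; auto; [left; now apply pow_lt|eapply Rle_trans; eauto|].
  replace k with (mu + (k - mu))%nat by lia. rewrite pow_add.
  assert (0 < x ^ mu) by now apply pow_lt.
  assert (x ^ (k - mu) <= 1 ^ (k - mu)) by (apply pow_incr; lra). rewrite pow1 in H0. nra. }
(* The middle of the two steps: [r / rho] and [r * rho] are the two radii at which [k0] is known to
   be central. *)
set (r := x * rho ^ (2 * m + 1)).
assert (Hr : 0 < r) by (apply Rmult_lt_0_compat; auto).
exists r. split.
{ split.
  - unfold r. apply Rmult_lt_compat_l; auto.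
    replace (2 * N + 2)%nat with (S (2 * m + 1 + (2 * N - 2 * m)))%nat by lia. rewrite <- tech_pow_Rmult. rewrite pow_add.
    generalize (Hle1 (2 * N - 2 * m)%nat) (Hpos (2 * N - 2 * m)%nat) (Hpos (2 * m + 1)%nat). intros.
    set (u := rho ^ (2 * N - 2 * m)) in *. set (v := rho ^ (2 * m + 1)) in *.
    assert (rho * u < 1) by nra. nra.
  - unfold r. replace (2 * m + 1)%nat with (S (2 * m)) by lia. rewrite <- tech_pow_Rmult.
    generalize (Hle1 (2 * m)%nat) (Hpos (2 * m)%nat). intros.
    set (u := rho ^ (2 * m)) in *.
    assert (rho * u < 1) by nra.
    assert (x * (rho * u) < x * 1) by (apply Rmult_lt_compat_l; auto). lra. }
exists k0. split; auto.
assert (Hdom := dominant_term A r N k0 HA Hr Hk0). cbv zeta in Hdom. fold rho in Hdom.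
assert (E1 : r / rho = x * rho ^ (2 * m)).
{ unfold r. rewrite pow_add. field. lra. }
assert (E2 : r * rho = x * rho ^ (2 * m + 2)).
{ unfold r. rewrite !pow_add. ring. }
rewrite E1, E2 in Hdom.
specialize (Hdom (fun k => proj1 (Hst k)) (fun k => proj2 (Hst k))).
set (B := A k0 * r ^ k0) in *.
assert (HB : 0 <= B) by (apply Rmult_le_pos; auto; left; now apply pow_lt).
intros z Hz. rewrite level_max_scaled by (auto; lra). fold A. fold B.
set (a := fun k => if Nat.eqb k k0 then RtoC 0 else pk F z0 k ((fst z - fst z0)%C, (snd z - snd z0)%C)).
assert (Ha : forall k, Cmod (a k) <= B / 4 * (/ 2) ^ k).
{ intros k. unfold a. destruct (Nat.eqb_spec k k0) as [->|Hk].
  - rewrite Cmod_0. assert (0 < (/ 2) ^ k0) by (apply pow_lt; lra). nra.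
  - eapply Rle_trans; [apply (pk_bound F l1 l2 z0 z r); auto; lra|]. fold A.
    eapply Rle_trans; [apply Hdom; auto|]. right; field. }
assert (HB4 : 0 <= B / 4) by lra. assert (H2 : 0 <= / 2 < 1) by lra.
destruct (geometric_ex_series a (B / 4) (/ 2) HB4 H2 Ha) as [S HS].
exists S. split; [exact HS|].
(* The tail from degree 1 on contributes at most [B / 4] and the term of degree 0 at most another
   [B / 4], together the required half of [B]. *)
assert (T := geometric_series_bound a S (B / 4) (/ 2) 0 HB4 H2 Ha HS).
rewrite sum_O in T. specialize (Ha 0%nat). simpl in T, Ha.
replace S with ((S - a 0%nat) + a 0%nat)%C by ring.
eapply Rle_trans; [apply Cmod_triangle|]. lra.
Qed.

(** * Coefficient extraction on a torus *)

(** Means over [n + 1] points stand in for integrals over circles: for polynomials of degree at most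
    [n] in each variable the orthogonality relations are exact, and only finite sums occur. *)
Definition avg (n : nat) (phi : nat -> C) : C :=
  (RtoC (/ INR (S n)) * sum_n (G := C_AbelianMonoid) phi n)%C.

Lemma avg_ext (n : nat) (phi psi : nat -> C) : (forall u, phi u = psi u) -> avg n phi = avg n psi.
Proof. intros H. unfold avg. f_equal. apply sum_n_ext. exact H. Qed.

Lemma avg_plus (n : nat) (phi psi : nat -> C) : avg n (fun u => phi u + psi u)%C = (avg n phi + avg n psi)%C.
Proof.
unfold avg. rewrite <- Cmult_plus_distr_l. f_equal.
apply (sum_n_plus (G := C_AbelianMonoid) phi psi n).
Qed.

Lemma avg_scal (n : nat) (c : C) (phi : nat -> C) : avg n (fun u => c * phi u)%C = (c * avg n phi)%C.
Proof.
unfold avg. replace (sum_n (G := C_AbelianMonoid) (fun u => (c * phi u)%C) n) with (c * sum_n (G := C_AbelianMonoid) phi n)%C; [ring|].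
induction n; [now rewrite !sum_O|]. rewrite !C_sum_Sn, <- IHn. ring.
Qed.

Lemma avg_bound (n : nat) (phi : nat -> C) (M : R) : (forall u, Cmod (phi u) <= M) -> Cmod (avg n phi) <= M.
Proof.
intros H. unfold avg. assert (Hn : 0 < INR (S n)) by (apply lt_0_INR; lia).
rewrite Cmod_mult, Cmod_R, Rabs_pos_eq by (left; now apply Rinv_0_lt_compat).
apply Rmult_le_reg_l with (INR (S n)); auto. rewrite <- Rmult_assoc, Rinv_r, Rmult_1_l by lra.
clear Hn. induction n.
- rewrite sum_O. simpl. rewrite Rmult_1_l. apply H.
- rewrite C_sum_Sn, S_INR. eapply Rle_trans; [apply Cmod_triangle|]. specialize (H (S n)). lra.
Qed.

Lemma Cpow_eit (t : R) (k : nat) : Cpow (eit t) k = eit (INR k * t).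
Proof.
induction k; [simpl; now rewrite Rmult_0_l, eit_0|].
rewrite Cpow_S, IHk, <- eit_add, S_INR. f_equal. ring.
Qed.

Lemma eit_eq_1 (x : R) : - PI < x < PI -> x <> 0 -> eit (2 * x) <> RtoC 1.
Proof.
intros Hx H0 E. assert (E1 : cos (2 * x) = 1) by (apply (f_equal fst) in E; exact E).
rewrite cos_2a_sin in E1. assert (E2 : sin x * sin x = 0) by lra.
destruct (Rlt_le_dec 0 x) as [Hp|Hp].
- assert (0 < sin x) by (apply sin_gt_0; lra). nra.
- assert (0 < sin (- x)) by (apply sin_gt_0; lra). rewrite sin_neg in H. nra.
Qed.

Lemma C_geometric_sum (q : C) (n : nat) :
  ((q - RtoC 1) * sum_n (G := C_AbelianMonoid) (fun u => Cpow q u) n)%C = (Cpow q (S n) - RtoC 1)%C.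
Proof.
induction n.
- rewrite sum_O, Cpow_1_r. change (Cpow q 0) with (RtoC 1). ring.
- rewrite C_sum_Sn, Cmult_plus_distr_l, IHn, (Cpow_S q (S n)). ring.
Qed.

Definition root_angle (n u : nat) : R := 2 * PI / INR (S n) * INR u.

Lemma avg_orthogonal (n i j : nat) : (i <= n)%nat -> (j <= n)%nat ->
  avg n (fun u => Cpow (eit (root_angle n u)) i * eit (- (INR j * root_angle n u)))%C
  = if Nat.eqb i j then RtoC 1 else RtoC 0.
Proof.
intros Hi Hj. assert (Hn : 0 < INR (S n)) by (apply lt_0_INR; lia).
assert (HP := PI_RGT_0).
(* Half of the angle between consecutive terms. It lies strictly between [- PI] and [PI] because [i]
   and [j] differ by less than [n + 1], so for [i <> j] the ratio [q] is not 1. *)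
set (x := PI / INR (S n) * (INR i - INR j)). set (q := eit (2 * x)).
rewrite (avg_ext n _ (fun u => Cpow q u)).
2: { intros u. rewrite Cpow_eit, <- eit_add. unfold q. rewrite Cpow_eit. f_equal.
  unfold root_angle, x. field. lra. }
unfold avg. destruct (Nat.eqb_spec i j) as [->|Hij].
- assert (Hq : q = RtoC 1) by (unfold q, x; rewrite Rminus_diag, !Rmult_0_r; apply eit_0).
  rewrite Hq. replace (sum_n (G := C_AbelianMonoid) (fun u => Cpow (RtoC 1) u) n) with (RtoC (INR (S n))).
  + rewrite <- RtoC_mult, Rinv_l; auto; lra.
  + clear. induction n; [now rewrite sum_O|]. rewrite C_sum_Sn, <- IHn, Cpow_1_l, <- RtoC_plus, <- S_INR. reflexivity.
- assert (Hq : q <> RtoC 1).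
  { apply eit_eq_1.
    - assert (B : Rabs (INR i - INR j) < INR (S n)).
      { apply le_INR in Hi, Hj. rewrite S_INR. generalize (pos_INR i) (pos_INR j). intros. apply Rabs_def1; lra. }
      apply Rabs_def2 in B. unfold x.
      assert (E : PI = PI / INR (S n) * INR (S n)) by (field; lra).
      assert (K : 0 < PI / INR (S n)) by (now apply Rdiv_lt_0_compat).
      split; [rewrite E at 1|rewrite E at 2]; nra.
    - unfold x. apply Rmult_integral_contrapositive. split.
      + apply Rgt_not_eq. now apply Rdiv_lt_0_compat.
      + intros E. apply Hij, INR_eq. lra. }
  assert (Hqn : Cpow q (S n) = RtoC 1).
  { unfold q. rewrite Cpow_eit. unfold x.
    replace (INR (S n) * (2 * (PI / INR (S n) * (INR i - INR j)))) with (INR i * (2 * PI) + - (INR j * (2 * PI))) by (field; lra).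
    rewrite eit_add, eit_2npi, Cmult_1_l. rewrite <- (eit_opp_inv (INR j * (2 * PI))), eit_2npi. ring. }
  assert (G := C_geometric_sum q n).
  rewrite Hqn, Cminus_diag in G.
  replace (sum_n (G := C_AbelianMonoid) (fun u => Cpow q u) n) with (RtoC 0); [ring|].
  assert (Hq1 : (q - RtoC 1)%C <> RtoC 0) by (intros E; apply Hq, Ceq_minus, E).
  symmetry. replace (sum_n (G := C_AbelianMonoid) (fun u => Cpow q u) n) with 
    (/ (q - RtoC 1) * ((q - RtoC 1) * sum_n (G := C_AbelianMonoid) (fun u => Cpow q u) n))%C.
  + rewrite G. ring.
  + rewrite Cmult_assoc, Cinv_l by auto. ring.
Qed.

Definition torus_pt (n : nat) (s1 s2 : R) (u v : nat) : C * C :=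
  ((RtoC s1 * eit (root_angle n u))%C, (RtoC s2 * eit (root_angle n v))%C).

Definition torus_coef (n : nat) (s1 s2 : R) (j1 j2 : nat) (f : C * C -> C) : C :=
  avg n (fun u => eit (- (INR j1 * root_angle n u)) *
    avg n (fun v => eit (- (INR j2 * root_angle n v)) * f (torus_pt n s1 s2 u v)))%C.

Lemma torus_coef_plus (n : nat) (s1 s2 : R) (j1 j2 : nat) (f g : C * C -> C) :
  torus_coef n s1 s2 j1 j2 (fun w => f w + g w)%C
  = (torus_coef n s1 s2 j1 j2 f + torus_coef n s1 s2 j1 j2 g)%C.
Proof.
unfold torus_coef. rewrite <- avg_plus. apply avg_ext. intros u.
rewrite <- Cmult_plus_distr_l. f_equal. rewrite <- avg_plus. apply avg_ext. intros v. ring.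
Qed.

Lemma torus_coef_bound (n : nat) (s1 s2 : R) (j1 j2 : nat) (f : C * C -> C) (M : R) :
  0 <= s1 -> 0 <= s2 -> (forall w, Cmod (fst w) = s1 -> Cmod (snd w) = s2 -> Cmod (f w) <= M) ->
  Cmod (torus_coef n s1 s2 j1 j2 f) <= M.
Proof.
intros H1 H2 HM. apply avg_bound. intros u. rewrite Cmod_mult, Cmod_eit, Rmult_1_l.
apply avg_bound. intros v. rewrite Cmod_mult, Cmod_eit, Rmult_1_l.
apply HM; simpl; rewrite Cmod_mult, Cmod_eit, Cmod_R, Rabs_pos_eq; auto; ring.
Qed.

Lemma torus_coef_monomial (n : nat) (s1 s2 : R) (j1 j2 i k : nat) (c : C) :
  (i <= n)%nat -> (j1 <= n)%nat -> (k <= n)%nat -> (j2 <= n)%nat ->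
  torus_coef n s1 s2 j1 j2 (fun w => c * Cpow (fst w) i * Cpow (snd w) k)%C
  = if andb (Nat.eqb i j1) (Nat.eqb k j2) then (c * RtoC s1 ^ i * RtoC s2 ^ k)%C else RtoC 0.
Proof.
intros. unfold torus_coef, torus_pt; simpl.
transitivity (c * RtoC s1 ^ i * RtoC s2 ^ k *
  (avg n (fun u => Cpow (eit (root_angle n u)) i * eit (- (INR j1 * root_angle n u))) *
   avg n (fun v => Cpow (eit (root_angle n v)) k * eit (- (INR j2 * root_angle n v)))))%C.
- set (A2 := avg n (fun v => Cpow (eit (root_angle n v)) k * eit (- (INR j2 * root_angle n v)))%C).
  rewrite (avg_ext n _ (fun u => (c * RtoC s1 ^ i * RtoC s2 ^ k * A2) *
    (Cpow (eit (root_angle n u)) i * eit (- (INR j1 * root_angle n u))))%C).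
  + rewrite avg_scal. ring.
  + intros u. transitivity (eit (- (INR j1 * root_angle n u)) *
      ((c * RtoC s1 ^ i * RtoC s2 ^ k * Cpow (eit (root_angle n u)) i) * A2))%C; [|ring].
    f_equal. unfold A2. rewrite <- avg_scal. apply avg_ext. intros v. rewrite !Cpow_mult_l. ring.
- rewrite !avg_orthogonal by auto.
  destruct (Nat.eqb i j1), (Nat.eqb k j2); simpl; ring.
Qed.

(** [pk_aux F z0 k w j] gathers the monomials of degree [k] whose first exponent is at most [j],
    whence the second test. *)
Lemma torus_coef_pk (F : C * C -> C) (z0 : C * C) (n : nat) (s1 s2 : R) (j1 j2 k j : nat) :
  (j1 + j2 <= n)%nat -> (k <= n)%nat -> (j <= k)%nat ->
  torus_coef n s1 s2 j1 j2 (fun w => pk_aux F z0 k w j)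
  = if andb (Nat.eqb (j1 + j2) k) (Nat.leb j1 j) then (bcoef F z0 j1 j2 * RtoC s1 ^ j1 * RtoC s2 ^ j2)%C else RtoC 0.
Proof.
intros Hn Hk Hj. induction j.
- simpl pk_aux.
  transitivity (torus_coef n s1 s2 j1 j2 (fun w => bcoef F z0 0 k * Cpow (fst w) 0 * Cpow (snd w) k)%C).
  { f_equal. apply functional_extensionality. intros w. simpl. ring. }
  rewrite torus_coef_monomial by lia.
  destruct (Nat.eqb_spec 0 j1) as [E1|E1], (Nat.eqb_spec k j2) as [E2|E2],
    (Nat.eqb_spec (j1 + j2) k) as [E3|E3], (Nat.leb_spec j1 0) as [E4|E4]; simpl; try lia; try reflexivity.
  subst. reflexivity.
- change (fun w => pk_aux F z0 k w (S j)) with (fun w => pk_aux F z0 k w j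
    + bcoef F z0 (S j) (k - S j) * Cpow (fst w) (S j) * Cpow (snd w) (k - S j))%C.
  rewrite torus_coef_plus, IHj by lia. rewrite torus_coef_monomial by lia.
  destruct (Nat.eqb_spec (S j) j1) as [<-|H1].
  + destruct (Nat.eqb_spec (k - S j) j2) as [<-|H2].
    * replace (S j + (k - S j))%nat with k by lia. rewrite Nat.eqb_refl.
      destruct (Nat.leb_spec (S j) j); [lia|]. rewrite Nat.leb_refl. simpl. ring.
    * destruct (Nat.eqb_spec (S j + j2) k); [lia|]. simpl. ring.
  + replace (Nat.leb j1 (S j)) with (Nat.leb j1 j).
    * simpl. ring.
    * destruct (Nat.leb_spec j1 j), (Nat.leb_spec j1 (S j)); auto; lia.
Qed.

(** The number of nodes is fixed by [n], while the induction runs over the truncation [m]. *)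
Lemma torus_coef_partial_sum (F : C * C -> C) (z0 : C * C) (n m : nat) (s1 s2 : R) (j1 j2 k0 : nat) :
  (j1 + j2 <= n)%nat -> (m <= n)%nat -> (j1 + j2)%nat <> k0 ->
  torus_coef n s1 s2 j1 j2 (fun w => sum_n (G := C_AbelianMonoid) (fun k => if Nat.eqb k k0 then RtoC 0 else pk F z0 k w) m)
  = if Nat.leb (j1 + j2) m then (bcoef F z0 j1 j2 * RtoC s1 ^ j1 * RtoC s2 ^ j2)%C else RtoC 0.
Proof.
intros Hn Hm Hk0.
assert (S : forall k, (k <= n)%nat -> torus_coef n s1 s2 j1 j2 (fun w => if Nat.eqb k k0 then RtoC 0 else pk F z0 k w)
  = if Nat.eqb (j1 + j2) k then (bcoef F z0 j1 j2 * RtoC s1 ^ j1 * RtoC s2 ^ j2)%C else RtoC 0).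
{ intros k Hk. destruct (Nat.eqb_spec k k0) as [->|Hne].
  - destruct (Nat.eqb_spec (j1 + j2) k0); [lia|].
    transitivity (torus_coef n s1 s2 j1 j2 (fun w => RtoC 0 * Cpow (fst w) 0 * Cpow (snd w) 0)%C).
    + f_equal. apply functional_extensionality. intros w. simpl. ring.
    + rewrite torus_coef_monomial by lia. destruct (andb _ _); simpl; ring.
  - unfold pk. rewrite torus_coef_pk by lia. destruct (Nat.eqb_spec (j1 + j2) k); simpl; auto.
    destruct (Nat.leb_spec j1 k); auto; lia. }
induction m.
- transitivity (torus_coef n s1 s2 j1 j2 (fun w => if Nat.eqb 0 k0 then RtoC 0 else pk F z0 0 w)).
  + f_equal. apply functional_extensionality. intros w. now rewrite sum_O.
  + rewrite S by lia. destruct (Nat.eqb_spec (j1 + j2) 0), (Nat.leb_spec (j1 + j2) 0); auto; lia.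
- transitivity (torus_coef n s1 s2 j1 j2 (fun w => sum_n (G := C_AbelianMonoid) (fun k => if Nat.eqb k k0 then RtoC 0 else pk F z0 k w) m
    + (if Nat.eqb (Datatypes.S m) k0 then RtoC 0 else pk F z0 (Datatypes.S m) w))%C).
  + f_equal. apply functional_extensionality. intros w. now rewrite C_sum_Sn.
  + rewrite torus_coef_plus, IHm, S by lia.
    destruct (Nat.leb_spec (j1 + j2) m), (Nat.leb_spec (j1 + j2) (Datatypes.S m)), (Nat.eqb_spec (j1 + j2) (Datatypes.S m)); try lia; ring.
Qed.

(** * Bounding the coefficients outside a main polynomial *)

Lemma list_bounded {A : Type} (f : A -> R) (l : list A) : exists M, forall t, In t l -> f t <= M.
Proof.
induction l as [|x l [M HM]]; [exists 0; intros t []|].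
exists (Rmax (f x) M). intros t [->|Ht]; [apply Rmax_l|]. eapply Rle_trans; [now apply HM|apply Rmax_r].
Qed.

(** Compactness of a box in real dimension 4. Continuity holds only at points of the polydisc; a
    centre outside it receives a neighbourhood that misses the polydisc, where nothing has to be
    shown. *)
Lemma closed_polydisc_bounded (F : C * C -> C) (a b : C) (R1 R2 : R) :
  (forall u v, Cmod (u - a)%C <= R1 -> Cmod (v - b)%C <= R2 -> continuous F (u, v)) ->
  exists M, forall u v, Cmod (u - a)%C <= R1 -> Cmod (v - b)%C <= R2 -> Cmod (F (u, v)) <= M.
Proof.
intros Hc.
set (pt := fun t : Compactness.Tn 4 R => let '(x1, (x2, (x3, (x4, _)))) := t in (((x1, x2) : C), ((x3, x4) : C))).
assert (Hloc : forall t, exists d : posreal, forall x, close_n 4 d x t ->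
  Cmod (fst (pt x) - a)%C <= R1 -> Cmod (snd (pt x) - b)%C <= R2 -> Cmod (F (pt x)) <= Cmod (F (pt t)) + 1).
{ intros t. 
  assert (Hd : forall d x, close_n 4 d x t -> Cmod (fst (pt x) - fst (pt t))%C < 2 * d /\ Cmod (snd (pt x) - snd (pt t))%C < 2 * d).
  { destruct t as [t1 [t2 [t3 [t4 []]]]]. intros d [x1 [x2 [x3 [x4 []]]]] [H1 [H2 [H3 [H4 _]]]]. simpl. split.
    - eapply Rle_lt_trans; [apply (Cmod_pair_le (x1 - t1) (x2 - t2))|]. lra.
    - eapply Rle_lt_trans; [apply (Cmod_pair_le (x3 - t3) (x4 - t4))|]. lra. }
  destruct (Rle_lt_dec (Cmod (fst (pt t) - a)%C) R1) as [I1|I1].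
  - destruct (Rle_lt_dec (Cmod (snd (pt t) - b)%C) R2) as [I2|I2].
    + assert (Hct : continuous F (pt t)).
      { rewrite (surjective_pairing (pt t)). apply Hc; auto. }
      destruct (proj1 (continuous_C2C_eps F (pt t)) Hct 1 Rlt_0_1) as [d [Hd0 K]].
      exists (mkposreal (d / 2) ltac:(lra)). intros x Hx _ _. apply Hd in Hx. simpl in Hx.
      specialize (K (pt x) ltac:(lra) ltac:(lra)).
      replace (F (pt x)) with ((F (pt x) - F (pt t)) + F (pt t))%C by ring.
      eapply Rle_trans; [apply Cmod_triangle|]. lra.
    + exists (mkposreal ((Cmod (snd (pt t) - b)%C - R2) / 2) ltac:(lra)). intros x Hx _ Hb. exfalso.
      apply Hd in Hx. simpl in Hx. 
      assert (T := Cmod_minus_triangle (snd (pt t)) (snd (pt x)) b).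
      replace (snd (pt t) - snd (pt x))%C with (- (snd (pt x) - snd (pt t)))%C in T by ring. rewrite Cmod_opp in T. lra.
  - exists (mkposreal ((Cmod (fst (pt t) - a)%C - R1) / 2) ltac:(lra)). intros x Hx Ha _. exfalso.
    apply Hd in Hx. simpl in Hx. 
    assert (T := Cmod_minus_triangle (fst (pt t)) (fst (pt x)) a).
    replace (fst (pt t) - fst (pt x))%C with (- (fst (pt x) - fst (pt t)))%C in T by ring. rewrite Cmod_opp in T. lra. }
set (delta := fun t => proj1_sig (constructive_indefinite_description _ (Hloc t))).
assert (Hdelta : forall t x, close_n 4 (delta t) x t ->
  Cmod (fst (pt x) - a)%C <= R1 -> Cmod (snd (pt x) - b)%C <= R2 -> Cmod (F (pt x)) <= Cmod (F (pt t)) + 1).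
{ intros t. exact (proj2_sig (constructive_indefinite_description _ (Hloc t))). }
(* [compactness_list] provides its finite list only under a double negation, so the goal is put in
   the same form. *)
apply Classical_Prop.NNPP. intros HN.
apply (compactness_list 4 (fst a - R1, (snd a - R1, (fst b - R2, (snd b - R2, tt))))
   (fst a + R1, (snd a + R1, (fst b + R2, (snd b + R2, tt)))) delta).
intros [l Hl]. apply HN.
destruct (list_bounded (fun t => Cmod (F (pt t)) + 1) l) as [M HM]. exists M.
intros [u1 u2] [v1 v2] Hu Hv.
assert (A1 := fst_le_Cmod ((u1, u2) - a)%C). assert (A2 := snd_le_Cmod ((u1, u2) - a)%C).
assert (A3 := fst_le_Cmod ((v1, v2) - b)%C). assert (A4 := snd_le_Cmod ((v1, v2) - b)%C).
simpl in A1, A2, A3, A4.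
destruct (Hl (u1, (u2, (v1, (v2, tt))))) as [t [Ht1 [_ Ht2]]].
{ simpl. repeat split; apply Rabs_le_between'; unfold Rminus; lra. }
eapply Rle_trans; [|apply (HM t Ht1)].
apply (Hdelta t (u1, (u2, (v1, (v2, tt)))) Ht2 Hu Hv).
Qed.

(** Each of the [k + 1] summands of [1 + q + ... + q ^ k] is at least [q ^ k], and the sum stays
    below [/ (1 - q)]. *)
Lemma succ_pow_bound (q : R) (k : nat) : 0 <= q < 1 -> INR (S k) * q ^ k <= / (1 - q).
Proof.
intros Hq. assert (H : INR (S k) * q ^ k * (1 - q) <= 1 - q ^ S k).
{ induction k; [simpl; lra|]. rewrite S_INR.
  assert (0 <= q ^ S k) by (apply pow_le; lra).
  assert (q ^ S k <= 1) by (rewrite <- (pow1 (S k)); apply pow_incr; lra).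
  simpl (q ^ S (S k)). simpl (q ^ S k) in *. set (x := q * q ^ k) in *.
  assert (q * (INR (S k) * q ^ k * (1 - q)) <= q * (1 - x)) by (apply Rmult_le_compat_l; lra).
  replace ((INR (S k) + 1) * x * (1 - q)) with (q * (INR (S k) * q ^ k * (1 - q)) + x * (1 - q)) by (unfold x; ring).
  nra. }
assert (0 <= q ^ S k) by (apply pow_le; lra).
apply Rmult_le_reg_r with (1 - q); [lra|]. rewrite Rinv_l by lra. lra.
Qed.

Lemma bcoef_cauchy (F : C * C -> C) (a b : C) (R1 R2 M : R) (i j : nat) :
  analytic_D2 F -> 0 < R1 -> 0 < R2 -> Cmod a + R1 < 1 -> Cmod b + R2 < 1 ->
  (forall u v, Cmod (u - a)%C <= R1 -> Cmod (v - b)%C <= R2 -> Cmod (F (u, v)) <= M) ->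
  Cmod (bcoef F (a, b) i j) * R1 ^ i * R2 ^ j <= M.
Proof.
intros H H1 H2 Ha Hb HM.
assert (E := cauchy_estimate_2 F a b R1 R2 M i j H H1 H2 Ha Hb HM).
rewrite Cmod_bcoef. 
assert (P0 : 0 < INR (fact i) * INR (fact j)) by (apply Rmult_lt_0_compat; apply INR_fact_lt_0).
assert (P1 : 0 < R1 ^ i) by now apply pow_lt. assert (P2 : 0 < R2 ^ j) by now apply pow_lt.
apply Rle_trans with (INR (fact i) * INR (fact j) * M / (R1 ^ i * R2 ^ j) / (INR (fact i) * INR (fact j)) * R1 ^ i * R2 ^ j).
- apply Rmult_le_compat_r; [lra|]. apply Rmult_le_compat_r; [lra|]. unfold Rdiv at 1 2.
  apply Rmult_le_compat_r; [left; now apply Rinv_0_lt_compat|exact E].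
- right. field. repeat split; try lra; apply INR_fact_neq_0.
Qed.

(** The torus lies strictly inside the polydisc of radii [R1] and [R2], so Cauchy's estimates there
    make the expansion converge geometrically and uniformly on the torus. A mean over finitely many
    torus points then extracts the coefficient from a partial sum that is close to the sum bounded
    by the hypothesis. *)
Lemma main_polynomial_coef_bound (F : C * C -> C) (a b : C) (R1 R2 t : R) (k0 i j : nat) :
  analytic_D2 F -> 0 < R1 -> 0 < R2 -> Cmod a + R1 < 1 -> Cmod b + R2 < 1 -> 0 < t < 1 ->
  main_polynomial F (a, b) (t * R1) (t * R2) k0 -> (i + j)%nat <> k0 ->
  Cmod (bcoef F (a, b) i j) * (t * R1) ^ i * (t * R2) ^ j <=
  / 2 * maxupto (fun m => Cmod (bcoef F (a, b) m (k0 - m)) * (t * R1) ^ m * (t * R2) ^ (k0 - m)) k0.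
Proof.
intros H H1 H2 Ha Hb Ht Hmain Hij.
set (X := / 2 * maxupto _ k0).
destruct (closed_polydisc_bounded F a b R1 R2) as [M HM].
{ intros u v Hu Hv. apply H. apply (proj2 (inD2_pair _ _)). split.
  - replace u with ((u - a) + a)%C by ring. eapply Rle_lt_trans; [apply Cmod_triangle|lra].
  - replace v with ((v - b) + b)%C by ring. eapply Rle_lt_trans; [apply Cmod_triangle|lra]. }
assert (HM0 : 0 <= M).
{ eapply Rle_trans; [apply (Cmod_ge_0 (F (a, b)))|]. apply HM; rewrite Cminus_diag, Cmod_0; lra. }
assert (Hco : forall i j, Cmod (bcoef F (a, b) i j) * (t * R1) ^ i * (t * R2) ^ j <= M * t ^ (i + j)).
{ intros m n. rewrite !Rpow_mult_distr, pow_add.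
  replace (Cmod (bcoef F (a, b) m n) * (t ^ m * R1 ^ m) * (t ^ n * R2 ^ n)) with
    (Cmod (bcoef F (a, b) m n) * R1 ^ m * R2 ^ n * (t ^ m * t ^ n)) by ring.
  apply Rmult_le_compat_r.
  - apply Rmult_le_pos; apply pow_le; lra.
  - now apply bcoef_cauchy. }
(* The decay [t ^ k] is shared out as [q ^ k * q ^ k]: one factor absorbs the [k + 1] monomials of
   degree [k], the other remains as a geometric majorant. *)
set (q := sqrt t).
assert (Hqq : q * q = t) by (apply sqrt_sqrt; lra).
assert (Hq0 : 0 < q) by (apply sqrt_lt_R0; lra).
assert (Hq : 0 <= q < 1) by (split; [lra|nra]).
set (K := M * / (1 - q)). assert (HK : 0 <= K) by (apply Rmult_le_pos; auto; left; apply Rinv_0_lt_compat; lra).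
(* The same [n] counts the nodes and truncates the series, so the extraction is exact for each [n];
   letting [n] grow removes the tail. *)
assert (Hpart : forall n, (i + j <= n)%nat ->
  Cmod (bcoef F (a, b) i j) * (t * R1) ^ i * (t * R2) ^ j <= X + K * q ^ S n / (1 - q)).
{ intros n Hn.
  assert (P1 : 0 <= t * R1) by (apply Rmult_le_pos; lra). assert (P2 : 0 <= t * R2) by (apply Rmult_le_pos; lra).
  assert (E := torus_coef_partial_sum F (a, b) n n (t * R1) (t * R2) i j k0 Hn (Nat.le_refl n) Hij).
  destruct (Nat.leb_spec (i + j) n) as [_|]; [|lia].
  apply (f_equal Cmod) in E. rewrite !Cmod_mult, !Cmod_pow, !Cmod_R, !Rabs_pos_eq in E by auto.
  rewrite <- E. apply torus_coef_bound; auto. intros w Hw1 Hw2.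
  destruct (Hmain ((a + fst w)%C, (b + snd w)%C)) as [S [HS1 HS2]].
  { split; simpl; [rewrite <- Hw1|rewrite <- Hw2]; f_equal; ring. }
  fold X in HS2. simpl fst in HS1. simpl snd in HS1.
  replace (a + fst w - a)%C with (fst w) in HS1 by ring. replace (b + snd w - b)%C with (snd w) in HS1 by ring.
  rewrite <- (surjective_pairing w) in HS1.
  assert (G := geometric_series_bound (fun k => if Nat.eqb k k0 then RtoC 0 else pk F (a, b) k w) S K q n HK Hq).
  cbv beta in G.
  set (Sn := sum_n (G := C_AbelianMonoid) (fun k => if Nat.eqb k k0 then RtoC 0 else pk F (a, b) k w) n) in *.
  replace Sn with (S + - (S - Sn))%C by ring.
  eapply Rle_trans; [apply Cmod_triangle|]. rewrite Cmod_opp. apply Rplus_le_compat; auto.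
  apply G; auto. intros k. destruct (Nat.eqb k k0).
  - rewrite Cmod_0. apply Rmult_le_pos; auto. apply pow_le; lra.
  - apply Rle_trans with (INR (Datatypes.S k) * (M * t ^ k)).
    + apply pk_aux_bound; auto. intros m Hm. rewrite Hw1, Hw2.
      replace (t ^ k) with (t ^ (m + (k - m))) by (f_equal; lia). apply Hco.
    + rewrite <- Hqq, Rpow_mult_distr. unfold K.
      replace (INR (Datatypes.S k) * (M * (q ^ k * q ^ k))) with (M * q ^ k * (INR (Datatypes.S k) * q ^ k)) by ring.
      replace (M * / (1 - q) * q ^ k) with (M * q ^ k * / (1 - q)) by ring.
      apply Rmult_le_compat_l; [|now apply succ_pow_bound].
      apply Rmult_le_pos; auto. apply pow_le; lra. }
apply le_epsilon. intros eps Heps.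
set (e := eps * (1 - q) / (K + 1)). assert (He : 0 < e) by (unfold e; apply Rdiv_lt_0_compat; [apply Rmult_lt_0_compat|]; lra).
destruct (pow_lt_1_zero q) with (y := e) as [n0 Hn0]; auto.
{ rewrite Rabs_pos_eq; lra. }
set (n := Nat.max n0 (i + j)).
eapply Rle_trans; [apply (Hpart n); unfold n; lia|]. apply Rplus_le_compat_l.
specialize (Hn0 (S n) ltac:(unfold n; lia)). rewrite Rabs_pos_eq in Hn0 by (apply pow_le; lra).
apply Rle_trans with ((K + 1) * e / (1 - q)).
- unfold Rdiv. apply Rmult_le_compat_r; [left; apply Rinv_0_lt_compat; lra|].
  apply Rmult_le_compat; try lra. apply pow_le; lra.
- right. unfold e. field. lra.
Qed.

(** * Gronwall's inequality for finite families *)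

Definition lsum {X : Type} (l : list X) (f : X -> R) : R := fold_right (fun x acc => f x + acc) 0 l.

Lemma lsum_le {X : Type} (l : list X) (f : X -> R) (c : R) :
  (forall x, In x l -> f x <= c) -> lsum l f <= INR (length l) * c.
Proof.
induction l as [|x l IH]; intros H; [simpl; lra|].
change (f x + lsum l f <= INR (S (length l)) * c). rewrite S_INR.
assert (f x <= c) by (apply H; now left).
assert (lsum l f <= INR (length l) * c) by (apply IH; intros; apply H; now right). lra.
Qed.

Lemma lsum_pos {X : Type} (l : list X) (f : X -> R) : (forall x, 0 <= f x) -> 0 <= lsum l f.
Proof.
intros H. induction l as [|x l IH]; [simpl; lra|].
change (0 <= f x + lsum l f). specialize (H x). lra.
Qed.

Lemma lsum_ge {X : Type} (l : list X) (f : X -> R) (x : X) :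
  (forall x, 0 <= f x) -> In x l -> f x <= lsum l f.
Proof.
intros H. induction l as [|y l IH]; [intros []|].
change (In x (y :: l) -> f x <= f y + lsum l f).
assert (P := lsum_pos l f H). intros [->|Hx]; [lra|]. specialize (IH Hx). specialize (H y). lra.
Qed.

Lemma is_derive_lsum {X : Type} (l : list X) (f df : X -> R -> R) (t : R) :
  (forall x, In x l -> is_derive (f x) t (df x t)) ->
  is_derive (fun u => lsum l (fun x => f x u)) t (lsum l (fun x => df x t)).
Proof.
induction l as [|x l IH]; intros H.
- apply (is_derive_const (K := R_AbsRing) (V := R_NormedModule) 0).
- apply (is_derive_plus (K := R_AbsRing) (V := R_NormedModule) (f x) (fun u => lsum l (fun x => f x u))).
  + apply H; now left.
  + apply IH. intros; apply H; now right.
Qed.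

Lemma gronwall (phi dphi : R -> R) (K : R) :
  (forall t, 0 <= t <= 1 -> is_derive phi t (dphi t)) ->
  (forall t, 0 <= t <= 1 -> dphi t <= K * phi t) -> phi 1 <= exp K * phi 0.
Proof.
intros Hd HK.
assert (D : forall t, 0 <= t <= 1 -> is_derive (fun u => phi u * exp (- K * u)) t ((dphi t - K * phi t) * exp (- K * t))).
{ intros t Ht.
  assert (He : is_derive (fun u => exp (- K * u)) t (- K * exp (- K * t))) by (auto_derive; auto; ring).
  replace ((dphi t - K * phi t) * exp (- K * t))
    with (plus (mult (dphi t) (exp (- K * t))) (mult (phi t) (- K * exp (- K * t))))
    by (unfold plus, mult; simpl; ring).
  apply (is_derive_mult (K := R_AbsRing) phi (fun u => exp (- K * u)) t _ _ (Hd t Ht) He).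
  intros; apply Rmult_comm. }
destruct (MVT_gen (fun u => phi u * exp (- K * u)) 0 1 (fun t => (dphi t - K * phi t) * exp (- K * t))) as [c [Hc E]].
- rewrite Rmin_left, Rmax_right by lra. intros; apply D; lra.
- rewrite Rmin_left, Rmax_right by lra. intros y Hy.
  apply continuity_pt_filterlim.
  apply (ex_derive_continuous (K := R_AbsRing) (V := R_NormedModule) (fun u => phi u * exp (- K * u)) y).
  eexists. apply D; auto.
- rewrite Rmin_left, Rmax_right in Hc by lra. specialize (HK c Hc).
  assert (P := exp_pos (- K * c)).
  rewrite Rmult_0_r, exp_0, Rmult_1_r, Rmult_1_r in E.
  assert (L : phi 1 * exp (- K) <= phi 0) by nra.
  apply Rmult_le_reg_r with (exp (- K)); [apply exp_pos|].
  replace (exp K * phi 0 * exp (- K)) with (phi 0 * (exp K * exp (- K))) by ring.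
  rewrite <- exp_plus, Rplus_opp_r, exp_0, Rmult_1_r. exact L.
Qed.

(** The squared modulus as a polynomial in the components, differentiable even where [c]
    vanishes. *)
Definition sqmod (c : C) : R := fst c * fst c + snd c * snd c.

Lemma sqmod_Cmod (c : C) : sqmod c = Cmod c * Cmod c.
Proof. replace (Cmod c * Cmod c) with (Cmod c ^ 2) by ring. rewrite Cmod2_alt. unfold sqmod, Re, Im. ring. Qed.

Lemma is_derive_sqmod (g : R -> C) (t : R) (dg : C) : rderiv g t dg ->
  is_derive (fun u => sqmod (g u)) t (2 * (fst (g t) * fst dg + snd (g t) * snd dg)).
Proof.
intros [H1 H2]. unfold sqmod. evar (l : R). 
replace (2 * (fst (g t) * fst dg + snd (g t) * snd dg)) with l.
- apply (is_derive_plus (K := R_AbsRing) (V := R_NormedModule)); apply (is_derive_mult (K := R_AbsRing)); eauto; intros; apply Rmult_comm.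
- unfold l, plus, mult; simpl. ring.
Qed.

(** Let [phi] be the sum of all squared moduli. A product of two moduli from the family is at most
    [phi], so each summand has derivative at most [2 * K * (phi + phi)], which is the origin of
    [4 * K]; the length counts the summands. *)
Lemma gronwall_family {X : Type} (l : list X) (g dg : X -> R -> C) (K : R) : 0 <= K ->
  (forall x t, In x l -> 0 <= t <= 1 -> rderiv (g x) t (dg x t)) ->
  (forall x t, In x l -> 0 <= t <= 1 -> exists y1 y2, In y1 l /\ In y2 l /\
     Cmod (dg x t) <= K * (Cmod (g y1 t) + Cmod (g y2 t))) ->
  lsum l (fun x => sqmod (g x 1)) <= exp (INR (length l) * (4 * K)) * lsum l (fun x => sqmod (g x 0)).
Proof.
intros HK Hd Hb.
assert (Hsq : forall c, 0 <= sqmod c) by (intros c; unfold sqmod; nra).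
apply (gronwall (fun t => lsum l (fun x => sqmod (g x t)))
  (fun t => lsum l (fun x => 2 * (fst (g x t) * fst (dg x t) + snd (g x t) * snd (dg x t))))).
- intros t Ht. apply (is_derive_lsum l (fun x t => sqmod (g x t))
    (fun x t => 2 * (fst (g x t) * fst (dg x t) + snd (g x t) * snd (dg x t)))).
  intros x Hx. apply is_derive_sqmod. auto.
- intros t Ht. rewrite Rmult_assoc. apply lsum_le. intros x Hx.
  set (phi := lsum l (fun x => sqmod (g x t))).
  assert (Hge : forall y, In y l -> Cmod (g y t) * Cmod (g y t) <= phi).
  { intros y Hy. rewrite <- sqmod_Cmod. apply (lsum_ge l (fun x => sqmod (g x t))); auto. }
  destruct (Hb x t Hx Ht) as [y1 [y2 [Hy1 [Hy2 B]]]].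
  assert (CS : fst (g x t) * fst (dg x t) + snd (g x t) * snd (dg x t) <= Cmod (g x t) * Cmod (dg x t)).
  { rewrite <- (Cmod_conj (g x t)), <- Cmod_mult. eapply Rle_trans; [|apply fst_le_Cmod].
    eapply Rle_trans; [|apply Rle_abs]. right. unfold Cconj, Cmult; simpl. ring. }
  assert (G1 := Hge y1 Hy1). assert (G2 := Hge y2 Hy2). assert (G0 := Hge x Hx).
  set (u := Cmod (g x t)) in *. set (v1 := Cmod (g y1 t)) in *. set (v2 := Cmod (g y2 t)) in *.
  assert (U : 0 <= u) by apply Cmod_ge_0.
  assert (B1 : u * v1 <= phi) by nra. assert (B2 : u * v2 <= phi) by nra.
  assert (u * Cmod (dg x t) <= u * (K * (v1 + v2))) by (apply Rmult_le_compat_l; auto).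
  assert (K * (u * v1 + u * v2) <= K * (2 * phi)) by (apply Rmult_le_compat_l; lra). lra.
Qed.

Definition multi_indices (p : nat) : list (nat * nat) :=
  filter (fun x => Nat.leb (fst x + snd x) p) (list_prod (seq 0 (S p)) (seq 0 (S p))).

Lemma in_multi_indices (p i j : nat) : In (i, j) (multi_indices p) <-> (i + j <= p)%nat.
Proof.
unfold multi_indices. rewrite filter_In, in_prod_iff, !in_seq, Nat.leb_le. simpl. lia.
Qed.

Lemma list_argmax {X : Type} (l : list X) (f : X -> R) (x : X) : In x l ->
  exists y, In y l /\ forall z, In z l -> f z <= f y.
Proof.
revert x. induction l as [|a l IH]; [intros x []|]. intros _ _.
destruct l as [|b l].
- exists a. split; [now left|]. intros z [->|[]]. lra.
- destruct (IH b) as [y [Hy H]]; [now left|].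
  destruct (Rle_lt_dec (f a) (f y)).
  + exists y. split; [now right|]. intros z [->|Hz]; auto.
  + exists a. split; [now left|]. intros z [->|Hz]; [lra|]. specialize (H z Hz). lra.
Qed.

(** * Main polynomials imply bounded index *)

(** The lower bound on [l1] and [l2] says exactly that the closed polydisc of radii [beta / l1 z]
    and [beta / l2 z] stays inside the bidisc. *)
Lemma admissible_pos (beta : R) (l1 l2 : C * C -> R) (z : C * C) : 0 < beta ->
  admissible_L beta l1 l2 -> inD2 z ->
  0 < l1 z /\ 0 < l2 z /\ Cmod (fst z) + beta / l1 z < 1 /\ Cmod (snd z) + beta / l2 z < 1.
Proof.
intros Hb H Hz. destruct (H z Hz) as [_ [_ [H1 H2]]]. destruct Hz as [Z1 Z2].
assert (P : forall m x, m < 1 -> x > beta / (1 - m) -> 0 < x /\ m + beta / x < 1).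
{ intros m x Hm Hx. assert (0 < beta / (1 - m)) by (apply Rdiv_lt_0_compat; lra).
  split; [lra|]. assert (beta / x < 1 - m); [|lra].
  apply Rmult_lt_reg_r with x; [lra|]. unfold Rdiv. rewrite Rmult_assoc, Rinv_l, Rmult_1_r by lra.
  apply Rmult_lt_compat_r with (r := 1 - m) in Hx; [|lra].
  unfold Rdiv in Hx. rewrite Rmult_assoc, Rinv_l, Rmult_1_r in Hx by lra. lra. }
destruct (P _ _ Z1 H1), (P _ _ Z2 H2). auto.
Qed.

Definition weight (l1 l2 : C * C -> R) (z : C * C) (i j : nat) : R :=
  INR (fact i) * INR (fact j) * (l1 z ^ i) * (l2 z ^ j).

Lemma weight_pos (l1 l2 : C * C -> R) (z : C * C) (i j : nat) :
  0 < l1 z -> 0 < l2 z -> 0 < weight l1 l2 z i j.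
Proof.
intros H1 H2. unfold weight. repeat apply Rmult_lt_0_compat; try apply INR_fact_lt_0; now apply pow_lt.
Qed.

Lemma weight_le (l1 l2 : C * C -> R) (z z' : C * C) (Lam : R) (i j m : nat) :
  0 < l1 z -> 0 < l2 z -> 0 < l1 z' -> 0 < l2 z' -> 1 <= Lam ->
  l1 z <= Lam * l1 z' -> l2 z <= Lam * l2 z' -> (i + j <= m)%nat ->
  weight l1 l2 z i j <= Lam ^ m * weight l1 l2 z' i j.
Proof.
intros P1 P2 P3 P4 HL H1 H2 Hm. unfold weight.
assert (A1 : l1 z ^ i <= Lam ^ i * l1 z' ^ i) by (rewrite <- Rpow_mult_distr; apply pow_incr; lra).
assert (A2 : l2 z ^ j <= Lam ^ j * l2 z' ^ j) by (rewrite <- Rpow_mult_distr; apply pow_incr; lra).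
assert (A3 : Lam ^ i * Lam ^ j <= Lam ^ m) by (rewrite <- pow_add; now apply Rle_pow).
assert (B1 : 0 < l1 z ^ i) by now apply pow_lt. assert (B2 : 0 < l2 z ^ j) by now apply pow_lt.
assert (B3 : 0 < l1 z' ^ i) by now apply pow_lt. assert (B4 : 0 < l2 z' ^ j) by now apply pow_lt.
assert (Q : 0 < INR (fact i) * INR (fact j)) by (apply Rmult_lt_0_compat; apply INR_fact_lt_0).
rewrite !Rmult_assoc. rewrite <- (Rmult_assoc (INR (fact i))).
replace (Lam ^ m * (INR (fact i) * (INR (fact j) * (l1 z' ^ i * l2 z' ^ j)))) with
  (INR (fact i) * INR (fact j) * (Lam ^ m * (l1 z' ^ i * l2 z' ^ j))) by ring.
apply Rmult_le_compat_l; [lra|].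
apply Rle_trans with ((Lam ^ i * l1 z' ^ i) * (Lam ^ j * l2 z' ^ j)).
- apply Rmult_le_compat; lra.
- replace ((Lam ^ i * l1 z' ^ i) * (Lam ^ j * l2 z' ^ j)) with ((Lam ^ i * Lam ^ j) * (l1 z' ^ i * l2 z' ^ j)) by ring.
  apply Rmult_le_compat_r; auto. apply Rmult_le_pos; lra.
Qed.

Lemma div_le_weighted (D w w' K : R) : 0 <= D -> 0 < w -> 0 < w' -> w <= K * w' -> D / w' <= K * (D / w).
Proof.
intros HD Hw Hw' H. apply Rmult_le_reg_r with (w * w'); [now apply Rmult_lt_0_compat|].
replace (D / w' * (w * w')) with (D * w) by (field; lra).
replace (K * (D / w) * (w * w')) with (D * (K * w')) by (field; lra).
now apply Rmult_le_compat_l.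
Qed.

(** The bounds at the largest radius [R = (beta, beta)], merged into one constant. They are
    two-sided because weights are moved from [z0] to [z] and back; [1 <= Lam] makes powers of [Lam]
    increase with the exponent. *)
Lemma lambda_bounds_constant (beta : R) (l1 l2 : C * C -> R) : 0 < beta ->
  admissible_L beta l1 l2 -> Q2 beta l1 l2 ->
  exists Lam, 1 <= Lam /\ forall z0 z, inD2 z0 -> inD2 z -> in_polydisc z0 (beta / l1 z0) (beta / l2 z0) z ->
    (l1 z <= Lam * l1 z0 /\ l1 z0 <= Lam * l1 z) /\ (l2 z <= Lam * l2 z0 /\ l2 z0 <= Lam * l2 z).
Proof.
intros Hb Hadm [HQ1 HQ2].
assert (Hbb : 0 <= beta <= beta) by lra.
destruct (HQ1 beta beta Hbb Hbb) as [[c1 [Hc1 K1]] [C1 K2]].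
destruct (HQ2 beta beta Hbb Hbb) as [[c2 [Hc2 K3]] [C2 K4]].
set (Lam := Rmax (Rmax 1 (Rmax C1 C2)) (Rmax (/ c1) (/ c2))).
assert (B0 : 1 <= Lam) by (eapply Rle_trans; [|apply Rmax_l]; apply Rmax_l).
assert (B1 : C1 <= Lam) by (eapply Rle_trans; [|apply Rmax_l]; eapply Rle_trans; [|apply Rmax_r]; apply Rmax_l).
assert (B2 : C2 <= Lam) by (eapply Rle_trans; [|apply Rmax_l]; eapply Rle_trans; [|apply Rmax_r]; apply Rmax_r).
assert (B3 : / c1 <= Lam) by (eapply Rle_trans; [|apply Rmax_r]; apply Rmax_l).
assert (B4 : / c2 <= Lam) by (eapply Rle_trans; [|apply Rmax_r]; apply Rmax_r).
exists Lam. split; auto. intros z0 z Hz0 Hz Hin.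
destruct (admissible_pos beta l1 l2 z0 Hb Hadm Hz0) as [P1 [P2 _]].
destruct (admissible_pos beta l1 l2 z Hb Hadm Hz) as [P3 [P4 _]].
assert (G : forall x x0 c Cc, 0 < x -> 0 < x0 -> 0 < c -> c <= x / x0 -> x / x0 <= Cc -> Cc <= Lam -> / c <= Lam ->
  x <= Lam * x0 /\ x0 <= Lam * x).
{ intros x x0 c Cc Hx Hx0 Hc G1 G2 G3 G4. 
  assert (E : x = x / x0 * x0) by (field; lra). split.
  - rewrite E at 1. apply Rmult_le_compat_r; lra.
  - apply Rle_trans with (/ c * x).
    + apply Rmult_le_reg_l with c; auto. rewrite <- Rmult_assoc, Rinv_r, Rmult_1_l by lra.
      rewrite E. apply Rmult_le_compat_r; lra.
    + apply Rmult_le_compat_r; lra. }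
split.
- apply (G _ _ c1 C1); auto.
- apply (G _ _ c2 C2); auto.
Qed.

Lemma in_polydisc_inD2 (a b a' b' : C) (R1 R2 : R) : Cmod a + R1 < 1 -> Cmod b + R2 < 1 ->
  in_polydisc (a, b) R1 R2 (a', b') -> inD2 (a', b').
Proof.
intros Ha Hb [H1 H2]. simpl in H1, H2. apply (proj2 (inD2_pair _ _)). split.
- replace a' with ((a' - a) + a)%C by ring. eapply Rle_lt_trans; [apply Cmod_triangle|lra].
- replace b' with ((b' - b) + b)%C by ring. eapply Rle_lt_trans; [apply Cmod_triangle|lra].
Qed.

(** * From Hayman's condition to bounded index *)

Section HaymanCondition.

Variables (beta : R) (l1 l2 : C * C -> R) (F : C * C -> C) (p : nat) (C1 Lam : R).
Hypothesis Hbeta : 1 < beta.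
Hypothesis Hadm : admissible_L beta l1 l2.
Hypothesis HF : analytic_D2 F.
Hypothesis HC1 : 1 <= C1.
Hypothesis HLam : 1 <= Lam.
Hypothesis Hcmp : forall z0 z, inD2 z0 -> inD2 z -> in_polydisc z0 (beta / l1 z0) (beta / l2 z0) z ->
    (l1 z <= Lam * l1 z0 /\ l1 z0 <= Lam * l1 z) /\ (l2 z <= Lam * l2 z0 /\ l2 z0 <= Lam * l2 z).
Hypothesis Hhay : forall z, inD2 z -> forall i j, (i + j = p + 1)%nat ->
  exists k1 k2, (k1 + k2 <= p)%nat /\ Lterm F l1 l2 z i j <= C1 * Lterm F l1 l2 z k1 k2.

(* Normalised derivatives at [z] with the weights kept at the base point [z0], so that they can be differentiated in [z]. *)
Definition frozen_term (z0 z : C * C) (x : nat * nat) : R :=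
  Cmod (Dpq F (fst x) (snd x) z) / weight l1 l2 z0 (fst x) (snd x).

(** In degree [p + 1] the weights are moved from [z0] to [z] at the cost of [Lam ^ (p + 1)],
    Hayman's condition at [z] costs [C1], and the return to the weights at [z0] in degree at most
    [p] costs [Lam ^ p]. In lower degrees the constant is at least 1 and nothing happens. *)
Lemma frozen_term_closed (z0 z : C * C) (i j : nat) : inD2 z0 -> inD2 z ->
  in_polydisc z0 (beta / l1 z0) (beta / l2 z0) z -> (i + j <= p + 1)%nat ->
  exists y, In y (multi_indices p) /\
    frozen_term z0 z (i, j) <= Lam ^ (p + 1) * C1 * Lam ^ p * frozen_term z0 z y.
Proof.
intros Hz0 Hz Hin Hij.
destruct (admissible_pos beta l1 l2 z0 ltac:(lra) Hadm Hz0) as [P1 [P2 _]].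
destruct (admissible_pos beta l1 l2 z ltac:(lra) Hadm Hz) as [P3 [P4 _]].
destruct (Hcmp z0 z Hz0 Hz Hin) as [[L1 L2] [L3 L4]].
assert (Q1 : 1 <= Lam ^ (p + 1)) by (now apply pow_R1_Rle).
assert (Q2' : 1 <= Lam ^ p) by (now apply pow_R1_Rle).
assert (Hft : forall y, 0 <= frozen_term z0 z y).
{ intros y. apply Rmult_le_pos; [apply Cmod_ge_0|]. left. apply Rinv_0_lt_compat, weight_pos; auto. }
destruct (le_lt_dec (i + j) p) as [Hp|Hp].
- exists (i, j). split; [now apply in_multi_indices|].
  rewrite <- (Rmult_1_l (frozen_term z0 z (i, j))) at 1. apply Rmult_le_compat_r; auto.
  assert (1 * 1 <= Lam ^ (p + 1) * C1) by (apply Rmult_le_compat; lra).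
  assert (1 * 1 <= Lam ^ (p + 1) * C1 * Lam ^ p) by (apply Rmult_le_compat; lra). lra.
- destruct (Hhay z Hz i j ltac:(lia)) as [k1 [k2 [Hk Hle]]].
  exists (k1, k2). split; [now apply in_multi_indices|].
  unfold frozen_term; simpl fst; simpl snd.
  apply Rle_trans with (Lam ^ (p + 1) * Lterm F l1 l2 z i j).
  { apply div_le_weighted; [apply Cmod_ge_0|now apply weight_pos|now apply weight_pos|].
    apply weight_le; auto. }
  rewrite !Rmult_assoc. apply Rmult_le_compat_l; [lra|].
  eapply Rle_trans; [exact Hle|]. apply Rmult_le_compat_l; [lra|].
  apply div_le_weighted; [apply Cmod_ge_0|now apply weight_pos|now apply weight_pos|].
  apply weight_le; auto.
Qed.

(** Differentiating along the segment raises one index. The weight then gains [INR (S i) * l1 z0],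
    or the analogue in the second variable; a direction of modulus at most [beta / l1 z0] cancels
    [l1 z0], leaving [beta] and a factor at most [p + 1]. The rest is the constant of
    [frozen_term_closed]. *)
Definition growth_rate : R := beta * INR (p + 1) * (Lam ^ (p + 1) * C1 * Lam ^ p).

Lemma frozen_derivative_bound (z0 z : C * C) (i j : nat) (w1 w2 : C) : inD2 z0 -> inD2 z ->
  in_polydisc z0 (beta / l1 z0) (beta / l2 z0) z -> (i + j <= p)%nat ->
  Cmod w1 <= beta / l1 z0 -> Cmod w2 <= beta / l2 z0 ->
  exists y1 y2, In y1 (multi_indices p) /\ In y2 (multi_indices p) /\
    Cmod (D1 (Dpq F i j) z * w1 + D2 (Dpq F i j) z * w2)%C / weight l1 l2 z0 i j
    <= growth_rate * (frozen_term z0 z y1 + frozen_term z0 z y2).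
Proof.
intros Hz0 Hz Hin Hij Hw1 Hw2.
destruct (admissible_pos beta l1 l2 z0 ltac:(lra) Hadm Hz0) as [P1 [P2 _]].
destruct (frozen_term_closed z0 z (S i) j Hz0 Hz Hin ltac:(lia)) as [y1 [I1 B1]].
destruct (frozen_term_closed z0 z i (S j) Hz0 Hz Hin ltac:(lia)) as [y2 [I2 B2]].
exists y1, y2. split; [auto|split; [auto|]].
rewrite D2_Dpq by auto. change (D1 (Dpq F i j) z) with (Dpq F (S i) j z).
assert (W := weight_pos l1 l2 z0 i j P1 P2).
assert (E1 : weight l1 l2 z0 (S i) j = INR (S i) * l1 z0 * weight l1 l2 z0 i j).
{ unfold weight. rewrite fact_simpl, mult_INR. simpl pow. ring. }
assert (E2 : weight l1 l2 z0 i (S j) = INR (S j) * l2 z0 * weight l1 l2 z0 i j).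
{ unfold weight. rewrite fact_simpl, mult_INR. simpl pow. ring. }
set (Kc := Lam ^ (p + 1) * C1 * Lam ^ p) in *.
assert (Si : 0 < INR (S i)) by (apply lt_0_INR; lia). assert (Sj : 0 < INR (S j)) by (apply lt_0_INR; lia).
assert (T1 : Cmod (Dpq F (S i) j z) * Cmod w1 / weight l1 l2 z0 i j <= beta * INR (S i) * frozen_term z0 z (S i, j)).
{ unfold frozen_term; simpl fst; simpl snd. rewrite E1.
  apply Rle_trans with (Cmod (Dpq F (S i) j z) * (beta / l1 z0) / weight l1 l2 z0 i j).
  - apply Rmult_le_compat_r; [left; now apply Rinv_0_lt_compat|]. apply Rmult_le_compat_l; auto. apply Cmod_ge_0.
  - right. field. repeat split; lra. }
assert (T2 : Cmod (Dpq F i (S j) z) * Cmod w2 / weight l1 l2 z0 i j <= beta * INR (S j) * frozen_term z0 z (i, S j)).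
{ unfold frozen_term; simpl fst; simpl snd. rewrite E2.
  apply Rle_trans with (Cmod (Dpq F i (S j) z) * (beta / l2 z0) / weight l1 l2 z0 i j).
  - apply Rmult_le_compat_r; [left; now apply Rinv_0_lt_compat|]. apply Rmult_le_compat_l; auto. apply Cmod_ge_0.
  - right. field. repeat split; lra. }
assert (Hft : forall y, 0 <= frozen_term z0 z y).
{ intros y. apply Rmult_le_pos; [apply Cmod_ge_0|]. left. apply Rinv_0_lt_compat, weight_pos; auto. }
assert (N : forall m, (m <= p)%nat -> forall y u, frozen_term z0 z u <= Kc * frozen_term z0 z y ->
  beta * INR (S m) * frozen_term z0 z u <= growth_rate * frozen_term z0 z y).
{ intros m Hm y u Hu. unfold growth_rate. fold Kc. rewrite (Rmult_assoc _ Kc).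
  apply Rmult_le_compat; auto.
  - apply Rmult_le_pos; [lra|apply pos_INR].
  - apply Rmult_le_compat_l; [lra|]. apply le_INR. lia. }
apply Rle_trans with (Cmod (Dpq F (S i) j z) * Cmod w1 / weight l1 l2 z0 i j + Cmod (Dpq F i (S j) z) * Cmod w2 / weight l1 l2 z0 i j).
- unfold Rdiv. rewrite <- Rmult_plus_distr_r. apply Rmult_le_compat_r; [left; now apply Rinv_0_lt_compat|].
  eapply Rle_trans; [apply Cmod_triangle|]. rewrite !Cmod_mult. lra.
- rewrite Rmult_plus_distr_l. apply Rplus_le_compat.
  + eapply Rle_trans; [exact T1|]. apply (N i); auto; lia.
  + eapply Rle_trans; [exact T2|]. apply (N j); auto; lia.
Qed.

Lemma growth_rate_pos : 0 <= growth_rate.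
Proof.
unfold growth_rate.
repeat apply Rmult_le_pos; try apply pos_INR; try (apply pow_le; lra); lra.
Qed.

Definition growth_factor : R := exp (INR (length (multi_indices p)) * (4 * growth_rate)).

Lemma local_growth (a b a' b' : C) : inD2 (a, b) ->
  Cmod (a' - a)%C <= beta / l1 (a, b) -> Cmod (b' - b)%C <= beta / l2 (a, b) ->
  Cmod (F (a', b')) * Cmod (F (a', b')) <=
  growth_factor * lsum (multi_indices p) (fun x => Lterm F l1 l2 (a, b) (fst x) (snd x) * Lterm F l1 l2 (a, b) (fst x) (snd x)).
Proof.
intros Hz0 H1 H2. set (z0 := (a, b)) in *.
destruct (admissible_pos beta l1 l2 z0 ltac:(lra) Hadm Hz0) as [P1 [P2 [P3 P4]]].
simpl in P3, P4.
set (gam := fun t => (seg a a' t, seg b b' t)).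
assert (Hgam : forall t, 0 <= t <= 1 -> in_polydisc z0 (beta / l1 z0) (beta / l2 z0) (gam t)).
{ intros t Ht. split; simpl.
  - eapply Rle_trans; [now apply seg_dist|exact H1].
  - eapply Rle_trans; [now apply seg_dist|exact H2]. }
assert (HgamD : forall t, 0 <= t <= 1 -> inD2 (gam t)).
{ intros t Ht. apply (in_polydisc_inD2 a b _ _ _ _ P3 P4). now apply Hgam. }
set (wt := fun x : nat * nat => weight l1 l2 z0 (fst x) (snd x)).
assert (Hwt : forall x, 0 < wt x) by (intros x; now apply weight_pos).
set (g := fun (x : nat * nat) t => (RtoC (/ wt x) * Dpq F (fst x) (snd x) (gam t))%C).
set (dg := fun (x : nat * nat) t => (RtoC (/ wt x) * (D1 (Dpq F (fst x) (snd x)) (gam t) * (a' - a)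
   + D2 (Dpq F (fst x) (snd x)) (gam t) * (b' - b)))%C).
assert (Eg : forall x t, Cmod (g x t) = frozen_term z0 (gam t) x).
{ intros x t. unfold g, frozen_term. rewrite Cmod_mult, Cmod_R, Rabs_pos_eq by (left; now apply Rinv_0_lt_compat).
  unfold wt, Rdiv. ring. }
assert (G := gronwall_family (multi_indices p) g dg growth_rate growth_rate_pos).
assert (G1 : forall x t, In x (multi_indices p) -> 0 <= t <= 1 -> rderiv (g x) t (dg x t)).
{ intros x t _ Ht. unfold g, dg. eapply rderiv_val.
  - apply (rderiv_mult (fun _ => RtoC (/ wt x)) (fun t => Dpq F (fst x) (snd x) (gam t))); [apply rderiv_const|].
    apply rderiv_segment; [now apply analytic_Dpq|]. now apply HgamD.
  - unfold gam. ring. }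
specialize (G G1). clear G1.
assert (G2 : forall x t, In x (multi_indices p) -> 0 <= t <= 1 -> exists y1 y2, In y1 (multi_indices p) /\ In y2 (multi_indices p) /\
     Cmod (dg x t) <= growth_rate * (Cmod (g y1 t) + Cmod (g y2 t))).
{ intros [i j] t Hx Ht. apply in_multi_indices in Hx.
  destruct (frozen_derivative_bound z0 (gam t) i j (a' - a)%C (b' - b)%C) as [y1 [y2 [I1 [I2 B]]]]; auto.
  exists y1, y2. split; [auto|split; [auto|]]. rewrite !Eg. eapply Rle_trans; [|exact B].
  right. unfold dg. rewrite Cmod_mult, Cmod_R, Rabs_pos_eq by (left; now apply Rinv_0_lt_compat).
  unfold wt, Rdiv; simpl. ring. }
specialize (G G2). clear G2. fold growth_factor in G.
assert (Hsq : forall c, 0 <= sqmod c) by (intros c; unfold sqmod; nra).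
assert (I0 : In (0%nat, 0%nat) (multi_indices p)) by (apply in_multi_indices; lia).
assert (L := lsum_ge (multi_indices p) (fun x => sqmod (g x 1)) (0%nat, 0%nat) ltac:(intros; apply Hsq) I0).
cbv beta in L. rewrite sqmod_Cmod in L.
(* The index [(0, 0)] has weight 1, so at the far end of the segment its term is the modulus of [F]
   itself. *)
assert (Eg1 : Cmod (g (0%nat, 0%nat) 1) = Cmod (F (a', b'))).
{ rewrite Eg. unfold frozen_term, weight, gam. simpl. rewrite !seg_1. unfold Dpq; simpl. field. }
rewrite Eg1 in L. eapply Rle_trans; [exact L|]. eapply Rle_trans; [exact G|].
right. f_equal. unfold lsum. f_equal. apply functional_extensionality. intros x.
rewrite sqmod_Cmod, Eg. apply functional_extensionality. intros acc.
unfold frozen_term, gam. rewrite !seg_0. reflexivity.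
Qed.

Lemma hayman_bounded_index : bounded_L_index F l1 l2.
Proof.
set (len := INR (length (multi_indices p))).
assert (Hlen : 0 <= len) by apply pos_INR.
(* [local_growth] compares a square with a sum of [len] squares, each at most the square of the
   largest [Lterm] of order up to [p]; [B] is the resulting factor without squares. *)
set (B := sqrt (growth_factor * len)).
assert (HE : 0 < growth_factor) by apply exp_pos.
assert (HB0 : 0 <= B) by apply sqrt_pos.
assert (HB2 : B * B = growth_factor * len) by (apply sqrt_sqrt; apply Rmult_le_pos; lra).
(* Cauchy's estimate will bound [Lterm] times [beta ^ (i + j)] by [B] times the largest [Lterm] of
   order up to [p]; from degree [n1] on the power outweighs [B]. *)
destruct (Pow_x_infinity beta) with (b := B) as [n1 Hn1].
{ rewrite Rabs_pos_eq; lra. }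
exists (p + n1)%nat. intros [a b] Hz i j.
destruct (le_lt_dec (i + j) (p + n1)) as [Hij|Hij].
{ exists i, j. split; [auto|lra]. }
destruct (admissible_pos beta l1 l2 (a, b) ltac:(lra) Hadm Hz) as [P1 [P2 [P3 P4]]].
simpl in P3, P4.
set (LT := fun x : nat * nat => Lterm F l1 l2 (a, b) (fst x) (snd x)).
assert (HLT : forall x, 0 <= LT x) by (intros x; now apply Lterm_pos).
destruct (list_argmax (multi_indices p) LT (0%nat, 0%nat)) as [[k1 k2] [Ik Hk]].
{ apply in_multi_indices; lia. }
apply in_multi_indices in Ik.
exists k1, k2. split; [lia|].
set (T := LT (k1, k2)) in *. assert (HT : 0 <= T) by apply HLT.
assert (HM : forall u v, Cmod (u - a)%C <= beta / l1 (a, b) -> Cmod (v - b)%C <= beta / l2 (a, b) -> Cmod (F (u, v)) <= B * T).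
{ intros u v Hu Hv. assert (G := local_growth a b u v Hz Hu Hv).
  assert (S1 : lsum (multi_indices p) (fun x => LT x * LT x) <= len * (T * T)).
  { apply lsum_le. intros x Hx. apply Rmult_le_compat; auto. }
  apply Rsqr_incr_0_var; [|now apply Rmult_le_pos]. unfold Rsqr.
  eapply Rle_trans; [exact G|]. 
  apply Rle_trans with (growth_factor * (len * (T * T))); [apply Rmult_le_compat_l; [lra|exact S1]|].
  right. replace (B * T * (B * T)) with (B * B * (T * T)) by ring. rewrite HB2. ring. }
assert (R1 : 0 < beta / l1 (a, b)) by (apply Rdiv_lt_0_compat; lra).
assert (R2 : 0 < beta / l2 (a, b)) by (apply Rdiv_lt_0_compat; lra).
assert (Cy := bcoef_cauchy F a b _ _ _ i j HF R1 R2 P3 P4 HM).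
rewrite (bcoef_Lterm F l1 l2) in Cy by auto.
assert (Hpow : B <= beta ^ (i + j)).
{ specialize (Hn1 (i + j)%nat ltac:(lia)). rewrite Rabs_pos_eq in Hn1; [lra|]. apply pow_le; lra. }
assert (Hb : 0 < beta ^ (i + j)) by (apply pow_lt; lra).
apply Rmult_le_reg_r with (beta ^ (i + j)); auto.
eapply Rle_trans; [exact Cy|]. rewrite Rmult_comm. now apply Rmult_le_compat_l.
Qed.

End HaymanCondition.

(** Since [k0 <= p], the degree [p + 1] is never that of the main polynomial, whichever [k0] the
    point has; its coefficients are therefore all controlled by the non-main sum. *)
Lemma main_polynomial_hayman (beta : R) (l1 l2 : C * C -> R) (F : C * C -> C) (p : nat) (eta : R) :
  1 < beta -> admissible_L beta l1 l2 -> analytic_D2 F -> 0 < eta < 1 ->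
  (forall z0 : C * C, inD2 z0 -> exists r : R, eta < r < 1 /\
     exists k0 : nat, (k0 <= p)%nat /\ main_polynomial F z0 (r / l1 z0) (r / l2 z0) k0) ->
  forall z, inD2 z -> forall i j, (i + j = p + 1)%nat ->
  exists k1 k2, (k1 + k2 <= p)%nat /\ Lterm F l1 l2 z i j <= (/ eta) ^ (p + 1) * Lterm F l1 l2 z k1 k2.
Proof.
intros Hb Hadm HF Heta H [a b] Hz i j Hij.
destruct (admissible_pos beta l1 l2 (a, b) ltac:(lra) Hadm Hz) as [P1 [P2 [P3 P4]]].
simpl in P3, P4.
destruct (H _ Hz) as [r [Hr [k0 [Hk0 Hmain]]]].
(* The torus of radii [r / L] is seen as [t] times that of radii [beta / L], on whose polydisc [F]
   is still defined; [r < 1 < beta] gives [t < 1]. *)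
set (t := r / beta). 
assert (Ht : 0 < t < 1).
{ split; [apply Rdiv_lt_0_compat; lra|]. apply Rmult_lt_reg_r with beta; [lra|].
  unfold t. replace (r / beta * beta) with r by (field; lra). lra. }
assert (E1 : r / l1 (a, b) = t * (beta / l1 (a, b))) by (unfold t; field; lra).
assert (E2 : r / l2 (a, b) = t * (beta / l2 (a, b))) by (unfold t; field; lra).
rewrite E1, E2 in Hmain.
assert (R1 : 0 < beta / l1 (a, b)) by (apply Rdiv_lt_0_compat; lra).
assert (R2 : 0 < beta / l2 (a, b)) by (apply Rdiv_lt_0_compat; lra).
assert (B := main_polynomial_coef_bound F a b _ _ t k0 i j HF R1 R2 P3 P4 Ht Hmain ltac:(lia)).
rewrite <- E1, <- E2 in B. rewrite bcoef_Lterm, level_max_scaled in B by (auto; lra).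
rewrite Hij in B.
destruct (maxupto_attained (fun j => Lterm F l1 l2 (a, b) j (k0 - j)) k0) as [m [Hm Em]].
exists m, (k0 - m)%nat. split; [lia|]. unfold level_max in B. rewrite Em in B.
set (X := Lterm F l1 l2 (a, b) i j) in *. set (Y := Lterm F l1 l2 (a, b) m (k0 - m)) in *.
assert (HY : 0 <= Y) by now apply Lterm_pos.
assert (Hrp : 0 < r ^ (p + 1)) by (apply pow_lt; lra).
apply Rmult_le_reg_r with (r ^ (p + 1)); auto.
assert (Hrk : r ^ k0 <= 1) by (rewrite <- (pow1 k0); apply pow_incr; lra).
(* Division by [r ^ (p + 1)] costs at most [(/ eta) ^ (p + 1)] because [eta < r], while
   [r ^ k0 <= 1] on the other side. *)
assert (Q : 1 <= (/ eta) ^ (p + 1) * r ^ (p + 1)).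
{ rewrite <- Rpow_mult_distr. apply pow_R1_Rle. apply Rmult_le_reg_l with eta; [lra|].
  rewrite <- Rmult_assoc, Rinv_r by lra. lra. }
eapply Rle_trans; [exact B|].
replace ((/ eta) ^ (p + 1) * Y * r ^ (p + 1)) with ((/ eta) ^ (p + 1) * r ^ (p + 1) * Y) by ring.
assert (Y * r ^ k0 <= Y * 1) by (apply Rmult_le_compat_l; auto).
assert (1 * Y <= (/ eta) ^ (p + 1) * r ^ (p + 1) * Y) by (apply Rmult_le_compat_r; auto). lra.
Qed.

Theorem theorem8 (beta : R) (l1 l2 : C * C -> R) (F : C * C -> C) :
  1 < beta ->
  admissible_L beta l1 l2 ->
  Q2 beta l1 l2 ->
  analytic_D2 F ->
  (bounded_L_index F l1 l2 <->
   exists p : nat, forall d : R, 0 < d <= beta ->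
     exists eta : R, 0 < eta < d /\
       forall z0 : C * C, inD2 z0 ->
         exists r : R, eta < r < d /\
           exists k0 : nat, (k0 <= p)%nat /\
             main_polynomial F z0 (r / l1 z0) (r / l2 z0) k0).
Proof.
intros Hb Hadm HQ HF. split.
- intros HI. destruct (bounded_index_main_polynomial F l1 l2) as [p Hp]; auto.
  + intros z Hz. destruct (admissible_pos beta l1 l2 z ltac:(lra) Hadm Hz) as [P1 [P2 _]]. auto.
  + exists p. intros d Hd. apply Hp. lra.
(* The value [d = 1] is allowed since [1 < beta]. It forces [r < 1], which discards [r ^ k0] and
   leaves room between [r] and [beta]. *)
- intros [p Hp]. destruct (Hp 1 ltac:(lra)) as [eta [Heta H]].
  destruct (lambda_bounds_constant beta l1 l2 ltac:(lra) Hadm HQ) as [Lam [HLam Hcmp]].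
  apply (hayman_bounded_index beta l1 l2 F p ((/ eta) ^ (p + 1)) Lam); auto.
  + apply pow_R1_Rle. rewrite <- Rinv_1. apply Rinv_le_contravar; lra.
  + now apply main_polynomial_hayman with (beta := beta).
Qed.
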